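(* Let $E,F$ be exact operator spaces and let $C=d_{SK}(E)\,d_{SK}(F)$. Then every completely bounded map $u\colon E\to F^*$ factors through a Hilbert space and $$\gamma_2(u)\le 4C\|u\|_{cb}.$$
   Context: An operator space is a closed subspace of $B(H)$ for some Hilbert space $H$. $\|v\|_{cb}$ denotes the completely bounded norm, and $d_{cb}(E,G)=\inf\{\|v\|_{cb}\|v^{-1}\|_{cb}\}$ over all isomorphisms $v\colon E\to G$ ($=\infty$ if none). For a finite dimensional operator space $E$, $d_{SK}(E)=\inf\{d_{cb}(E,G): G\subset K(\ell_2)\}$, where $K(\ell_2)$ is the algebra of compact operators on $\ell_2$. For an infinite dimensional operator space $X$, $d_{SK}(X)=\sup d_{SK}(E)$ over all finite dimensional subspaces $E\subset X$. $X$ is called exact if $d_{SK}(X)<\infty$. $F^*$ denotes the operator space dual of $F$: the dual Banach space with matrix norms given by $M_n(F^* )=cb(F,M_n)$ isometrically. If an operator $u\colon X\to Y$ between Banach spaces factors as $u=\alpha\beta$ through a Hilbert space $H$, with bounded $\beta\colon X\to H$ and $\alpha\colon H\to Y$, then $\gamma_2(u)=\inf\{\|\alpha\|\,\|\beta\|\}$, the infimum being over all such factorizations. *)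

(* Defs.v *)
From HB Require Import structures.
From mathcomp Require Import all_boot all_order all_algebra.
From mathcomp Require Import all_classical all_reals all_analysis.
From mathcomp Require Import complex ring lra.
Set Implicit Arguments.
Unset Strict Implicit.
Unset Printing Implicit Defensive.
Import Order.TTheory GRing.Theory Num.Theory.
Import numFieldNormedType.Exports.
Local Open Scope classical_set_scope.
Local Open Scope ring_scope.
Local Open Scope complex_scope.

(* In a normed space over R[i] the norm `|x| is a (real) element of R[i];
   rnorm x is the same number as an element of R. *)
Definition rnorm (R : realType) (V : normedModType R[i]) (x : V) : R :=
  complex.Re `|x|.

Section rnorm_theory.
Variables (R : realType) (V : normedModType R[i]).
Implicit Types x y : V.

Lemma rnormE x : (rnorm x)%:C = `|x|.
Proof.
have : 0 <= `|x| := normr_ge0 x.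
by rewrite lecE /rnorm; case: `|x| => a b /= /andP[/eqP ->].
Qed.

Lemma rnorm_ge0 x : 0 <= rnorm x.
Proof. by rewrite -lecR rnormE; exact: normr_ge0. Qed.

Lemma rnorm0 : rnorm (0 : V) = 0.
Proof. by rewrite /rnorm normr0. Qed.

Lemma rnormD x y : rnorm (x + y) <= rnorm x + rnorm y.
Proof. by rewrite -lecR rmorphD /= !rnormE ler_normD. Qed.

Lemma rnormZ (a : R[i]) x : rnorm (a *: x) = rnorm (a : R[i]^o) * rnorm x.
Proof. by apply: complexI; rewrite rmorphM /= !rnormE normrZ. Qed.

Lemma rnorm0_eq0 x : rnorm x = 0 -> x = 0.
Proof. by move=> x0; apply/normr0_eq0; rewrite -rnormE x0. Qed.

Lemma rnormB x y : rnorm (x - y) = rnorm (y - x).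
Proof. by rewrite /rnorm distrC. Qed.

End rnorm_theory.

Section bounded_operators.
Variables (R : realType) (V W : normedModType R[i]).

Definition bounded_linear : {pred V -> W} := [pred f : V -> W |
  `[< linear f /\ exists M : R, forall x, rnorm (f x) <= M * rnorm x >]].

Lemma bounded_linear_submod : submod_closed bounded_linear.
Proof.
split.
  apply/asboolP; split=> [a x y|]; first by rewrite /= scaler0 addr0.
  by exists 0 => x; rewrite mul0r rnorm0.
move=> a f g /asboolP[fl [M fM]] /asboolP[gl [N gN]]; apply/asboolP; split.
  move=> b x y /=.
  rewrite -![(a *: f + g) _]/(a *: f _ + g _) fl gl !scalerDr !scalerA.
  by rewrite (mulrC a b) -!addrA; congr +%R; rewrite addrCA.
exists (rnorm (a : R[i]^o) * M + N) => x.
rewrite -[(a *: f + g) x]/(a *: f x + g x).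
apply: (le_trans (rnormD _ _)); rewrite rnormZ mulrDl lerD// -mulrA.
by rewrite ler_wpM2l// rnorm_ge0.
Qed.

HB.instance Definition _ := GRing.isSubmodClosed.Build R[i] (V -> W)
  bounded_linear bounded_linear_submod.

Record bop := Bop { bop_fun :> V -> W ; bopP : bop_fun \in bounded_linear }.

HB.instance Definition _ := [isSub for bop_fun].
HB.instance Definition _ := [Choice of bop by <:].
HB.instance Definition _ := [SubChoice_isSubLmodule of bop by <:].

Definition opnorm (T : bop) : R :=
  sup [set rnorm (T x) | x in [set x | rnorm x <= 1]].

Lemma bop_linear (T : bop) : linear T.
Proof. by have /asboolP[] := bopP T. Qed.

HB.instance Definition _ (T : bop) :=
  GRing.isLinear.Build R[i] V W *:%R T (bop_linear T).

Lemma opnorm_has_sup (T : bop) :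
  has_sup [set rnorm (T x) | x in [set x | rnorm x <= 1]].
Proof.
split; first by exists (rnorm (T 0)), 0 => //=; rewrite rnorm0.
have /asboolP[_ [M TM]] := bopP T; exists `|M| => _ [x /= x1 <-].
apply: (le_trans (TM x)); apply: (@le_trans _ _ (`|M| * rnorm x)).
  by rewrite ler_wpM2r ?rnorm_ge0// ler_norm.
by rewrite ler_piMr.
Qed.

Lemma opnorm_ub (T : bop) x : rnorm x <= 1 -> rnorm (T x) <= opnorm T.
Proof. by move=> x1; apply: (sup_upper_bound (opnorm_has_sup T)); exists x. Qed.

Lemma opnorm_ge0 (T : bop) : 0 <= opnorm T.
Proof.
by apply: (le_trans (rnorm_ge0 (T 0))); apply: opnorm_ub; rewrite rnorm0.
Qed.

Lemma opnormP (T : bop) x : rnorm (T x) <= opnorm T * rnorm x.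
Proof.
have [x0|x0] := eqVneq (rnorm x) 0.
  by rewrite (rnorm0_eq0 x0) linear0 !rnorm0 mulr0.
have xgt0 : 0 < rnorm x by rewrite lt_def x0 rnorm_ge0.
have nr : rnorm ((rnorm x)^-1%:C : R[i]^o) = (rnorm x)^-1.
  apply: complexI; rewrite rnormE ger0_norm// ler0c invr_ge0; exact: rnorm_ge0.
rewrite -ler_pdivrMr// mulrC -nr -rnormZ -linearZ; apply: opnorm_ub.
by rewrite rnormZ nr mulVf.
Qed.

Lemma opnorm_le (T : bop) (M : R) : 0 <= M ->
  (forall x, rnorm (T x) <= M * rnorm x) -> opnorm T <= M.
Proof.
move=> M0 TM; apply: ge_sup; first by have [] := opnorm_has_sup T.
by move=> _ [x /= x1 <-]; apply: (le_trans (TM x)); rewrite ler_piMr.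
Qed.

Lemma opnormD (S T : bop) : (opnorm (S + T))%:C <= (opnorm S)%:C + (opnorm T)%:C.
Proof.
rewrite -rmorphD lecR; apply: opnorm_le; first by rewrite addr_ge0// opnorm_ge0.
move=> x; rewrite mulrDl; apply: (le_trans (rnormD _ _)).
by apply: lerD; exact: opnormP.
Qed.

Lemma opnormZ (a : R[i]) (T : bop) : (opnorm (a *: T))%:C = `|a| * (opnorm T)%:C.
Proof.
have le b S : opnorm (b *: S) <= rnorm (b : R[i]^o) * opnorm S.
  apply: opnorm_le; first by rewrite mulr_ge0 ?rnorm_ge0 ?opnorm_ge0.
  move=> x; rewrite -[(b *: S) x]/(b *: S x) rnormZ -mulrA ler_wpM2l ?rnorm_ge0//.
  exact: opnormP.
suff : opnorm (a *: T) = rnorm (a : R[i]^o) * opnorm T.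
  by move=> ->; rewrite rmorphM /= rnormE.
apply/eqP; rewrite eq_le le /=.
have [->|a0] := eqVneq a 0; first by rewrite rnorm0 mul0r opnorm_ge0.
rewrite -ler_pdivlMl; last first.
  rewrite lt_def rnorm_ge0 andbT; apply: contra_neq a0; exact: rnorm0_eq0.
have -> : (rnorm (a : R[i]^o))^-1 = rnorm (a^-1 : R[i]^o).
  by apply: complexI; rewrite fmorphV !rnormE normfV.
by rewrite -{1}[T](scalerK a0) le.
Qed.

Lemma opnorm0_eq0 (T : bop) : (opnorm T)%:C = 0 -> T = 0.
Proof.
move=> /complexI T0; apply: val_inj; apply/funext => x /=.
apply: rnorm0_eq0; apply/eqP; rewrite eq_le rnorm_ge0 andbT.
by have := opnormP T x; rewrite T0 mul0r.
Qed.

HB.instance Definition _ :=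
  Lmodule_isNormed.Build R[i] bop opnormD opnormZ opnorm0_eq0.

End bounded_operators.

HB.mixin Record isHilbert (R : realType) H & CompleteNormedModule R[i] H := {
  dotp : {dot H for (@Num.conj R[i])};
  dotp_norm : forall x : H, `|x| ^+ 2 = dotp x x }.
#[short(type="hilbertType")]
HB.structure Definition Hilbert (R : realType) :=
  {H of CompleteNormedModule R[i] H & isHilbert R H}.

Section complex_convergence.
Variable R : realType.
Implicit Types z : R[i]^o.

Lemma rnorm_sqr z : rnorm z ^+ 2 = complex.Re z ^+ 2 + complex.Im z ^+ 2.
Proof.
by case: z => a b /=; rewrite /rnorm /= sqr_sqrtr// addr_ge0 ?sqr_ge0.
Qed.

Lemma rnorm_Re z : `|complex.Re z| <= rnorm z.
Proof.
rewrite -(@ler_pXn2r _ 2) ?nnegrE ?rnorm_ge0// real_normK ?num_real//.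
by rewrite rnorm_sqr lerDl sqr_ge0.
Qed.

Lemma rnorm_Im z : `|complex.Im z| <= rnorm z.
Proof.
rewrite -(@ler_pXn2r _ 2) ?nnegrE ?rnorm_ge0// real_normK ?num_real//.
by rewrite rnorm_sqr lerDr sqr_ge0.
Qed.

Lemma rnorm_le_ReIm z : rnorm z <= `|complex.Re z| + `|complex.Im z|.
Proof.
rewrite -(@ler_pXn2r _ 2) ?nnegrE ?rnorm_ge0 ?addr_ge0//.
rewrite rnorm_sqr sqrrD !real_normK ?num_real// lerD2r lerDl.
by rewrite mulrn_wge0// mulr_ge0.
Qed.

Lemma gt0_complexP (e : R[i]) : 0 < e -> exists2 r : R, 0 < r & e = r%:C.
Proof.
by case: e => a b; rewrite ltcE /= => /andP[/eqP-> a0]; exists a.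
Qed.

Lemma rnorm_cvgP (V : normedModType R[i]) (F : set_system V) (l : V) :
  Filter F -> (forall e : R, 0 < e -> \forall x \near F, rnorm (l - x) <= e) ->
  F --> l.
Proof.
move=> FF H; apply/cvgrPdist_le => _ /gt0_complexP[r r0 ->].
by apply: filterS (H r r0) => x; rewrite -lecR rnormE.
Qed.

Lemma cvg_rnormP (T : Type) (V : normedModType R[i]) (F : set_system T)
    (f : T -> V) (l : V) : Filter F ->
  (f @ F --> l <->
   forall e : R, 0 < e -> \forall x \near F, rnorm (l - f x) <= e).
Proof.
move=> FF; split=> [fl e e0|H]; last exact: rnorm_cvgP.
have ec0 : 0 < e%:C :> R[i] by rewrite ltcR.
move/cvgrPdist_le: fl => /(_ _ ec0); apply: filterS => x.
by rewrite -lecR rnormE.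
Qed.

Lemma cvg_ReIm (T : Type) (F : set_system T) (f : T -> R[i]^o) (a b : R) :
  Filter F -> @complex.Re R \o f @ F --> a -> @complex.Im R \o f @ F --> b ->
  f @ F --> (a +i* b : R[i]^o).
Proof.
move=> FF /cvgrPdist_le fa /cvgrPdist_le fb; apply/cvg_rnormP => e e0.
have e20 : 0 < e / 2 by rewrite divr_gt0.
near=> x; apply: (le_trans (rnorm_le_ReIm _)); rewrite [e]splitr lerD//.
  suff -> : complex.Re ((a +i* b) - f x) = a - (@complex.Re R \o f) x.
    by near: x; exact: fa.
  by rewrite /=; case: (f x).
suff -> : complex.Im ((a +i* b) - f x) = b - (@complex.Im R \o f) x.
  by near: x; exact: fb.
by rewrite /=; case: (f x).
Unshelve. all: by end_near. Qed.

Lemma complex_complete (F : set_system R[i]^o) :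
  ProperFilter F -> cauchy F -> cvg F.
Proof.
move=> FF /cauchy_ballP Fc.
have cv (p : R[i] -> R) :
    (forall y z : R[i]^o, `|p y - p z| <= rnorm (y - z)) -> cvg (p @ F).
  move=> plip; apply: R_complete; apply/cauchy_ballP => e e0.
  rewrite near_simpl.
  have ec0 : 0 < e%:C :> R[i] by rewrite ltcR.
  have := Fc _ ec0; rewrite near_simpl => -[[A B] /= [FA FB] AB].
  exists (A, B) => //= -[y z] /= [Ay Bz]; rewrite -ball_normE /=.
  have := AB (y, z) (conj Ay Bz); rewrite /= -ball_normE /= => yz.
  by apply: (le_lt_trans (plip y z)); rewrite -ltcR rnormE.
have /cvg_ex[a Fa] : cvg (@complex.Re R @ F).
  by apply: cv => y z; apply: (le_trans _ (rnorm_Re _)); case: y z => ? ? [].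
have /cvg_ex[b Fb] : cvg (@complex.Im R @ F).
  by apply: cv => y z; apply: (le_trans _ (rnorm_Im _)); case: y z => ? ? [].
by apply/cvg_ex; exists (a +i* b); exact: (@cvg_ReIm _ F id).
Qed.

HB.instance Definition _ := Uniform_isComplete.Build R[i]^o complex_complete.

Lemma rnorm_series_cvg (u : R[i]^o ^nat) :
  cvgn (series (fun k => rnorm (u k))) -> cvgn (series u).
Proof.
move=> cu.
have cv (p : {additive R[i] -> R}) : (forall z, `|p z| <= rnorm (z : R[i]^o)) ->
    cvgn (p \o series u).
  move=> ple; have -> : p \o series u = series (p \o u).
    by apply/funext => n; rewrite /series /= raddf_sum.
  apply: normed_cvg; apply: series_le_cvg cu => k; rewrite ?normr_ge0 ?rnorm_ge0//=; exact: ple.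
have := cv (@complex.Re R : {additive Rcomplex R -> R}) rnorm_Re.
move=> /cvg_ex[a ua].
have := cv (@complex.Im R : {additive Rcomplex R -> R}) rnorm_Im.
move=> /cvg_ex[b ub].
by apply/cvg_ex; exists (a +i* b); exact: cvg_ReIm.
Qed.

End complex_convergence.

Section dot_triangle.
Variables (C : numClosedFieldType) (U : lmodType C) (f : {dot U for (@Num.conj C)}).

Lemma dot_CauchySchwarz (u v : U) : `|f u v| ^+ 2 <= f u u * f v v.
Proof.
have [->|v0] := eqVneq v 0.
  by rewrite !(linear0r f) normr0 expr0n/= mulr0.
have vv0 : f v v != 0 by rewrite dnorm_eq0.
pose a := f u v / f v v; pose w := u - a *: v.
have wv : f w v = 0.
  by rewrite linearBl/= linearZl_LR divfK// subrr.
have -> : f u u = f w w + `|a| ^+ 2 * f v v.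
  have -> : u = w + a *: v by rewrite /w subrK.
  by rewrite hnormDd/= ?dnormZ ?linearZr_LR/= ?wv ?mulr0.
rewrite mulrDl -[leLHS]add0r lerD//.
  by rewrite mulr_ge0// dnorm_ge0.
have -> : f u v = a * f v v by rewrite /a divfK.
rewrite normrM exprMn (ger0_norm (dnorm_ge0 _ _)).
by rewrite -[leRHS]mulrA -expr2.
Qed.

Lemma dot_triangle (u v : U) :
  sqrtC (f (u + v) (u + v)) <= sqrtC (f u u) + sqrtC (f v v).
Proof.
have s0 w : 0 <= sqrtC (f w w) by rewrite sqrtC_ge0 dnorm_ge0.
rewrite -(@ler_pXn2r _ 2) ?nnegrE ?addr_ge0// sqrrD !sqrtCK dnormD.
rewrite addrAC lerD2r lerD2l.
have -> : f u v + (f u v)^*%R = 'Re (f u v) *+ 2.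
  by rewrite ReE -mulr_natr divfK// pnatr_eq0.
rewrite lerMn2r/=; apply: (le_trans (leif_Re_Creal _)).
rewrite -(@ler_pXn2r _ 2) ?nnegrE ?mulr_ge0// exprMn !sqrtCK.
exact: dot_CauchySchwarz.
Qed.
End dot_triangle.

Section ell2.
Variable R : realType.

Lemma rnorm_dist (V : normedModType R[i]) (x y : V) :
  `|rnorm x - rnorm y| <= rnorm (x - y).
Proof.
have h (a b : V) : rnorm a - rnorm b <= rnorm (a - b).
  by rewrite lerBlDr -{1}(subrK b a) rnormD.
by rewrite ler_norml h andbT lerNl opprB rnormB h.
Qed.

Lemma cvg_rnorm (T : Type) (V : normedModType R[i]) (F : set_system T)
    (f : T -> V) (l : V) : Filter F -> f @ F --> l -> rnorm (f x) @[x --> F] --> rnorm l.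
Proof.
move=> FF /cvg_rnormP fl; apply/cvgrPdist_le => e e0.
by apply: filterS (fl e e0) => x; apply: le_trans; exact: rnorm_dist.
Qed.

Definition square_summable : {pred nat -> R[i]^o} := [pred x : nat -> R[i]^o |
  `[< cvgn (series (fun k => rnorm (x k) ^+ 2)) >]].

Lemma square_summable_submod : submod_closed square_summable.
Proof.
split.
  apply/asboolP; rewrite (_ : series _ = cst 0); first exact: is_cvg_cst.
  by apply/funext => n; rewrite /series /= big1// => k _; rewrite rnorm0 expr0n.
move=> a x y /asboolP cx /asboolP cy; apply/asboolP.
pose u : R^nat := (2 * rnorm (a : R[i]^o) ^+ 2) *: (fun k => rnorm (x k) ^+ 2).
pose v : R^nat := (2 : R) *: (fun k => rnorm (y k) ^+ 2).
apply: (@series_le_cvg _ _ (u + v)) => [k|k|k|].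
- exact: sqr_ge0.
- rewrite -[(u + v) k]/(2 * _ ^+ 2 * _ ^+ 2 + 2 * _ ^+ 2).
  by apply: addr_ge0; apply: mulr_ge0; rewrite ?mulr_ge0 ?rnorm_ge0.
- rewrite -[(a *: x + y) k]/(a *: x k + y k) -[(u + v) k]/(_ * _ + _ * _).
  have := rnormD (a *: x k) (y k); rewrite rnormZ.
  have := rnorm_ge0 (a *: x k + y k).
  set p := rnorm (a *: _ + _); set q := rnorm _; set r := rnorm _.
  set s := rnorm _ => p0 le.
  apply: (@le_trans _ _ ((q * r + s) ^+ 2)).
    by rewrite ler_pXn2r// nnegrE (le_trans p0).
  have := sqr_ge0 (q * r - s); nra.
- by apply: is_cvg_seriesD; exact: is_cvg_seriesZ.
Qed.

HB.instance Definition _ := GRing.isSubmodClosed.Build R[i] (nat -> R[i]^o)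
  square_summable square_summable_submod.

Record ell2 := Ell2 { ell2_fun :> nat -> R[i]^o ; ell2P : ell2_fun \in square_summable }.

HB.instance Definition _ := [isSub for ell2_fun].
HB.instance Definition _ := [Choice of ell2 by <:].
HB.instance Definition _ := [SubChoice_isSubLmodule of ell2 by <:].

Implicit Types x y : ell2.

Definition ell2_dot x y : R[i] :=
  limn (series (fun k => x k * Num.conj (y k) : R[i]^o)).

Lemma ell2_sqr_cvg x : cvgn (series (fun k => rnorm (x k) ^+ 2)).
Proof. by have /asboolP := ell2P x. Qed.

Lemma rnormM (a b : R[i]^o) : rnorm (a * b : R[i]^o) = rnorm a * rnorm b.
Proof. exact: rnormZ. Qed.

Lemma rnorm_conj (a : R[i]^o) : rnorm (Num.conj a : R[i]^o) = rnorm a.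
Proof. by rewrite /rnorm norm_conjC. Qed.

Lemma ell2_dot_cvg x y : cvgn (series (fun k => x k * Num.conj (y k) : R[i]^o)).
Proof.
apply: rnorm_series_cvg.
have cxy := is_cvg_seriesD (@ell2_sqr_cvg x) (@ell2_sqr_cvg y).
apply: series_le_cvg cxy => k /=; rewrite ?rnorm_ge0//.
  by rewrite addr_ge0// sqr_ge0.
rewrite rnormM rnorm_conj -[leRHS]/(_ ^+ 2 + _ ^+ 2).
have := rnorm_ge0 (x k); have := rnorm_ge0 (y k).
set p := rnorm (x k); set q := rnorm (y k) => q0 p0.
by have := sqr_ge0 (p - q); nra.
Qed.

Lemma ell2_dot_linear y : linear_for *%R (ell2_dot^~ y).
Proof.
move=> a x z; apply: (@cvg_lim R[i]^o) => //.
rewrite (_ : series _ =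
  (a : R[i]^o) *: series (fun k => x k * Num.conj (y k) : R[i]^o) +
  series (fun k => z k * Num.conj (y k) : R[i]^o)).
  by apply: cvgD; [apply: cvgZl_tmp|]; exact: ell2_dot_cvg.
rewrite -seriesZ -seriesD; congr series; apply/funext => k.
by rewrite -[(a *: x + z) k]/(a * x k + z k) mulrDl -mulrA.
Qed.

Lemma ell2_dotC x y : ell2_dot x y = Num.conj (ell2_dot y x).
Proof.
apply: (@cvg_lim R[i]^o) => //; apply/cvg_rnormP => e e0.
have /cvg_rnormP/(_ e e0) := @ell2_dot_cvg y x.
apply: filterS => n; congr (_ <= _).
rewrite -[LHS]rnorm_conj rmorphB /=; congr (rnorm (_ - _)).
rewrite /series /= rmorph_sum /=; apply: eq_bigr => k _.
by rewrite rmorphM /= conjCK mulrC.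
Qed.

Lemma ell2_dotE x : ell2_dot x x = (limn (series (fun k => rnorm (x k) ^+ 2)))%:C.
Proof.
apply: (@cvg_lim R[i]^o) => //; apply: cvg_ReIm.
  rewrite (_ : _ \o _ = series (fun k => rnorm (x k) ^+ 2)).
    exact: ell2_sqr_cvg.
  apply/funext => n; rewrite /= /series /=.
  rewrite (raddf_sum (@complex.Re R : {additive Rcomplex R -> R})).
  by apply: eq_bigr => k _; rewrite -normCK -rnormE -rmorphXn.
rewrite (_ : _ \o _ = cst 0); first exact: cvg_cst.
apply/funext => n; rewrite /= /series /=.
rewrite (raddf_sum (@complex.Im R : {additive Rcomplex R -> R})).
by apply: big1 => k _; rewrite -normCK -rnormE -rmorphXn.
Qed.

Lemma ell2_partial_le x n :
  \sum_(0 <= k < n) rnorm (x k) ^+ 2 <= limn (series (fun k => rnorm (x k) ^+ 2)).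
Proof.
apply: (nondecreasing_cvgn_le _ (@ell2_sqr_cvg x)).
by apply: nondecreasing_series => k _ _; exact: sqr_ge0.
Qed.

Lemma ell2_dot_gt0 x : x != 0 -> 0 < ell2_dot x x.
Proof.
move=> x0; rewrite ell2_dotE ltcR.
have [k xk] : exists k, x k != 0.
  apply: contrapT => /forallNP x00; move/negP: x0; apply; apply/eqP/val_inj/funext => k /=.
  by have /negP := x00 k; rewrite negbK => /eqP.
apply: lt_le_trans (ell2_partial_le x k.+1).
rewrite big_nat_recr//= ltr_wpDl//; first by rewrite sumr_ge0// => i _; exact: sqr_ge0.
rewrite exprn_gt0// lt_def rnorm_ge0 andbT.
by apply: contra_neq xk; exact: rnorm0_eq0.
Qed.

Lemma ell2_dot_bilinear : bilinear_for *%R (Num.conj \; *%R) ell2_dot.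
Proof.
split=> [y|x]; first exact: ell2_dot_linear.
move=> a y z; rewrite !(ell2_dotC x) ell2_dot_linear rmorphD rmorphM /=.
by [].
Qed.

HB.instance Definition _ := @bilinear_isBilinear.Build R[i] ell2 ell2 R[i]
  *%R (Num.conj \; *%R) ell2_dot ell2_dot_bilinear.

Lemma ell2_dot_hermitian x y : ell2_dot x y = (-1) ^+ false * Num.conj (ell2_dot y x).
Proof. by rewrite expr0 mul1r ell2_dotC. Qed.

HB.instance Definition _ := isHermitianSesquilinear.Build R[i] ell2 false
  (@Num.conj R[i]) ell2_dot ell2_dot_hermitian.
HB.instance Definition _ := isDotProduct.Build R[i] ell2 ell2_dot ell2_dot_gt0.

Definition ell2_norm x : R[i] := sqrtC (ell2_dot x x).

Lemma ell2_normD x y : ell2_norm (x + y) <= ell2_norm x + ell2_norm y.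
Proof. exact: (dot_triangle (ell2_dot : {dot ell2 for (@Num.conj R[i])})). Qed.

Lemma ell2_normZ (a : R[i]) x : ell2_norm (a *: x) = `|a| * ell2_norm x.
Proof.
rewrite /ell2_norm (dnormZ (ell2_dot : {dot ell2 for (@Num.conj R[i])})).
by rewrite sqrtCM ?nnegrE ?exprn_ge0// ?sqrCK.
Qed.

Lemma ell2_norm0_eq0 x : ell2_norm x = 0 -> x = 0.
Proof.
move=> /eqP; rewrite (sqrt_dnorm_eq0 (ell2_dot : {dot ell2 for (@Num.conj R[i])})).
by move/eqP.
Qed.

HB.instance Definition _ :=
  Lmodule_isNormed.Build R[i] ell2 ell2_normD ell2_normZ ell2_norm0_eq0.

Lemma ell2_norm_sqr x : `|x| ^+ 2 = ell2_dot x x.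
Proof. exact: sqrtCK. Qed.

Lemma ell2_rnorm_sqr x : rnorm x ^+ 2 = limn (series (fun k => rnorm (x k) ^+ 2)).
Proof. by apply: complexI; rewrite rmorphXn /= rnormE ell2_norm_sqr ell2_dotE. Qed.

Lemma ell2_rnorm_ge x n : \sum_(0 <= k < n) rnorm (x k) ^+ 2 <= rnorm x ^+ 2.
Proof. by rewrite ell2_rnorm_sqr; exact: ell2_partial_le. Qed.

Lemma ell2_coord_le x k : rnorm (x k) <= rnorm x.
Proof.
rewrite -(@ler_pXn2r _ 2) ?nnegrE ?rnorm_ge0//.
apply: le_trans (ell2_rnorm_ge x k.+1).
by rewrite big_nat_recr//= lerDr sumr_ge0// => i _; exact: sqr_ge0.
Qed.

Lemma square_summableP (x : nat -> R[i]^o) (M : R) :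
  (forall n, \sum_(0 <= k < n) rnorm (x k) ^+ 2 <= M) -> x \in square_summable.
Proof.
move=> xM; apply/asboolP; apply: nondecreasing_is_cvgn.
  by apply: nondecreasing_series => k _ _; exact: sqr_ge0.
by exists M => _ [n _ <-]; exact: xM.
Qed.

Lemma ell2_rnorm_le x (M : R) : 0 <= M ->
  (forall n, \sum_(0 <= k < n) rnorm (x k) ^+ 2 <= M ^+ 2) -> rnorm x <= M.
Proof.
move=> M0 xM; rewrite -(@ler_pXn2r _ 2) ?nnegrE ?rnorm_ge0// ell2_rnorm_sqr.
apply: limr_le; first exact: ell2_sqr_cvg.
by near=> n; exact: xM.
Unshelve. all: by end_near. Qed.

Lemma ell2_complete (F : set_system ell2) : ProperFilter F -> cauchy F -> cvg F.
Proof.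
move=> FF /cauchy_ballP Fc.
have Fc' (e : R) : 0 < e ->
    \forall x \near F, \forall y \near F, rnorm (x - y) <= e.
  move=> e0; have ec0 : 0 < e%:C :> R[i] by rewrite ltcR.
  have /nearP_dep := Fc _ ec0; apply: filterS => x; apply: filterS => y.
  by rewrite -ball_normE /= -rnormE ltcR; exact: ltW.
have Fk k : cvg ((fun x : ell2 => x k : R[i]^o) @ F).
  apply: complex_complete; apply/cauchy_ballP => e e0; rewrite near_simpl.
  have := Fc _ e0; rewrite near_simpl => -[[A B] /= [FA FB] AB].
  exists (A, B) => //= -[y z] /= [Ay Bz]; rewrite -ball_normE /=.
  have := AB (y, z) (conj Ay Bz); rewrite /= -ball_normE /=.
  by apply: le_lt_trans; rewrite -!rnormE lecR; exact: (ell2_coord_le (y - z)).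
pose l : nat -> R[i]^o := fun k => lim ((fun x : ell2 => x k : R[i]^o) @ F).
have Fl k : (fun x : ell2 => x k : R[i]^o) @ F --> l k by exact: Fk.
have Fle (e : R) : 0 < e -> \forall x \near F, forall n,
    \sum_(0 <= k < n) rnorm (l k - (x : ell2) k : R[i]^o) ^+ 2 <= e ^+ 2.
  move=> e0; apply: filterS (Fc' e e0) => x xy n.
  have cv : (fun y : ell2 => \sum_(0 <= k < n) rnorm (y k - x k : R[i]^o) ^+ 2)
      @ F --> \sum_(0 <= k < n) rnorm (l k - x k : R[i]^o) ^+ 2.
    elim: n => [|n IH].
      rewrite big_geq//; rewrite (_ : (fun _ => _) = cst 0); first exact: cvg_cst.
      by apply/funext => y; rewrite big_geq.
    rewrite big_nat_recr//=.
    rewrite (_ : (fun _ => _) = (fun y : ell2 =>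
      \sum_(0 <= k < n) rnorm (y k - x k : R[i]^o) ^+ 2) +
      (fun y : ell2 => rnorm (y n - x n : R[i]^o) ^+ 2)); last first.
      by apply/funext => y; rewrite big_nat_recr.
    apply: cvgD => //.
    have cn : (fun y : ell2 => rnorm (y n - x n : R[i]^o)) @ F
        --> rnorm (l n - x n : R[i]^o).
      by apply: cvg_rnorm; apply: cvgB; [exact: Fl|exact: cvg_cst].
    by rewrite expr2; under eq_fun do rewrite expr2; exact: cvgM.
  rewrite -(cvg_lim _ cv)//; apply: limr_le; first by apply/cvg_ex; eexists; exact: cv.
  near=> y; apply: (le_trans (ell2_rnorm_ge (y - x) n)).
  rewrite ler_pXn2r ?nnegrE ?rnorm_ge0 ?(ltW e0)// rnormB.
  by near: y.
have l2 : l \in square_summable.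
  have [x xl] := filter_ex (Fle 1 ltr01).
  have -> : l = (l - ell2_fun x) + ell2_fun x by rewrite subrK.
  by apply: rpredD; [apply: (@square_summableP _ (1 ^+ 2)); exact: xl|exact: ell2P].
apply/cvg_ex; exists (Ell2 l2); apply: rnorm_cvgP => e e0.
apply: filterS (Fle e e0) => x xl.
by apply: ell2_rnorm_le; [exact: ltW|exact: xl].
Unshelve. all: by end_near. Qed.

HB.instance Definition _ := Uniform_isComplete.Build ell2 ell2_complete.
HB.instance Definition _ := isHilbert.Build R ell2 ell2_norm_sqr.
End ell2.

(* A complex vector space V together with a matrix norm on each M_n(V). No
   axioms are imposed: the instances below (operator spaces, their duals and
   the matrix algebras M_n) are concrete. Values lie in \bar R so that a
   supremum needs no finiteness proof. *)
HB.mixin Record hasMxNorm (R : realType) V & GRing.Lmodule R[i] V := {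
  mxnorm : forall n, 'M[V]_n -> \bar R }.
#[short(type="mxNormedType")]
HB.structure Definition MxNormed (R : realType) :=
  {V of GRing.Lmodule R[i] V & hasMxNorm R V}.
Arguments mxnorm {R s n} _.

Section completely_bounded.
Variable R : realType.

Definition cbnorm (V W : mxNormedType R) (u : V -> W) : \bar R :=
  ereal_sup [set t | exists n (x : 'M[V]_n),
    (mxnorm x <= 1)%E /\ t = mxnorm (map_mx u x)].

Definition completely_bounded (V W : mxNormedType R) (u : V -> W) : Prop :=
  (cbnorm u < +oo)%E.

(* ereal_inf set0 = +oo, so dcb V W = +oo when V and W are not isomorphic.
   Between operator spaces the product is never 0 * +oo: the cb norm of an
   isomorphism vanishes only if V = W = 0. *)
Definition dcb (V W : mxNormedType R) : \bar R :=
  ereal_inf [set t | exists (v : {linear V -> W}) (w : {linear W -> V}),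
    [/\ cancel v w, cancel w v & t = (cbnorm v * cbnorm w)%E]].

End completely_bounded.

Section matrix_algebra.
Variables (R : realType) (n : nat).

Definition Mn := 'M[R[i]]_n.

HB.instance Definition _ := GRing.Lmodule.on Mn.

(* M_k(M_n) is identified with M_(kn) = B(C^k (x) C^n): the vector xi is
   indexed by pairs (j, q). *)
Definition Mn_mxnorm k (A : 'M[Mn]_k) : \bar R :=
  ereal_sup [set (Num.sqrt (\sum_(i < k) \sum_(p < n)
      rnorm (\sum_(j < k) \sum_(q < n) (A i j : 'M[R[i]]_n) p q * xi j q : R[i]^o) ^+ 2))%:E
    | xi in [set xi : 'M[R[i]]_(k, n) |
        \sum_(j < k) \sum_(q < n) rnorm (xi j q : R[i]^o) ^+ 2 <= 1]].

HB.instance Definition _ := hasMxNorm.Build R Mn Mn_mxnorm.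

End matrix_algebra.

Section operator_spaces.
Variables (R : realType) (H : hilbertType R).

(* The norm of a as an operator on the Hilbertian direct sum of n copies of H *)
Definition opmx_norm n (a : 'M[bop H H]_n) : \bar R :=
  ereal_sup [set (Num.sqrt (\sum_(i < n) rnorm (\sum_(j < n) a i j (xi j)) ^+ 2))%:E
    | xi in [set xi : 'I_n -> H | \sum_(j < n) rnorm (xi j) ^+ 2 <= 1]].

Definition compact_op : set (bop H H) :=
  [set T | precompact (T @` [set x | rnorm x <= 1])].

Record opspace := OpSpace {
  opset : set (bop H H) ;
  opset_submod : submod_closed [pred T | T \in opset] ;
  opset_closed : closed opset }.

Section elements.
Variable E : opspace.

Definition opset_pred : {pred bop H H} := [pred T | T \in opset E].

HB.instance Definition _ := GRing.isSubmodClosed.Build R[i] (bop H H)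
  opset_pred (opset_submod E).

Record opelt := OpElt { opval :> bop H H ; opvalP : opval \in opset_pred }.

HB.instance Definition _ := [isSub for opval].
HB.instance Definition _ := [Choice of opelt by <:].
HB.instance Definition _ := [SubChoice_isSubLmodule of opelt by <:].

Definition opelt_norm (x : opelt) : R[i] := `|opval x|.

Lemma opelt_normD x y : opelt_norm (x + y) <= opelt_norm x + opelt_norm y.
Proof. exact: ler_normD. Qed.

Lemma opelt_normZ (a : R[i]) x : opelt_norm (a *: x) = `|a| * opelt_norm x.
Proof. exact: normrZ. Qed.

Lemma opelt_norm0_eq0 x : opelt_norm x = 0 -> x = 0.
Proof. by move=> /normr0_eq0 x0; exact: val_inj. Qed.

HB.instance Definition _ := Lmodule_isNormed.Build R[i] opelt
  opelt_normD opelt_normZ opelt_norm0_eq0.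

HB.instance Definition _ := hasMxNorm.Build R opelt
  (fun n x => opmx_norm (map_mx opval x)).

End elements.
End operator_spaces.

Coercion opelt : opspace >-> Sortclass.

Section operator_space_dual.
Variables (R : realType) (H : hilbertType R) (F : opspace H).

Definition odual := bop F R[i]^o.

HB.instance Definition _ := NormedModule.copy odual (bop F R[i]^o).

(* M_n (F^* ) = cb (F, M_n), isometrically *)
Definition odual_mxnorm n (f : 'M[odual]_n) : \bar R :=
  cbnorm (fun x : F => \matrix_(i, j) (f i j : bop F R[i]^o) x : Mn R n).

HB.instance Definition _ := hasMxNorm.Build R odual odual_mxnorm.

End operator_space_dual.

Section exactness.
Variable R : realType.

Definition finite_dim (V : lmodType R[i]) : Prop :=
  exists n (e : 'I_n -> V), forall x : V,
    exists c : 'I_n -> R[i], x = \sum_(i < n) c i *: e i.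

Definition dSK_fin (H : hilbertType R) (E : opspace H) : \bar R :=
  ereal_inf [set dcb E G | G in
    [set G : opspace (ell2 R) | opset G `<=` @compact_op R (ell2 R)]].

(* The fields of opspace make E and G closed; this excludes nothing here, a
   finite dimensional subspace being closed. *)
Definition dSK (H : hilbertType R) (X : opspace H) : \bar R :=
  if `[< finite_dim X >] then dSK_fin X
  else ereal_sup [set dSK_fin E | E in
    [set E : opspace H | opset E `<=` opset X /\ finite_dim E]].

Definition exact_opspace (H : hilbertType R) (X : opspace H) : Prop :=
  (dSK X < +oo)%E.

End exactness.

Section hilbert_factorization.
Variables (R : realType) (X Y : normedModType R[i]) (u : X -> Y).

Definition factors_through (H : hilbertType R) (beta : bop X H) (alpha : bop H Y) : Prop :=
  forall x, u x = alpha (beta x).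

Definition hilbert_factorable : Prop :=
  exists (H : hilbertType R) (beta : bop X H) (alpha : bop H Y),
    factors_through beta alpha.

Definition gamma2 : \bar R :=
  ereal_inf [set t | exists (H : hilbertType R) (beta : bop X H) (alpha : bop H Y),
    factors_through beta alpha /\ t = (rnorm alpha * rnorm beta)%:E].

End hilbert_factorization.

(* Main.v *)
From HB Require Import structures.
Require Import Defs.
From mathcomp Require Import all_boot all_order all_algebra all_fingroup.
From mathcomp Require Import all_classical all_reals all_analysis.
From mathcomp Require Import complex ring lra zify.
Set Implicit Arguments.
Unset Strict Implicit.
Unset Printing Implicit Defensive.
Import Order.TTheory GRing.Theory Num.Theory.
Import numFieldNormedType.Exports.
Local Open Scope ring_scope.

(** The proof has two halves: a Grothendieck inequality for families of vectors,
    and a duality argument that turns it into a factorization.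

    The inequality ([grothendieck_exact]) says that if the row and column norms of
    [(x_j)] in [E] and of [(y_j)] in [F] are at most [rho] and [tau], then
    [sum_j <u x_j, y_j>] is at most [4 d_SK(E) d_SK(F) |u|_cb rho tau] in modulus.
    One tests [u] on [X = sum_j x_j (x) a_j] and [Y = sum_j y_j (x) b_j], where the
    real matrices [a_j], [b_j] satisfy [tr (a_j b_k^T) ~ delta_jk] for the
    normalized trace: the maximally entangled vector recovers the sum, up to a
    small error, from a matrix of norm at most [|u|_cb |X| |Y|]
    ([cbnorm_pairing_le]). So [a_j] is wanted with [|X| <= 2 d_SK(E) rho] nearly.
    If [g_1, ..., g_n] are the generators of the free product of [n] groups of
    order 2, then [lambda(g_j)] is the sum of an operator that lengthens reduced
    words and one that shortens them; hence [sum_j x_j (x) lambda(g_j)] is at most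
    the column norm plus the row norm, that is, [2 rho]. A finite group generated
    by [n] involutions whose Cayley graph looks like the tree of reduced words up
    to distance [L] provides permutation matrices [U_j] with orthonormality for
    free. The norm of [sum_j t_j (x) U_j] itself may be large, but for matrix
    coefficients [t_j] a high power of this operator has a small trace, computed in
    the tree, so that a contraction [q] of small defect in normalized
    Hilbert-Schmidt norm suffices to cut off the large part; one takes
    [a_j = U_j q] ([free_like_norm_le]). As [q] acts on the group side only, the
    coefficients may be changed afterwards: compact operators are approximated by
    matrices ([compact_free_like]), and a completely bounded isomorphism from a
    space of compact operators onto a subspace of [E] costs the factor [d_SK(E)]
    ([exact_model], [exact_free_like]).

    For the second half, consider all positive sesquilinear forms [s] on [E] with
    [s(x, x) <= |x|^2]. The forms [<x xi, y xi>] and [<y^* eta, x^* eta>] are among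
    them, so the supremum over [s] of [sum_j s(z_j, z_j)] dominates the squared
    row and column norms of [(z_j)], and the inequality bounds
    [sum_j |<u z_j, y_j>|^2] by [M^2] times this supremum whenever [|y_j| <= 1].
    By Hahn-Banach separation one positive form [s] satisfies
    [|<u x, y>| <= M s(x, x)^(1/2) |y|] for all [x] and [y] ([dominating_form]), and
    [u] factors through the Hilbert space completion of [(E, s)] with constant
    [M] ([gamma2_le_of_form]). *)

(** * Permutations of reduced words *)

Section reduced_words.
Variables (n L : nat).
Implicit Types (j k : 'I_n).

Definition reduced (w : seq 'I_n) := sorted (fun a b => a != b) w.

Definition word := {w : L.-bseq 'I_n | reduced w}.

Definition letters (w : word) : seq 'I_n := val (val w).

Lemma letters_inj : injective letters.
Proof. by move=> v w /val_inj/val_inj. Qed.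

(** The generators of the free product of copies of Z/2 act on reduced words by
    left multiplication. Words of length [L] that would become longer are left
    fixed instead, which keeps the set finite and the action involutive. *)
Definition toggle j (w : seq 'I_n) :=
  if ohead w == Some j then behead w
  else if (size w < L)%N then j :: w else w.

Lemma toggle_size j (w : seq 'I_n) : (size w <= L)%N -> (size (toggle j w) <= L)%N.
Proof. by rewrite /toggle; case: ifP => _; [case: w => //= a w /ltnW | case: ifP]. Qed.

Lemma toggle_reduced j w : reduced w -> reduced (toggle j w).
Proof.
rewrite /toggle; case: w => [|a w] /=; first by case: ifP.
case: eqVneq => [_|aj]; first exact: path_sorted.
by case: ifP => //= _ ->; rewrite andbT; apply: contra_neq aj => ->.
Qed.

Lemma toggle_pop j w : toggle j (j :: w) = w.
Proof. by rewrite /toggle /= eqxx. Qed.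

Lemma toggleK j w : (size w <= L)%N -> reduced w -> toggle j (toggle j w) = w.
Proof.
have [/eqP wj|wj] := boolP (ohead w == Some j).
  case: w wj => //= _ w [->] szw red; rewrite toggle_pop /toggle szw.
  by case: w {szw} red => //= b w /andP[jb _]; rewrite eq_sym (inj_eq Some_inj) (negPf jb).
move=> _ _; rewrite {2}/toggle (negPf wj); case: ltnP => szw; first exact: toggle_pop.
by rewrite /toggle (negPf wj) ltnNge szw.
Qed.

Definition word_toggle j (w : word) : word :=
  exist _ (Bseq (toggle_size j (valP (val w)))) (toggle_reduced j (valP w)).

Lemma word_toggleK j : involutive (word_toggle j).
Proof.
by move=> w; apply: letters_inj; apply: toggleK; [exact: (valP (val w))|exact: (valP w)].
Qed.

Definition empty_word : word := exist _ [bseq] (erefl true : reduced [::]).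

Definition toggle_perm j : {perm word} := perm (inv_inj (word_toggleK j)).

Lemma toggle_perm_invol j : (toggle_perm j * toggle_perm j = 1)%g.
Proof. by apply/permP => w; rewrite permM !permE /= word_toggleK. Qed.

(** An enumeration of the group is fixed so that square matrices can be indexed
    by its elements. *)
Definition nperm : nat := #|{perm word}|.

Definition act j (p : 'I_nperm) : 'I_nperm := enum_rank (enum_val p * toggle_perm j)%g.

Lemma actK j : involutive (act j).
Proof.
by move=> p; rewrite /act enum_rankK -mulgA toggle_perm_invol mulg1 enum_valK.
Qed.

Lemma act_neq j k p : (0 < L)%N -> j != k -> act j p != act k p.
Proof.
move=> L0; apply: contraNneq => /enum_rank_inj/mulgI jk.
have /(congr1 letters) : toggle_perm j empty_word = toggle_perm k empty_word by rewrite jk.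
by rewrite !permE /letters /= /toggle /= L0 => -[->].
Qed.

Lemma nperm_gt0 : (0 < nperm)%N.
Proof. by apply/card_gt0P; exists 1%g. Qed.

(** Seen from [p], the group is a covering of the tree of words: the point that [p]
    moves to the empty word is moved by [p'] to a word, whose length plays the
    role of the distance from [p] to [p']. *)
Definition depth (p p' : 'I_nperm) : nat :=
  size (letters (enum_val p' ((enum_val p)^-1%g empty_word))).

Lemma depthE p j p' : depth p (act j p') =
  size (toggle j (letters (enum_val p' ((enum_val p)^-1%g empty_word)))).
Proof. by rewrite /depth /act enum_rankK permM [toggle_perm j _]permE. Qed.

Lemma depth0 p : depth p p = 0%N.
Proof. by rewrite /depth permKV. Qed.

Lemma depth_step_le p j p' : (depth p (act j p') <= (depth p p').+1)%N.
Proof.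
rewrite depthE /depth; set w := letters _; rewrite /toggle.
by case: ifP => _; [rewrite size_behead; lia | case: ifP => /= _; lia].
Qed.

Lemma depth_step_neq p j p' : (depth p p' < L)%N -> depth p (act j p') != depth p p'.
Proof.
rewrite depthE /depth; set w := letters _; rewrite /toggle => ->.
case: ifP => [/eqP|_ /=]; last by rewrite gtn_eqF.
by case: w => //= a w _; rewrite ltn_eqF.
Qed.

(** Only the first letter of a word can be removed. *)
Lemma depth_parent p j k p' : (depth p (act j p') < depth p p')%N ->
  (depth p (act k p') < depth p p')%N -> j = k.
Proof.
have h i : (depth p (act i p') < depth p p')%N ->
    ohead (letters (enum_val p' ((enum_val p)^-1%g empty_word))) = Some i.
  rewrite depthE /depth; set w := letters _; rewrite /toggle.
  by case: ifP => [/eqP//|_]; case: ifP => /= _; lia.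
by move=> /h hj /h; rewrite hj => -[].
Qed.

End reduced_words.

(** * The Frobenius norm and resolvents of positive matrices *)

Section frobenius.
Variable R : realFieldType.

Lemma sum_CauchySchwarz (I : finType) (a b : I -> R) :
  (\sum_i a i * b i) ^+ 2 <= (\sum_i a i ^+ 2) * (\sum_i b i ^+ 2).
Proof.
set A := \sum_i a i ^+ 2; set B := \sum_i b i ^+ 2; set C := \sum_i _.
have B0 : 0 <= B by apply: sumr_ge0 => i _; exact: sqr_ge0.
have : 0 <= \sum_i (B * a i - C * b i) ^+ 2 by apply: sumr_ge0 => i _; exact: sqr_ge0.
have -> : \sum_i (B * a i - C * b i) ^+ 2 = B * (A * B - C ^+ 2).
  transitivity (B ^+ 2 * A - 2 * B * C * C + C ^+ 2 * B); last by ring.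
  rewrite (eq_bigr (fun i => B ^+ 2 * a i ^+ 2 - 2 * B * C * (a i * b i) +
    C ^+ 2 * b i ^+ 2)); last by move=> i _; ring.
  by rewrite big_split sumrB -!mulr_sumr.
have [B1|] := eqVneq B 0; last by move=> B1; rewrite pmulr_rge0 ?lt_def ?B1//; lra.
have b0 i : b i = 0.
  have /eqP := B1; rewrite psumr_eq0; last by move=> k _; exact: sqr_ge0.
  by move/allP => /(_ i); rewrite mem_index_enum sqrf_eq0 => /(_ isT) /eqP.
by move=> _; rewrite B1 mulr0 /C big1 ?expr0n// => i _; rewrite b0 mulr0.
Qed.

Definition dotmx m n (A B : 'M[R]_(m, n)) := \tr (A *m B^T).
Definition nsq m n (A : 'M[R]_(m, n)) := dotmx A A.

Lemma dotmxE m n (A B : 'M[R]_(m, n)) : dotmx A B = \sum_i \sum_j A i j * B i j.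
Proof.
by apply: eq_bigr => i _; rewrite mxE; apply: eq_bigr => j _; rewrite mxE.
Qed.

Lemma nsqE m n (A : 'M[R]_(m, n)) : nsq A = \sum_i \sum_j A i j ^+ 2.
Proof. by rewrite /nsq dotmxE. Qed.

Lemma nsqE2 m n (A : 'M[R]_(m, n)) : nsq A = \sum_j \sum_i A i j ^+ 2.
Proof. by rewrite nsqE exchange_big. Qed.

Lemma dotmxC m n (A B : 'M[R]_(m, n)) : dotmx A B = dotmx B A.
Proof. by rewrite /dotmx -mxtrace_tr trmx_mul trmxK. Qed.

Lemma dotmxDl m n (A B C : 'M[R]_(m, n)) : dotmx (A + B) C = dotmx A C + dotmx B C.
Proof. by rewrite /dotmx mulmxDl mxtraceD. Qed.

Lemma dotmxNl m n (A C : 'M[R]_(m, n)) : dotmx (- A) C = - dotmx A C.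
Proof. by rewrite /dotmx mulNmx linearN. Qed.

Lemma dotmxDr m n (A B C : 'M[R]_(m, n)) : dotmx C (A + B) = dotmx C A + dotmx C B.
Proof. by rewrite !(dotmxC C) dotmxDl. Qed.

Lemma dotmxZl m n a (A C : 'M[R]_(m, n)) : dotmx (a *: A) C = a * dotmx A C.
Proof. by rewrite /dotmx -scalemxAl mxtraceZ. Qed.

Lemma dotmxZr m n a (A C : 'M[R]_(m, n)) : dotmx C (a *: A) = a * dotmx C A.
Proof. by rewrite !(dotmxC C) dotmxZl. Qed.

Lemma dotmx_suml m n I (r : seq I) P (F : I -> 'M[R]_(m, n)) C :
  dotmx (\sum_(i <- r | P i) F i) C = \sum_(i <- r | P i) dotmx (F i) C.
Proof. by rewrite /dotmx mulmx_suml linear_sum. Qed.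

Lemma dotmx_sumr m n I (r : seq I) P (F : I -> 'M[R]_(m, n)) C :
  dotmx C (\sum_(i <- r | P i) F i) = \sum_(i <- r | P i) dotmx C (F i).
Proof. by rewrite dotmxC dotmx_suml; apply: eq_bigr => i _; rewrite dotmxC. Qed.

Lemma nsq_ge0 m n (A : 'M[R]_(m, n)) : 0 <= nsq A.
Proof. by rewrite nsqE; do 2!apply: sumr_ge0 => ? _; exact: sqr_ge0. Qed.

Lemma nsq0 m n : nsq (0 : 'M[R]_(m, n)) = 0.
Proof. by rewrite /nsq /dotmx mul0mx mxtrace0. Qed.

Lemma nsq_eq0 m n (A : 'M[R]_(m, n)) : nsq A = 0 -> A = 0.
Proof.
move=> /eqP; rewrite nsqE psumr_eq0; last first.
  by move=> i _; apply: sumr_ge0 => j _; exact: sqr_ge0.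
move=> /allP A0; apply/matrixP => i j; rewrite mxE; apply/eqP; rewrite -sqrf_eq0.
have := A0 i; rewrite mem_index_enum psumr_eq0 => [/(_ isT)/allP/(_ j)|*].
  by rewrite mem_index_enum; apply.
exact: sqr_ge0.
Qed.

Lemma nsqZ m n a (A : 'M[R]_(m, n)) : nsq (a *: A) = a ^+ 2 * nsq A.
Proof. by rewrite /nsq dotmxZl dotmxZr mulrA. Qed.

Lemma nsqD m n (A B : 'M[R]_(m, n)) : nsq (A + B) = nsq A + 2 * dotmx A B + nsq B.
Proof. by rewrite /nsq dotmxDl !dotmxDr (dotmxC B A); ring. Qed.

Lemma nsqN m n (A : 'M[R]_(m, n)) : nsq (- A) = nsq A.
Proof. by rewrite -scaleN1r nsqZ; ring. Qed.

Lemma nsqD_le m n (A B : 'M[R]_(m, n)) : nsq (A + B) <= 2 * nsq A + 2 * nsq B.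
Proof. have := nsq_ge0 (A - B); rewrite !nsqD nsqN dotmxC dotmxNl dotmxC; lra. Qed.

Lemma dotmx_CauchySchwarz m n (A B : 'M[R]_(m, n)) :
  dotmx A B ^+ 2 <= nsq A * nsq B.
Proof.
rewrite dotmxE !nsqE !pair_big /=.
exact: (@sum_CauchySchwarz _ (fun p => A p.1 p.2) (fun p => B p.1 p.2)).
Qed.

Lemma nsq_col m n (A : 'M[R]_(m, n)) : nsq A = \sum_p nsq (col p A).
Proof.
rewrite nsqE2; apply: eq_bigr => p _; rewrite nsqE; apply: eq_bigr => i _.
by rewrite big_ord1 mxE.
Qed.

Lemma nsq_row m n (A : 'M[R]_(m, n)) : nsq A = \sum_p nsq (row p A).
Proof.
rewrite nsqE; apply: eq_bigr => p _; rewrite nsqE big_ord1.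
by apply: eq_bigr => i _; rewrite mxE.
Qed.

Lemma nsq_sum_le m n (I : finType) (F : I -> 'M[R]_(m, n)) :
  nsq (\sum_i F i) <= #|I|%:R * \sum_i nsq (F i).
Proof.
rewrite nsqE; under eq_bigr do under eq_bigr do rewrite summxE.
rewrite [X in _ <= _ * X](_ : _ =
  \sum_i \sum_j \sum_k (F k) i j ^+ 2); last first.
  under eq_bigr do rewrite nsqE; rewrite exchange_big /=.
  by apply: eq_bigr => i _; rewrite exchange_big.
rewrite mulr_sumr; apply: ler_sum => i _; rewrite mulr_sumr; apply: ler_sum => j _.
have /= := @sum_CauchySchwarz I (fun=> 1) (fun k => F k i j).
by rewrite expr1n sumr_const; under eq_bigr do rewrite mul1r.
Qed.

Lemma dotmx_mull m n k (A : 'M[R]_(m, n)) (B : 'M[R]_(n, k)) C :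
  dotmx (A *m B) C = dotmx B (A^T *m C).
Proof. by rewrite /dotmx trmx_mul trmxK mulmxA -mulmxA mxtrace_mulC. Qed.

Lemma dotmx_mulr m n k (A : 'M[R]_(m, n)) (B : 'M[R]_(n, k)) C :
  dotmx (A *m B) C = dotmx A (C *m B^T).
Proof. by rewrite /dotmx trmx_mul trmxK mulmxA. Qed.

End frobenius.

Section resolvent.
Variables (R : realFieldType) (N : nat) (T : 'M[R]_N) (c : R).
Hypotheses (T_sym : T^T = T) (T_psd : forall w : 'rV_N, 0 <= dotmx (w *m T) w).
Hypothesis c_gt0 : 0 < c.

Let S := 1%:M + c^-1 *: T.
Let q := invmx S.

Let decomp (v : 'rV[R]_N) : v *m S = v + c^-1 *: (v *m T).
Proof. by rewrite mulmxDr mulmx1 -scalemxAr. Qed.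

Let nsq_decomp (v : 'rV[R]_N) :
  nsq (v *m S) = nsq v + 2 * c^-1 * dotmx (v *m T) v + c^-1 ^+ 2 * nsq (v *m T).
Proof. by rewrite decomp nsqD dotmxZr nsqZ dotmxC; ring. Qed.

Let c'0 : 0 < c^-1. Proof. by rewrite invr_gt0. Qed.

Let S_unit : S \in unitmx.
Proof.
rewrite -row_free_unit -kermx_eq0; apply/eqP/row_matrixP => i; rewrite row0.
set v := row i _; have vS : v *m S = 0 by rewrite -row_mul mulmx_ker row0.
have := nsq_decomp v; rewrite vS nsq0.
have := nsq_ge0 v; have := T_psd v; have := nsq_ge0 (v *m T) => h1 h2 h3 h4.
have t1 : 0 <= 2 * c^-1 * dotmx (v *m T) v by rewrite !mulr_ge0// ltW.
have t2 : 0 <= c^-1 ^+ 2 * nsq (v *m T) by rewrite mulr_ge0// sqr_ge0.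
have v0 : nsq v = 0 by lra.
exact: nsq_eq0.
Qed.

Let qK (w : 'rV[R]_N) : w *m q *m S = w. Proof. by rewrite mulmxKV. Qed.

(** The matrix is the resolvent [(1 + T / c)^-1]. With [w = v + T v / c], the three
    bounds are read off the expansion of [|w|^2] and of [<T w, w>]; the last two
    are the two ways to compare [v] with the trivial candidates in the problem of
    minimizing [|w - v|^2 + <T v, v> / c]. *)
Lemma resolvent_cutoff : exists q : 'M[R]_N, forall w : 'rV[R]_N,
  [/\ nsq (w *m q) <= nsq w,
      dotmx (w *m q *m T) (w *m q) <= c * nsq w &
      c * nsq (w - w *m q) <= dotmx (w *m T) w].
Proof.
exists q => w; have := qK w; set v := w *m q => vS.
have := nsq_decomp v; rewrite vS => wE.
have Tv0 := T_psd v; have TTv0 := T_psd (v *m T); have TT0 := nsq_ge0 (v *m T).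
have v0 := nsq_ge0 v.
have t1 : 0 <= c^-1 * dotmx (v *m T) v by rewrite !mulr_ge0// ltW.
have t2 : 0 <= c^-1 ^+ 2 * nsq (v *m T) by rewrite mulr_ge0// sqr_ge0.
split; first by lra.
  by rewrite -ler_pdivrMl//; lra.
have wv : w - v = c^-1 *: (v *m T) by rewrite -[w]vS decomp addrC addKr.
rewrite wv nsqZ -[w]vS decomp mulmxDl !dotmxDl !dotmxDr -!scalemxAl.
rewrite !dotmxZr !dotmxZl.
have -> : dotmx (v *m T *m T) v = nsq (v *m T).
  by rewrite dotmx_mulr T_sym.
rewrite -[dotmx (v *m T) (v *m T)]/(nsq (v *m T)).
have t3 : 0 <= c^-1 * (c^-1 * dotmx (v *m T *m T) (v *m T)).
  by rewrite !mulr_ge0// ltW.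
have -> : c * (c^-1 ^+ 2 * nsq (v *m T)) = c^-1 * nsq (v *m T).
  by rewrite expr2 !mulrA divff ?mul1r// gt_eqF.
have t4 : 0 <= c^-1 * nsq (v *m T) by rewrite mulr_ge0// ltW.
by lra.
Qed.

End resolvent.

(** * Sums of permutation matrices in a tree-like neighbourhood *)

Section row_column.
Variables (R : realType) (n : nat).

Definition col_bound m1 m2 (t : 'I_n -> 'M[R]_(m1, m2)) (c : R) :=
  forall v : 'cV_m2, \sum_j nsq (t j *m v) <= c ^+ 2 * nsq v.

Definition row_bound m1 m2 (t : 'I_n -> 'M[R]_(m1, m2)) (c : R) :=
  forall v : 'I_n -> 'cV_m2, nsq (\sum_j t j *m v j) <= c ^+ 2 * \sum_j nsq (v j).

Lemma dotmx_family_CauchySchwarz m (a b : 'I_n -> 'cV[R]_m) :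
  (\sum_j dotmx (a j) (b j)) ^+ 2 <= (\sum_j nsq (a j)) * (\sum_j nsq (b j)).
Proof.
have E (x y : 'I_n -> 'cV[R]_m) : \sum_j dotmx (x j) (y j) =
    \sum_(p : 'I_n * 'I_m) x p.1 p.2 0 * y p.1 p.2 0.
  rewrite -(pair_bigA _ (fun j i => x j i 0 * y j i 0)) /=.
  by apply: eq_bigr => j _; rewrite dotmxE; apply: eq_bigr => i _; rewrite big_ord1.
rewrite /nsq !E; apply: le_trans (sum_CauchySchwarz _ _) _.
by rewrite le_eqVlt; apply/orP; left; apply/eqP; congr (_ * _); apply: eq_bigr.
Qed.

(** Test the row bound on the vectors [(t j)^T v]. *)
Lemma row_bound_tr m1 m2 (t : 'I_n -> 'M[R]_(m1, m2)) c :
  row_bound t c -> col_bound (fun j => (t j)^T) c.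
Proof.
move=> tc v; set s := \sum_j _.
have s0 : 0 <= s by apply: sumr_ge0 => j _; exact: nsq_ge0.
have sE : s = dotmx (\sum_j t j *m ((t j)^T *m v)) v.
  by rewrite dotmx_suml; apply: eq_bigr => j _; rewrite dotmx_mull dotmxC.
have := dotmx_CauchySchwarz (\sum_j t j *m ((t j)^T *m v)) v; rewrite -sE => h1.
have h2 := tc (fun j => (t j)^T *m v); rewrite -/s in h2.
have h3 : s * s <= s * (c ^+ 2 * nsq v).
  rewrite -expr2; apply: le_trans h1 _; rewrite mulrA (mulrC s).
  by rewrite ler_wpM2r ?nsq_ge0.
have [->|s1] := eqVneq s 0; first by rewrite mulr_ge0 ?sqr_ge0 ?nsq_ge0.
by rewrite ler_pM2l ?lt_def ?s1 in h3.
Qed.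

(** Test the column bound on [sum_j (t j)^T v_j]. *)
Lemma col_bound_tr m1 m2 (t : 'I_n -> 'M[R]_(m1, m2)) c :
  col_bound t c -> row_bound (fun j => (t j)^T) c.
Proof.
move=> tc v; set w := \sum_j _ *m _.
have wE : nsq w = \sum_j dotmx (v j) (t j *m w).
  by rewrite {1}/nsq {1}/w dotmx_suml; apply: eq_bigr => j _; rewrite dotmx_mull trmxK.
have := dotmx_family_CauchySchwarz v (fun j => t j *m w); rewrite -wE => h1.
have v0 : 0 <= \sum_j nsq (v j) by apply: sumr_ge0 => j _; exact: nsq_ge0.
have h3 : nsq w * nsq w <= nsq w * (c ^+ 2 * \sum_j nsq (v j)).
  rewrite -expr2; apply: le_trans h1 _; rewrite mulrA mulrC ler_wpM2r// mulrC.
  exact: tc.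
have [->|s1] := eqVneq (nsq w) 0; first by rewrite mulr_ge0 ?sqr_ge0.
by rewrite ler_pM2l ?lt_def ?s1 ?nsq_ge0 in h3.
Qed.

End row_column.

Section permuted_sum.
Variables (R : realType) (n N : nat) (sg : 'I_n -> 'I_N -> 'I_N).
Hypothesis sgK : forall j, involutive (sg j).

Definition sgmx j : 'M[R]_N := \matrix_(q, p) (q == sg j p)%:R.

Lemma mulmx_sg m (A : 'M[R]_(m, N)) j i p : (A *m sgmx j) i p = A i (sg j p).
Proof.
rewrite mxE (bigD1 (sg j p))//= mxE eqxx mulr1 big1 ?addr0// => q.
by rewrite mxE => /negPf->; rewrite mulr0.
Qed.

Lemma sgmx_tr j : (sgmx j)^T = sgmx j.
Proof.
apply/matrixP => p q; rewrite !mxE; congr (_%:R); congr nat_of_bool.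
by apply/eqP/eqP => ->; rewrite sgK.
Qed.

(** The matrix of [sum_j t_j (x) U_j], where [U_j] is the permutation matrix of
    [sg j], acting on R^m2 (x) R^N seen as a space of matrices. *)
Definition psum m1 m2 (t : 'I_n -> 'M[R]_(m1, m2)) (Z : 'M[R]_(m2, N)) : 'M[R]_(m1, N) :=
  \sum_j t j *m Z *m sgmx j.

Lemma psumD m1 m2 (t : 'I_n -> 'M[R]_(m1, m2)) Y Z :
  psum t (Y + Z) = psum t Y + psum t Z.
Proof.
by rewrite /psum -big_split /=; apply: eq_bigr => j _; rewrite mulmxDr mulmxDl.
Qed.

Lemma psumZ m1 m2 (t : 'I_n -> 'M[R]_(m1, m2)) a Z : psum t (a *: Z) = a *: psum t Z.
Proof.
by rewrite /psum scaler_sumr; apply: eq_bigr => j _; rewrite -scalemxAr -scalemxAl.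
Qed.

Lemma psum_adj m1 m2 (t : 'I_n -> 'M[R]_(m1, m2)) Z W :
  dotmx (psum t Z) W = dotmx Z (psum (fun j => (t j)^T) W).
Proof.
rewrite dotmx_suml dotmx_sumr; apply: eq_bigr => j _.
by rewrite dotmx_mulr dotmx_mull sgmx_tr mulmxA.
Qed.

Lemma col_psum m1 m2 (t : 'I_n -> 'M[R]_(m1, m2)) Z p :
  col p (psum t Z) = \sum_j t j *m col (sg j p) Z.
Proof.
rewrite /psum linear_sum /=; apply: eq_bigr => j _.
apply/colP => i; rewrite mxE mulmx_sg !mxE; apply: eq_bigr => k _.
by rewrite mxE.
Qed.

Section tree.
Variables (L : nat) (d : 'I_N -> nat).
Hypotheses (d_le : forall j p, (d (sg j p) <= (d p).+1)%N)
  (d_neq : forall j p, (d p < L)%N -> d (sg j p) != d p)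
  (d_parent : forall j k p, (d (sg j p) < d p)%N -> (d (sg k p) < d p)%N -> j = k).

Definition supported m (Z : 'M[R]_(m, N)) r := forall p, (r < d p)%N -> col p Z = 0.

Lemma psum_supported m1 m2 (t : 'I_n -> 'M[R]_(m1, m2)) Z r :
  supported Z r -> supported (psum t Z) r.+1.
Proof.
move=> Zr p rp; rewrite col_psum big1// => j _; rewrite Zr ?mulmx0//.
by have := d_le j (sg j p); rewrite sgK; lia.
Qed.

(** Haagerup's estimate for the free product of copies of Z/2: at each point, the
    terms of the sum that come from a shorter word number at most one, hence
    contribute the column norm, while those that come from longer words contribute
    the row norm. The support condition keeps away from the words of maximal
    length, where the action departs from that of the free product. *)
Lemma psum_tree_le m1 m2 (t : 'I_n -> 'M[R]_(m1, m2)) (c : R) Z r :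
  col_bound t c -> row_bound t c -> supported Z r -> (r < L)%N ->
  nsq (psum t Z) <= (2 * c) ^+ 2 * nsq Z.
Proof.
move=> tcol trow Zr rL.
pose up p : 'cV[R]_m1 := \sum_(j | (d (sg j p) < d p)%N) t j *m col (sg j p) Z.
pose dn p : 'cV[R]_m1 := \sum_(j | (d p < d (sg j p))%N) t j *m col (sg j p) Z.
have XE p : col p (psum t Z) = up p + dn p.
  rewrite col_psum (bigID (fun j => (d (sg j p) < d p)%N)) /=; congr (_ + _).
  rewrite (bigID (fun j => (d p < d (sg j p))%N)) /= [X in _ + X]big1 ?addr0.
    by apply: eq_bigl => j; rewrite -leqNgt; lia.
  move=> j; rewrite -!leqNgt -eqn_leq => /eqP dj; rewrite Zr ?mulmx0//.
  have := @d_neq j (sg j p); rewrite sgK dj eqxx; lia.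
have upE : \sum_p nsq (up p) <= c ^+ 2 * nsq Z.
  have up_le p : nsq (up p) <= \sum_(j | (d (sg j p) < d p)%N) nsq (t j *m col (sg j p) Z).
    have [j jp|none] := pickP (fun j => (d (sg j p) < d p)%N).
      rewrite /up (bigD1 j)//= [X in _ + X]big1 ?addr0; last first.
        by move=> k /andP[/(d_parent jp) ->]; rewrite eqxx.
      by rewrite [leRHS](bigD1 j)//= lerDl sumr_ge0// => k _; exact: nsq_ge0.
    by rewrite /up !big_pred0// nsq0.
  apply: le_trans (ler_sum _ (fun p _ => up_le p)) _.
  rewrite (exchange_big_dep predT) //=.
  rewrite [leLHS](eq_bigr (fun j => \sum_(p | (d p < d (sg j p))%N) nsq (t j *m col p Z))).
    rewrite (nsq_col Z) mulr_sumr.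
    apply: le_trans (ler_sum _ (fun p _ => tcol (col p Z))).
    rewrite exchange_big /=; apply: ler_sum => j _.
    rewrite [leRHS](bigID (fun p => (d p < d (sg j p))%N)) /= lerDl.
    by apply: sumr_ge0 => p _; exact: nsq_ge0.
  move=> j _; rewrite (reindex_inj (inv_inj (sgK j))) /=.
  by apply: eq_big => p; rewrite sgK.
have dnE : \sum_p nsq (dn p) <= c ^+ 2 * nsq Z.
  pose z p j : 'cV[R]_m2 := if (d p < d (sg j p))%N then col (sg j p) Z else 0.
  have dnz p : dn p = \sum_j t j *m z p j.
    rewrite /dn big_mkcond; apply: eq_bigr => j _; rewrite /z; case: ifP => //.
    by rewrite mulmx0.
  under eq_bigr do rewrite dnz.
  apply: le_trans (ler_sum _ (fun p _ => trow (z p))) _.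
  rewrite -mulr_sumr ler_wpM2l ?sqr_ge0// exchange_big /=.
  rewrite [leLHS](eq_bigr (fun j => \sum_p if (d (sg j p) < d p)%N then nsq (col p Z) else 0)).
    rewrite exchange_big /= (nsq_col Z); apply: ler_sum => p _.
    rewrite -big_mkcond /=.
    have [j jp|none] := pickP (fun j => (d (sg j p) < d p)%N).
      rewrite (bigD1 j)//= [X in _ + X]big1 ?addr0//.
      by move=> k /andP[/(d_parent jp) ->]; rewrite eqxx.
    by rewrite big_pred0// nsq_ge0.
  move=> j _; rewrite (reindex_inj (inv_inj (sgK j))) /=.
  by apply: eq_bigr => p _; rewrite /z sgK; case: ifP => // _; rewrite nsq0.
rewrite nsq_col.
have : \sum_p nsq (col p (psum t Z)) <= \sum_p (2 * nsq (up p) + 2 * nsq (dn p)).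
  by apply: ler_sum => p _; rewrite XE nsqD_le.
rewrite big_split /= -!mulr_sumr; nra.
Qed.

Lemma iter_psum_tree_le m1 m2 (t : 'I_n -> 'M[R]_(m1, m2)) (c : R) Z K :
  col_bound t c -> row_bound t c -> supported Z 0 -> (2 * K <= L)%N ->
  supported (iter K (psum (fun j => (t j)^T) \o psum t) Z) (2 * K) /\
  nsq (iter K (psum (fun j => (t j)^T) \o psum t) Z) <= (2 * c) ^+ (4 * K) * nsq Z.
Proof.
move=> tcol trow Z0; elim: K => [|K IH] KL; first by rewrite muln0 expr0 mul1r.
have [|S le] := IH; first by lia.
rewrite iterS /=; split.
  by rewrite mulnS addnC addn2; do 2!apply: psum_supported.
have -> : (4 * K.+1 = 2 + (2 + 4 * K))%N by lia.
have S1 := psum_supported t S.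
apply: le_trans (psum_tree_le (row_bound_tr trow) (col_bound_tr tcol) S1 _) _; first by lia.
rewrite exprD -mulrA ler_wpM2l ?sqr_ge0//.
apply: le_trans (psum_tree_le tcol trow S _) _; first by lia.
by rewrite exprD -mulrA ler_wpM2l ?sqr_ge0.
Qed.

End tree.
End permuted_sum.

(** * Cutting off the large part of a sum of permutation matrices *)

Section cutoff.
Variables (R : realType) (n N : nat) (sg : 'I_n -> 'I_N -> 'I_N).
Hypothesis sgK : forall j, involutive (sg j).
Variables (m1 m2 : nat) (t : 'I_n -> 'M[R]_(m1, m2)).

Let h := psum sg (fun j => (t j)^T) \o psum sg t.

Lemma iter_gramD k Y Z : iter k h (Y + Z) = iter k h Y + iter k h Z.
Proof. by elim: k => //= k ->; rewrite /h /= !psumD. Qed.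

Lemma iter_gramZ k a Z : iter k h (a *: Z) = a *: iter k h Z.
Proof. by elim: k => //= k ->; rewrite /h /= !psumZ. Qed.

Lemma iter_gram_sum k I (r : seq I) (F : I -> 'M[R]_(m2, N)) :
  iter k h (\sum_(i <- r) F i) = \sum_(i <- r) iter k h (F i).
Proof.
elim: r => [|i r IH]; last by rewrite !big_cons iter_gramD IH.
by rewrite !big_nil -[X in iter _ _ X](scale0r 0) iter_gramZ scale0r.
Qed.

Lemma gram_adj Z W : dotmx (h Z) W = dotmx Z (h W).
Proof.
rewrite /h /= psum_adj// psum_adj//.
suff -> : (fun j => ((t j)^T)^T) = t by [].
by apply/funext => j; rewrite trmxK.
Qed.

Lemma iter_gram_adj k Z W : dotmx (iter k h Z) W = dotmx Z (iter k h W).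
Proof. by elim: k Z W => // k IH Z W; rewrite iterSr IH gram_adj -iterS. Qed.

(** Repeated Cauchy-Schwarz: [|h^k V|^2 = <V, h^(2k) V> <= |h^(2k) V|]. *)
Lemma nsq_psum_power_le r V : nsq V <= 1 ->
  nsq (psum sg t V) ^+ (2 * 2 ^ r) <= nsq (iter (2 ^ r) h V).
Proof.
move=> V1.
have dbl k : nsq (iter k h V) ^+ 2 <= nsq (iter (k + k) h V).
  rewrite /nsq iter_gram_adj -iterD; apply: le_trans (dotmx_CauchySchwarz _ _) _.
  by rewrite ler_piMl ?nsq_ge0.
elim: r => [|r IH].
  rewrite expn0 muln1 /= {1}/nsq psum_adj//.
  by apply: le_trans (dotmx_CauchySchwarz _ _) _; rewrite ler_piMl ?nsq_ge0.
have -> : (2 * 2 ^ r.+1 = 2 * 2 ^ r * 2)%N by rewrite expnS; lia.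
rewrite exprM [in leRHS]expnS [in leRHS]mul2n -addnn.
by apply: le_trans (dbl _); rewrite ler_pXn2r ?nnegrE ?exprn_ge0 ?nsq_ge0.
Qed.

Let unit_row i (w : 'rV[R]_N) : 'M[R]_(m2, N) := delta_mx i 0 *m w.

Let unit_row_sum (Z : 'M[R]_(m2, N)) q :
  Z *m q = \sum_i unit_row i (row i Z *m q).
Proof.
rewrite (_ : \sum_i _ = (\sum_i unit_row i (row i Z)) *m q); last first.
  by rewrite mulmx_suml; apply: eq_bigr => i _; rewrite /unit_row mulmxA.
congr (_ *m q); apply/matrixP => a p; rewrite summxE (bigD1 a)//= big1 ?addr0.
  by rewrite mxE big_ord1 !mxE !eqxx mul1r.
by move=> i ia; rewrite mxE big_ord1 mxE eq_sym (negPf ia) mul0r.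
Qed.

Let T k : 'M[R]_N := \matrix_(p, p')
  \sum_i dotmx (iter k h (delta_mx i p)) (iter k h (delta_mx i p')).

Let T_form k (v w : 'rV[R]_N) : dotmx (v *m T k) w =
  \sum_i dotmx (iter k h (unit_row i v)) (iter k h (unit_row i w)).
Proof.
have unitE i u : unit_row i u = \sum_p u 0 p *: delta_mx i p.
  rewrite /unit_row {1}[u]row_sum_delta mulmx_sumr; apply: eq_bigr => p _.
  by rewrite -scalemxAr mul_delta_mx.
rewrite dotmxE big_ord1.
transitivity (\sum_p \sum_p' v 0 p * w 0 p' * T k p p').
  rewrite exchange_big /=; apply: eq_bigr => p' _; rewrite mxE mulr_suml.
  by apply: eq_bigr => p _; ring.
symmetry; transitivity (\sum_p \sum_p' \sum_i v 0 p * w 0 p' *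
    dotmx (iter k h (delta_mx i p)) (iter k h (delta_mx i p'))); last first.
  by apply: eq_bigr => p _; apply: eq_bigr => p' _; rewrite mxE mulr_sumr.
under [RHS]eq_bigr do rewrite exchange_big.
rewrite [RHS]exchange_big /=; apply: eq_bigr => i _.
rewrite !unitE !iter_gram_sum dotmx_suml; apply: eq_bigr => p _.
rewrite dotmx_sumr; apply: eq_bigr => p' _.
by rewrite !iter_gramZ dotmxZl dotmxZr mulrA.
Qed.

(** The resolvent is that of the partial trace of [h^k h^k] over R^m2, which
    dominates [h^k h^k] up to the factor [m2]; so the cutoff can be done by a
    matrix that acts on the second tensor factor alone. The trace of [T k] is at
    most [m2 N D], whence the defect of [q]. *)
Lemma power_cutoff k (D e : R) : 0 < D -> 0 < e ->
  (forall i p, nsq (iter k h (delta_mx i p)) <= D) ->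
  exists q : 'M[R]_N, [/\ forall w : 'rV_N, nsq (w *m q) <= nsq w,
    nsq (1%:M - q) <= e * N%:R &
    forall Z, nsq (iter k h (Z *m q)) <= (m2.+1%:R) ^+ 2 * D / e * nsq Z].
Proof.
move=> D0 e0 hD; pose c := m2.+1%:R * D / e.
have c0 : 0 < c by rewrite divr_gt0// mulr_gt0// ltr0Sn.
have Tsym : (T k)^T = T k.
  by apply/matrixP => p p'; rewrite !mxE; apply: eq_bigr => i _; rewrite dotmxC.
have Tpsd (w : 'rV[R]_N) : 0 <= dotmx (w *m T k) w.
  by rewrite T_form; apply: sumr_ge0 => i _; exact: nsq_ge0.
have [q qP] := resolvent_cutoff Tsym Tpsd c0.
exists q; split=> [w||Z]; first by have [] := qP w.
  rewrite nsq_row.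
  have le p : c * nsq (row p (1%:M - q)) <= m2.+1%:R * D.
    have [_ _] := qP (delta_mx 0 p); rewrite linearB /= row1 -rowE => le.
    apply: le_trans le _; rewrite T_form.
    apply: (@le_trans _ _ (\sum_(i < m2) D)).
      by apply: ler_sum => i _; rewrite /unit_row mul_delta_mx; exact: hD.
    rewrite sumr_const card_ord -[D *+ _]mulr_natl ler_wpM2r ?(ltW D0)//.
    by rewrite ler_nat.
  have : c * \sum_p nsq (row p (1%:M - q)) <= c * (e * N%:R).
    rewrite mulr_sumr; apply: le_trans (ler_sum _ (fun p _ => le p)) _.
    rewrite sumr_const card_ord -[leLHS]mulr_natr mulrA ler_wpM2r//.
    by rewrite /c divfK// gt_eqF.
  by rewrite ler_pM2l.
rewrite unit_row_sum iter_gram_sum; apply: le_trans (nsq_sum_le _) _.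
rewrite card_ord (nsq_row Z).
have le i : nsq (iter k h (unit_row i (row i Z *m q))) <= c * nsq (row i Z).
  have [_ le _] := qP (row i Z); apply: le_trans le; rewrite T_form.
  by rewrite (bigD1 i)//= lerDl sumr_ge0// => ? _; exact: nsq_ge0.
have S0 : 0 <= \sum_i nsq (row i Z) by apply: sumr_ge0 => ? _; exact: nsq_ge0.
apply: (@le_trans _ _ (m2%:R * (c * \sum_i nsq (row i Z)))).
  by rewrite ler_wpM2l// mulr_sumr; apply: ler_sum.
rewrite mulrA ler_wpM2r// /c expr2 -!mulrA ler_wpM2r ?ler_nat//.
by rewrite ltW// mulr_gt0 ?ltr0Sn// divr_gt0.
Qed.

End cutoff.

Lemma exp2n_bernoulli (R : realType) (e M : R) : 0 < e ->
  exists r, M <= (1 + e) ^+ (2 ^ r).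
Proof.
move=> e0; have bern k : 1 + k%:R * e <= (1 + e) ^+ k.
  elim: k => [|k IH]; first by rewrite mul0r addr0 expr0.
  rewrite exprS -natr1; have k0 : 0 <= k%:R :> R by [].
  have : (1 + e) * (1 + k%:R * e) <= (1 + e) * (1 + e) ^+ k.
    by rewrite ler_wpM2l//; lra.
  have : 0 <= k%:R * e * e by rewrite !mulr_ge0// ltW.
  lra.
have [r Mr] : exists r, M / e <= r%:R.
  exists (Num.Def.archi_bound `|M / e|); apply: le_trans (ler_norm _) (ltW _).
  by apply: archi_boundP; exact: normr_ge0.
exists r; apply: le_trans (bern _).
rewrite ler_pdivrMr// in Mr.
have : (r%:R : R) <= (2 ^ r)%:R by rewrite ler_nat ltnW// ltn_expl.
have := ltW e0; nra.
Qed.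

(** Around every point of the group the powers of [h] are computed in the tree, as
    long as they do not reach the words of length [L]. The constants produced by
    the cutoff depend on [m2] and [e] only, and disappear when the root of order
    [4 * 2 ^ r] is taken. *)
Theorem free_like_norm_le (R : realType) n m1 m2 (t : 'I_n -> 'M[R]_(m1, m2)) (c e : R) :
  0 < c -> 0 < e -> col_bound t c -> row_bound t c ->
  exists L0, forall L, (L0 <= L)%N -> exists q : 'M[R]_(nperm n L),
    [/\ forall w : 'rV_(nperm n L), nsq (w *m q) <= nsq w,
        nsq (1%:M - q) <= e * (nperm n L)%:R &
        forall Z, nsq (psum (@act n L) t (Z *m q)) <= (2 * c * (1 + e)) ^+ 2 * nsq Z].
Proof.
move=> c0 e0 tcol trow.
have [r rP] := exp2n_bernoulli (m2.+1%:R ^+ 2 / e) e0.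
(* [h ^ K] moves points by at most [2 * K] letters. *)
pose K := (2 ^ r)%N; exists (2 * K)%N => L KL.
set N := nperm n L.
have [||i p|q [q1 q2 q3]] := @power_cutoff R n N (@act n L) m1 m2 t K
    ((2 * c) ^+ (4 * K)) e => //.
- by rewrite exprn_gt0// mulr_gt0.
- have [|_] := @iter_psum_tree_le R n N (@act n L) (@actK n L) L (depth p)
     (depth_step_le p) (@depth_step_neq n L p) (@depth_parent n L p) m1 m2 t c
     (delta_mx i p) K tcol trow _ KL.
    move=> p' dp'; apply/colP => a; rewrite !mxE.
    have [pp'|] := eqVneq p' p; last by rewrite andbF.
    by rewrite pp' depth0 in dp'.
  rewrite [X in _ <= _ * X -> _](_ : _ = 1) ?mulr1//.
  rewrite nsqE (bigD1 i)//= [X in _ + X]big1 ?addr0; last first.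
    by move=> k ki; apply: big1 => j _; rewrite mxE (negPf ki) expr0n.
  rewrite (bigD1 p)//= [X in _ + X]big1 ?addr0; last first.
    by move=> k ki; rewrite mxE (negPf ki) andbF expr0n.
  by rewrite mxE !eqxx expr1n.
exists q; split=> // Z.
have Zq (W : 'M[R]_(m2, N)) : nsq (W *m q) <= nsq W.
  rewrite nsq_row (nsq_row W); apply: ler_sum => i _.
  by rewrite row_mul; exact: q1.
have [Z0|Z0] := eqVneq (nsq Z) 0.
  have -> : Z *m q = 0.
    have ZqE : nsq (Z *m q) = 0 by apply/eqP; rewrite eq_le nsq_ge0 -Z0 Zq.
    exact: nsq_eq0.
  by rewrite -(scale0r (0 : 'M[R]_(m2, N))) psumZ scale0r nsq0 mulr_ge0 ?sqr_ge0 ?nsq_ge0.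
have z0 : 0 < nsq Z by rewrite lt_def Z0 nsq_ge0.
pose s : R := (Num.sqrt (nsq Z))^-1; have s0 : 0 < s by rewrite invr_gt0 sqrtr_gt0.
have sE : s ^+ 2 = (nsq Z)^-1 by rewrite exprVn sqr_sqrtr// ltW.
pose W : 'M[R]_(m2, N) := s *: Z; have W1 : nsq W = 1 by rewrite nsqZ sE mulVf.
suff : nsq (psum (@act n L) t (W *m q)) <= (2 * c * (1 + e)) ^+ 2.
  by rewrite -scalemxAl psumZ nsqZ sE mulrC ler_pdivrMr.
have Wq1 : nsq (W *m q) <= 1 by rewrite -W1 Zq.
have := nsq_psum_power_le (@actK n L) t r Wq1.
rewrite -/K => le; have {le} := le_trans le (q3 W); rewrite W1 mulr1 => le.
rewrite -(@ler_pXn2r _ (2 * K)) ?nnegrE ?nsq_ge0 ?sqr_ge0 ?muln_gt0 ?expn_gt0//.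
apply: le_trans le _.
rewrite -[leRHS]exprM mulnA [leRHS]exprMn mulrAC [leLHS]mulrC ler_wpM2l//.
  by rewrite exprn_ge0// mulr_ge0// ltW.
apply: le_trans rP _; rewrite -/K ler_weXn2l//; first by lra.
by lia.
Qed.

Local Open Scope classical_set_scope.
Local Open Scope complex_scope.

(** * Positive sesquilinear forms *)

(** Minimize over [t]; the case [B = 0] forces [n = 0]. *)
Lemma le_of_quadratic (R : realFieldType) (A n B : R) : 0 <= A -> 0 <= n -> 0 <= B ->
  (forall t, 0 <= A - 2 * t * n + t ^+ 2 * n * B) -> n <= A * B.
Proof.
move=> A0 n0 B0 H; have [->|n1] := eqVneq n 0; first by rewrite mulr_ge0.
have npos : 0 < n by rewrite lt_def n1.
have [B1|B1] := eqVneq B 0.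
  have := H ((A + 1) / (2 * n)); rewrite B1 mulr0 addr0.
  have -> : 2 * ((A + 1) / (2 * n)) * n = A + 1 by field.
  lra.
have Bpos : 0 < B by rewrite lt_def B1.
have := H B^-1; have -> : A - 2 * B^-1 * n + B^-1 ^+ 2 * n * B = A - n / B.
  by field.
by rewrite subr_ge0 ler_pdivrMr.
Qed.

Record psd_form (R : realType) (V : lmodType R[i]) := PsdForm {
  pform :> V -> V -> R[i] ;
  pformDl : forall a x y z, pform (a *: x + y) z = a * pform x z + pform y z ;
  pformC : forall x y, pform y x = Num.conj (pform x y) ;
  pform_ge0 : forall x, 0 <= pform x x }.

Section psd_form_theory.
Variables (R : realType) (V : lmodType R[i]) (s : psd_form V).
Implicit Types x y : V.
Local Notation C := R[i].

Lemma pformDr a x y z : s z (a *: x + y) = Num.conj a * s z x + s z y.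
Proof. by rewrite !(pformC s _ z) pformDl rmorphD rmorphM. Qed.

Lemma pform0l x : s 0 x = 0.
Proof. by have := pformDl s (-1) 0 0 x; rewrite scaler0 add0r mulN1r addNr. Qed.

Definition pnorm x : R := Num.sqrt (complex.Re (s x x)).

Lemma pnorm_ge0 x : 0 <= pnorm x. Proof. exact: sqrtr_ge0. Qed.

Lemma pnorm_sqr x : (pnorm x ^+ 2)%:C = s x x.
Proof.
have := pform_ge0 s x; rewrite /pnorm; case: (s x x) => a b.
by rewrite lecE /= => /andP[/eqP -> a0]; rewrite sqr_sqrtr.
Qed.

Lemma pnormZ a x : pnorm (a *: x) = rnorm (a : C^o) * pnorm x.
Proof.
apply/eqP; rewrite -(@eqrXn2 _ 2) ?pnorm_ge0 ?mulr_ge0 ?rnorm_ge0 ?pnorm_ge0//.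
apply/eqP/complexI; rewrite pnorm_sqr exprMn rmorphM /= pnorm_sqr rmorphXn /= rnormE.
rewrite normCK -[a *: x]addr0 pformDl pformDr pform0l (pformC s 0) pform0l conjC0 !addr0.
by rewrite mulrA.
Qed.

(** For [phi = 0] this is the expansion behind the Cauchy-Schwarz inequality; for
    [a] almost minimizing [|x|^2 - 2 Re phi x] it shows that [s a] is close to
    [phi]. *)
Lemma riesz_expansion (phi : V -> C^o) a y (t : R) (z := s a y - phi y) :
  (forall b x y, phi (b *: x + y) = Num.conj b * phi x + phi y) ->
  pnorm ((- (t%:C * z)) *: y + a) ^+ 2 - 2 * complex.Re (phi ((- (t%:C * z)) *: y + a)) =
  pnorm a ^+ 2 - 2 * complex.Re (phi a) - 2 * t * rnorm (z : C^o) ^+ 2 +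
    t ^+ 2 * rnorm (z : C^o) ^+ 2 * pnorm y ^+ 2.
Proof.
move=> phiP.
have ReE (w : C) : (2 * complex.Re w)%:C = w + Num.conj w.
  by case: w => u v; apply/eqP; rewrite eq_complex /=; apply/andP; split; apply/eqP; ring.
have zz : (rnorm (z : C^o) ^+ 2)%:C = z * Num.conj z.
  by rewrite rmorphXn /= rnormE normCK.
set w := - _ *: y + a; have := pnorm_sqr w; have := pnorm_sqr y; have := pnorm_sqr a.
move: (pnorm w ^+ 2) (pnorm y ^+ 2) (pnorm a ^+ 2) (rnorm (z : C^o) ^+ 2) zz.
move=> W B A n zz AE BE WE.
apply: complexI; rewrite !(rmorphB, rmorphD) /= !ReE !rmorphM /= zz AE BE WE /w.
rewrite pformDl !pformDr !phiP (pformC s a y) /z.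
have tc : Num.conj (t%:C) = t%:C by apply/eqP; rewrite eq_complex /= oppr0 !eqxx.
rewrite !(rmorphN, rmorphM, rmorphB, rmorphD) /= !tc !conjCK.
rewrite rmorph1.
ring.
Qed.

Lemma pform_CauchySchwarz x y : rnorm (s x y : C^o) <= pnorm x * pnorm y.
Proof.
rewrite -(@ler_pXn2r _ 2) ?nnegrE ?rnorm_ge0 ?mulr_ge0 ?pnorm_ge0// exprMn.
apply: le_of_quadratic; rewrite ?sqr_ge0// => t.
have /= := @riesz_expansion (fun=> 0) x y t; rewrite subr0 !mulr0 !subr0 => <-.
  exact: sqr_ge0.
by move=> *; rewrite mulr0 addr0.
Qed.

End psd_form_theory.

(** * The Hilbert space of a positive form *)

Section antidual.
Variables (R : realType) (V : lmodType R[i]) (s : psd_form V).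
Local Notation C := R[i].

Definition antibounded : {pred V -> C^o} := [pred f : V -> C^o |
  `[< (forall a x y, f (a *: x + y) = Num.conj a * f x + f y) /\
      exists M : R, forall x, rnorm (f x) <= M * pnorm s x >]].

Lemma antibounded_submod : submod_closed antibounded.
Proof.
split.
  apply/asboolP; split=> [a x y|]; first by rewrite /= mulr0 addr0.
  by exists 0 => x; rewrite mul0r rnorm0.
move=> a f g /asboolP[fl [M fM]] /asboolP[gl [N gN]]; apply/asboolP; split.
  move=> b x y /=.
  rewrite -![(a *: f + g) _]/(a * f _ + g _) fl gl; ring.
exists (rnorm (a : C^o) * M + N) => x.
rewrite -[(a *: f + g) x]/(a *: f x + g x).
apply: (le_trans (rnormD _ _)); rewrite rnormZ mulrDl lerD// -mulrA.
by rewrite ler_wpM2l// rnorm_ge0.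
Qed.

HB.instance Definition _ := GRing.isSubmodClosed.Build C (V -> C^o)
  antibounded antibounded_submod.

(** This is the Hilbert space with reproducing kernel [s], that is, the completion
    of [V] for the seminorm of [s]. As a space of functions it needs no quotient,
    and its completeness is a pointwise matter. The functionals are antilinear so
    that [kernel] is linear. *)
Record antidual := Antidual { antidual_fun :> V -> C^o ;
  antidualP : antidual_fun \in antibounded }.

HB.instance Definition _ := [isSub for antidual_fun].
HB.instance Definition _ := [Choice of antidual by <:].
HB.instance Definition _ := [SubChoice_isSubLmodule of antidual by <:].

Implicit Types f g : antidual.

Lemma antidual_lin f a x y : f (a *: x + y) = Num.conj a * f x + f y.
Proof. by have /asboolP[] := antidualP f. Qed.

Lemma antidualZ f a x : f (a *: x) = Num.conj a * f x.
Proof.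
have f0 : f 0 = 0.
  by have := antidual_lin f (-1) 0 0; rewrite scaler0 add0r rmorphN rmorph1 mulN1r addNr.
by rewrite -[a *: x]addr0 antidual_lin f0 addr0.
Qed.

Definition adnorm f : R := sup [set rnorm (f x) | x in [set x | pnorm s x <= 1]].

Lemma pnorm0 : pnorm s 0 = 0.
Proof. by rewrite /pnorm pform0l sqrtr0. Qed.

Lemma adnorm_has_sup f : has_sup [set rnorm (f x) | x in [set x | pnorm s x <= 1]].
Proof.
split; first by exists (rnorm (f 0)), 0 => //=; rewrite pnorm0.
have /asboolP[_ [M fM]] := antidualP f; exists `|M| => _ [x /= x1 <-].
apply: (le_trans (fM x)); apply: (@le_trans _ _ (`|M| * pnorm s x)).
  by rewrite ler_wpM2r ?pnorm_ge0// ler_norm.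
by rewrite ler_piMr.
Qed.

Lemma adnorm_ge0 f : 0 <= adnorm f.
Proof.
apply: (le_trans (rnorm_ge0 (f 0))); apply: (sup_upper_bound (adnorm_has_sup f)).
by exists 0 => //=; rewrite pnorm0.
Qed.

Lemma adnormP f x : rnorm (f x) <= adnorm f * pnorm s x.
Proof.
have [x0|x0] := eqVneq (pnorm s x) 0.
  have /asboolP[_ [M fM]] := antidualP f.
  by have := fM x; rewrite x0 !mulr0.
have xgt0 : 0 < pnorm s x by rewrite lt_def x0 pnorm_ge0.
have nr : rnorm ((pnorm s x)^-1%:C : C^o) = (pnorm s x)^-1.
  apply: complexI; rewrite rnormE ger0_norm// ler0c invr_ge0; exact: pnorm_ge0.
rewrite -ler_pdivrMr// mulrC -nr -rnorm_conj -rnormM -antidualZ.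
by apply: (sup_upper_bound (adnorm_has_sup f)); eexists; last by [];
  rewrite /= pnormZ nr mulVf.
Qed.

Lemma adnorm_le f (M : R) : 0 <= M ->
  (forall x, rnorm (f x) <= M * pnorm s x) -> adnorm f <= M.
Proof.
move=> M0 fM; apply: ge_sup; first by have [] := adnorm_has_sup f.
by move=> _ [x /= x1 <-]; apply: (le_trans (fM x)); rewrite ler_piMr.
Qed.

Lemma adnormD f g : (adnorm (f + g))%:C <= (adnorm f)%:C + (adnorm g)%:C.
Proof.
rewrite -rmorphD lecR; apply: adnorm_le; first by rewrite addr_ge0// adnorm_ge0.
move=> x; rewrite mulrDl; apply: (le_trans (rnormD _ _)).
by apply: lerD; exact: adnormP.
Qed.

Lemma adnormZ (a : C) f : (adnorm (a *: f))%:C = `|a| * (adnorm f)%:C.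
Proof.
have le b g : adnorm (b *: g) <= rnorm (b : C^o) * adnorm g.
  apply: adnorm_le; first by rewrite mulr_ge0 ?rnorm_ge0 ?adnorm_ge0.
  move=> x; rewrite -[(b *: g) x]/(b *: g x) rnormZ -mulrA ler_wpM2l ?rnorm_ge0//.
  exact: adnormP.
suff : adnorm (a *: f) = rnorm (a : C^o) * adnorm f.
  by move=> ->; rewrite rmorphM /= rnormE.
apply/eqP; rewrite eq_le le /=.
have [->|a0] := eqVneq a 0; first by rewrite rnorm0 mul0r adnorm_ge0.
rewrite -ler_pdivlMl; last first.
  rewrite lt_def rnorm_ge0 andbT; apply: contra_neq a0; exact: rnorm0_eq0.
have -> : (rnorm (a : C^o))^-1 = rnorm (a^-1 : C^o).
  by apply: complexI; rewrite fmorphV !rnormE normfV.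
by rewrite -{1}[f](scalerK a0) le.
Qed.

Lemma adnorm0_eq0 f : (adnorm f)%:C = 0 -> f = 0.
Proof.
move=> /complexI f0; apply: val_inj; apply/funext => x /=.
apply: rnorm0_eq0; apply/eqP; rewrite eq_le rnorm_ge0 andbT.
by have := adnormP f x; rewrite f0 mul0r.
Qed.

HB.instance Definition _ :=
  Lmodule_isNormed.Build C antidual adnormD adnormZ adnorm0_eq0.

Lemma antidual_le f x : rnorm (f x) <= rnorm f * pnorm s x.
Proof. exact: adnormP. Qed.

Lemma kernel_antibounded x : (s x : V -> C^o) \in antibounded.
Proof.
apply/asboolP; split=> [a y z|]; first exact: pformDr.
by exists (pnorm s x) => y; exact: pform_CauchySchwarz.
Qed.

Definition kernel x : antidual := Antidual (kernel_antibounded x).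

Lemma kernel_linear : linear kernel.
Proof.
by move=> a x y; apply: val_inj; apply/funext => z; exact: pformDl.
Qed.

HB.instance Definition _ :=
  GRing.isLinear.Build C V antidual *:%R kernel kernel_linear.

Lemma rnorm_kernel x : rnorm (kernel x) = pnorm s x.
Proof.
apply/eqP; rewrite eq_le adnorm_le ?pnorm_ge0//=; last exact: pform_CauchySchwarz.
have [->|x0] := eqVneq (pnorm s x) 0; first exact: rnorm_ge0.
have xgt0 : 0 < pnorm s x by rewrite lt_def x0 pnorm_ge0.
rewrite -(ler_pM2r xgt0); apply: le_trans (adnormP _ x).
by rewrite -lecR rnormE /= -pnorm_sqr expr2 ger0_norm// ler0c -expr2 sqr_ge0.
Qed.

Lemma norm_kernel_sqr x : `|kernel x| ^+ 2 = s x x.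
Proof. by rewrite -rnormE -rmorphXn /= rnorm_kernel pnorm_sqr. Qed.

(** An approximate Riesz representation: minimizing [|x|^2 - 2 Re f x] up to
    [e ^+ 2] gives a vector that represents [f] up to [e]. *)
Lemma kernel_dense f (e : R) : 0 < e -> exists a, rnorm (f - kernel a) <= e.
Proof.
move=> e0; pose J x := pnorm s x ^+ 2 - 2 * complex.Re (f x).
have Jlb x : - adnorm f ^+ 2 <= J x.
  have := le_trans (rnorm_Re (f x)) (adnormP f x).
  move/(le_trans (ler_norm _)); rewrite /J.
  by have := sqr_ge0 (adnorm f - pnorm s x); nra.
have hi : has_inf (range J).
  split; first by exists (J 0), 0.
  by exists (- adnorm f ^+ 2) => _ [x _ <-].
have [_ [a _ <-] aJ] := inf_adherent (exprn_gt0 2 e0) hi.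
exists a; apply: adnorm_le (ltW e0) _ => y.
rewrite -(@ler_pXn2r _ 2) ?nnegrE ?rnorm_ge0 ?mulr_ge0 ?pnorm_ge0 ?(ltW e0)//.
have -> : rnorm ((f - kernel a) y) = rnorm (s a y - f y : C^o) by rewrite [RHS]rnormB.
rewrite exprMn.
apply: le_of_quadratic; rewrite ?sqr_ge0// => t.
have := @riesz_expansion _ _ s f a y t (antidual_lin f).
set x := - _ *: y + a; have := inf_lbound (proj2 hi) (ex_intro2 _ _ x I erefl : range J (J x)).
by rewrite /J in aJ *; lra.
Qed.

Lemma antidual_complete (F : set_system antidual) :
  ProperFilter F -> cauchy F -> cvg F.
Proof.
move=> FF /cauchy_ballP Fc.
have Fc' (e : R) : 0 < e ->
    \forall f \near F, \forall g \near F, rnorm (f - g) <= e.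
  move=> e0; have ec0 : 0 < e%:C :> C by rewrite ltcR.
  have /nearP_dep := Fc _ ec0; apply: filterS => f; apply: filterS => g.
  by rewrite -ball_normE /= -rnormE ltcR; exact: ltW.
have Fx x : cvg ((fun f : antidual => f x) @ F).
  apply: complex_complete; apply/cauchy_ballP => e e0; rewrite near_simpl.
  have [r r0 er] := gt0_complexP e0.
  have pos : 0 < r / (pnorm s x + 1) by rewrite divr_gt0// ltr_wpDl ?pnorm_ge0.
  have posC : 0 < (r / (pnorm s x + 1))%:C :> C by rewrite ltcR.
  have := Fc _ posC; rewrite near_simpl => -[[A B] /= [FA FB] AB].
  exists (A, B) => //= -[f g] /= [Af Bg]; rewrite -ball_normE /=.
  have := AB (f, g) (conj Af Bg); rewrite /= -ball_normE /= -!rnormE er !ltcR => fg.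
  have := antidual_le (f - g) x => /le_lt_trans; apply.
  rewrite ltr_pdivlMr ?ltr_wpDl ?pnorm_ge0// in fg.
  by have := rnorm_ge0 (f - g); lra.
pose l : V -> C^o := fun x => lim ((fun f : antidual => f x) @ F).
have Fl x : (fun f : antidual => f x) @ F --> l x by exact: Fx.
have Fle (e : R) : 0 < e -> \forall f \near F, forall x,
    rnorm (l x - (f : antidual) x) <= e * pnorm s x.
  move=> e0; apply: filterS (Fc' e e0) => f fg x.
  have cv : (fun g : antidual => rnorm (g x - f x : C^o)) @ F
      --> rnorm (l x - f x : C^o).
    by apply: cvg_rnorm; apply: cvgB; [exact: Fl|exact: cvg_cst].
  rewrite -(cvg_lim _ cv)//; apply: limr_le; first by apply/cvg_ex; eexists; exact: cv.
  near=> g; rewrite rnormB -[f x - g x]/((f - g) x).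
  apply: le_trans (antidual_le (f - g) x) _; rewrite ler_wpM2r ?pnorm_ge0//.
  by near: g.
have lb : l \in antibounded.
  apply/asboolP; split=> [a x y|]; last first.
    have [f fl] := filter_ex (Fle 1 ltr01).
    exists (1 + adnorm f) => x; rewrite -(subrK (f x) (l x)) mulrDl.
    apply: le_trans (rnormD _ _) _; apply: lerD; first exact: fl.
    exact: adnormP.
  apply: (cvg_unique _ (Fl (a *: x + y))) => //.
  rewrite (_ : (fun _ => _) = (fun f : antidual => Num.conj a *: (f x : C^o) + f y));
    last by apply/funext => f; exact: antidual_lin.
  by apply: cvgD => //; apply: cvgZl_tmp.
apply/cvg_ex; exists (Antidual lb); apply: rnorm_cvgP => e e0.
apply: filterS (Fle e e0) => f fl.
by apply: adnorm_le => //; exact: ltW.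
Unshelve. all: by end_near. Qed.

HB.instance Definition _ := Uniform_isComplete.Build antidual antidual_complete.

End antidual.

(** * The inner product of the Hilbert space of a positive form *)

Section antidual_dot.
Variables (R : realType) (V : lmodType R[i]) (s : psd_form V).
Local Notation C := R[i].
Local Notation D := (antidual s).
Implicit Types (f g : D) (x y : V).

Lemma pnorm_sqrD x y :
  pnorm s (x + y) ^+ 2 = pnorm s x ^+ 2 + pnorm s y ^+ 2 + 2 * complex.Re (s x y).
Proof.
have E (w : C) : (2 * complex.Re w)%:C = w + Num.conj w.
  by case: w => u v; apply/eqP; rewrite eq_complex /=; apply/andP; split; apply/eqP; ring.
have addl x' y' z : s (x' + y') z = s x' z + s y' z.
  by rewrite -{1}(scale1r x') pformDl mul1r.
apply: complexI; rewrite !rmorphD /= !pnorm_sqr E addl !(pformC s (x + y)) !addl.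
by rewrite !rmorphD /= -!pformC; ring.
Qed.

(** The inner product is recovered from the norm by polarization; its algebraic
    properties hold on the dense range of [kernel], where it is [s], and pass to
    limits of sequences ([addot_cvg], [kernel_seq]). *)
Definition addot f g : C :=
  ((rnorm (f + g) ^+ 2 - rnorm (f - g) ^+ 2) / 4) +i*
  ((rnorm (f + 'i *: g) ^+ 2 - rnorm (f - 'i *: g) ^+ 2) / 4).

Lemma pform_polar x y : s x y =
  ((pnorm s (x + y) ^+ 2 - pnorm s (x - y) ^+ 2) / 4) +i*
  ((pnorm s (x + 'i *: y) ^+ 2 - pnorm s (x - 'i *: y) ^+ 2) / 4).
Proof.
have E b z : s x (b *: z) = Num.conj b * s x z.
  by rewrite -[b *: z]addr0 pformDr (pformC s 0) pform0l conjC0 addr0.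
rewrite -(scaleN1r y) -(scaleN1r ('i *: y)) scalerA !pnorm_sqrD !pnormZ !E.
have n1 : rnorm (-1 : C^o) = 1 by apply: complexI; rewrite rnormE normrN1.
have ni : rnorm ('i : C^o) = 1 by rewrite /rnorm /= expr0n expr1n add0r sqrtr1.
have nni : rnorm (-1 * 'i : C^o) = 1 by rewrite mulN1r /rnorm normrN /= expr0n expr1n add0r sqrtr1.
rewrite n1 ni nni; case: (s x y) => u v /=.
by apply/eqP; rewrite eq_complex /=; apply/andP; split; apply/eqP; field.
Qed.

Lemma addot_cvg (a b : nat -> V) f g :
  kernel s \o a @ \oo --> f -> kernel s \o b @ \oo --> g ->
  (fun n => s (a n) (b n) : C^o) @ \oo --> (addot f g : C^o).
Proof.
move=> af bg.
have sq (u v : C) : (fun n => pnorm s (u *: a n + v *: b n) ^+ 2) @ \oo -->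
    rnorm (u *: f + v *: g) ^+ 2.
  under eq_fun do rewrite -rnorm_kernel linearD !linearZ /= expr2.
  rewrite expr2; have cv : (fun n => rnorm (u *: kernel s (a n) + v *: kernel s (b n)))
      @ \oo --> rnorm (u *: f + v *: g).
    by apply: cvg_rnorm; apply: cvgD; apply: cvgZl_tmp.
  exact: cvgM.
have sq2 (u v : C) : (fun n => (pnorm s (a n + u *: b n) ^+ 2 -
      pnorm s (a n + v *: b n) ^+ 2) / 4) @ \oo -->
    (rnorm (f + u *: g) ^+ 2 - rnorm (f + v *: g) ^+ 2) / 4.
  apply: cvgM; last exact: cvg_cst.
  have sq1 w : (fun n => pnorm s (a n + w *: b n) ^+ 2) @ \oo --> rnorm (f + w *: g) ^+ 2.
    by have := sq 1 w; under eq_fun do rewrite scale1r; rewrite scale1r.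
  by apply: cvgB; exact: sq1.
rewrite (_ : (fun n => _) = (fun n => ((pnorm s (a n + b n) ^+ 2 -
    pnorm s (a n - b n) ^+ 2) / 4) +i* ((pnorm s (a n + 'i *: b n) ^+ 2 -
    pnorm s (a n - 'i *: b n) ^+ 2) / 4))); last by apply/funext => n; exact: pform_polar.
apply: cvg_ReIm.
  have := sq2 1 (-1); under eq_fun do rewrite scale1r scaleN1r.
  by rewrite scale1r scaleN1r.
by have := sq2 'i (- 'i); under eq_fun do rewrite scaleNr; rewrite scaleNr.
Qed.

Lemma kernel_seq f : exists a : nat -> V, kernel s \o a @ \oo --> f.
Proof.
have /choice[a aP] n : exists a, rnorm (f - kernel s a) <= n.+1%:R^-1.
  by apply: kernel_dense; rewrite invr_gt0.
exists a; apply/cvg_rnormP => e e0.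
have /cvgrPdist_le/(_ e e0) := @cvg_harmonic R; apply: filterS => n.
rewrite sub0r normrN ger0_norm ?invr_ge0// => h; exact: le_trans (aP n) h.
Qed.

Lemma addot_linear g : linear_for *%R (addot^~ g).
Proof.
move=> u f f'; have [a af] := kernel_seq f; have [a' af'] := kernel_seq f'.
have [b bg] := kernel_seq g.
have cv : kernel s \o (fun n => u *: a n + a' n) @ \oo --> u *: f + f'.
  rewrite (_ : _ \o _ = (fun n => u *: kernel s (a n) + kernel s (a' n))); last first.
    by apply/funext => n; exact: linearP.
  by apply: cvgD => //; apply: cvgZl_tmp.
apply: (cvg_unique _ (addot_cvg cv bg)) => //.
rewrite (_ : (fun _ => _) = (fun n => u *: (s (a n) (b n) : C^o) + s (a' n) (b n)));
  last by apply/funext => n; exact: pformDl.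
by apply: cvgD; [apply: (@cvgZl_tmp _ C^o)|]; apply: addot_cvg.
Qed.

Lemma addotC f g : addot f g = Num.conj (addot g f).
Proof.
have [a af] := kernel_seq f; have [b bg] := kernel_seq g.
apply: (cvg_unique _ (addot_cvg af bg)) => //; apply/cvg_rnormP => e e0.
have /cvg_rnormP/(_ e e0) := addot_cvg bg af.
apply: filterS => n; congr (_ <= _).
by rewrite -[LHS]rnorm_conj rmorphB /= -pformC.
Qed.

Lemma addotE f : addot f f = (rnorm f ^+ 2)%:C.
Proof.
have [a af] := kernel_seq f.
apply: (cvg_unique _ (addot_cvg af af)) => //.
have cv : (fun n => rnorm (kernel s (a n))) @ \oo --> rnorm f by apply: cvg_rnorm.
apply: (@cvg_ReIm _ _ _ (fun n => s (a n) (a n) : C^o)).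
  rewrite (_ : _ \o _ = (fun n => rnorm (kernel s (a n)) * rnorm (kernel s (a n)))).
    by rewrite expr2; apply: cvgM.
  by apply/funext => n /=; rewrite -norm_kernel_sqr -rnormE -rmorphXn /= expr2.
rewrite (_ : _ \o _ = cst 0); first exact: cvg_cst.
by apply/funext => n /=; rewrite -norm_kernel_sqr -rnormE -rmorphXn.
Qed.

Lemma addot_kernel f x : addot f (kernel s x) = f x.
Proof.
have [a af] := kernel_seq f.
have bg : kernel s \o (fun=> x) @ \oo --> kernel s x by exact: cvg_cst.
apply: (cvg_unique _ (addot_cvg af bg)) => //; apply/cvg_rnormP => e e0.
have pos : 0 < e / (pnorm s x + 1) by rewrite divr_gt0// ltr_wpDl ?pnorm_ge0.
have /cvg_rnormP/(_ _ pos) := af; apply: filterS => n.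
rewrite ler_pdivlMr ?ltr_wpDl ?pnorm_ge0// => le.
apply: le_trans (antidual_le (f - kernel s (a n)) x) _.
by have := rnorm_ge0 (f - kernel s (a n)); rewrite /= in le *; lra.
Qed.

Lemma addot_bilinear : bilinear_for *%R (Num.conj \; *%R) addot.
Proof.
split=> [y|x]; first exact: addot_linear.
by move=> a y z; rewrite !(addotC x) addot_linear rmorphD rmorphM.
Qed.

HB.instance Definition _ := @bilinear_isBilinear.Build C D D C
  *%R (Num.conj \; *%R) addot addot_bilinear.

Lemma addot_hermitian f g : addot f g = (-1) ^+ false * Num.conj (addot g f).
Proof. by rewrite expr0 mul1r addotC. Qed.

HB.instance Definition _ := isHermitianSesquilinear.Build C D false
  (@Num.conj C) addot addot_hermitian.

Lemma addot_gt0 f : f != 0 -> 0 < addot f f.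
Proof.
move=> f0; rewrite addotE ltcR exprn_gt0// lt_def rnorm_ge0 andbT.
by apply: contra_neq f0; exact: rnorm0_eq0.
Qed.

HB.instance Definition _ := isDotProduct.Build C D addot addot_gt0.

Lemma addot_norm_sqr f : `|f| ^+ 2 = addot f f.
Proof. by rewrite addotE rmorphXn /= rnormE. Qed.

HB.instance Definition _ := isHilbert.Build R D addot_norm_sqr.

Lemma addot_CauchySchwarz f g : rnorm (addot f g : C^o) <= rnorm f * rnorm g.
Proof.
have := dot_CauchySchwarz (addot : {dot D for (@Num.conj C)}) f g.
rewrite /= !addotE -rnormE -!rmorphM /= -rmorphXn lecR -exprMn.
by rewrite ler_pXn2r ?nnegrE ?mulr_ge0 ?rnorm_ge0.
Qed.

End antidual_dot.

(** * Sublinear functionals and separation *)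

Section sublinear.
Variables (R : realType) (V : lmodType R).
Implicit Types (P Q : V -> R) (x y v : V).

Definition sublinear Q := (forall x y, Q (x + y) <= Q x + Q y) /\
  (forall (a : R) x, 0 < a -> Q (a *: x) <= a * Q x).

Lemma sublinear0 Q : sublinear Q -> Q 0 = 0.
Proof.
case=> _ Qh; have := Qh 2 0 (ltr0Sn _ 1); have : 0 < (2 : R)^-1 by rewrite invr_gt0.
by move=> /(Qh _ 0); rewrite !scaler0; lra.
Qed.

Lemma sublinearN Q x : sublinear Q -> - Q (- x) <= Q x.
Proof. by move=> Ql; have [+ _] := Ql => /(_ x (- x)); rewrite subrr sublinear0//; lra. Qed.

Lemma sublinearB Q x y : sublinear Q -> Q x - Q y <= Q (x - y).
Proof. by case=> + _ => /(_ (x - y) y); rewrite subrK; lra. Qed.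

(** Three infima of this kind occur: over a chain of sublinear functionals, over the
    translates along a vector, and over a convex cone. *)
Lemma inf_sublinear P (A : V -> set R) : sublinear P ->
  (forall x, A x !=set0) -> (forall x r, A x r -> - P (- x) <= r) ->
  (forall x y r r', A x r -> A y r' -> exists2 q, A (x + y) q & q <= r + r') ->
  (forall (a : R) x r, 0 < a -> A x r -> exists2 q, A (a *: x) q & q <= a * r) ->
  sublinear (fun x => inf (A x)).
Proof.
move=> Ps A0 Alb AD AZ.
have Ah x : has_inf (A x) by split; [exact: A0|exists (- P (- x)) => r /Alb].
have inf_le x r : A x r -> inf (A x) <= r by apply: inf_lbound; case: (Ah x).
split=> [x y|a x a0].
  apply/ler_addgt0Pr => e e0; have e2 : 0 < e / 2 by rewrite divr_gt0.
  have [r Ar re] := inf_adherent e2 (Ah x); have [r' Ar' re'] := inf_adherent e2 (Ah y).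
  have [q /inf_le Aq qr] := AD _ _ _ _ Ar Ar'; lra.
rewrite mulrC -ler_pdivrMr//; apply: lb_le_inf; first exact: A0.
move=> r Ar; rewrite ler_pdivrMr// mulrC.
by have [q /inf_le Aq qr] := AZ _ _ _ a0 Ar; exact: le_trans qr.
Qed.

(** The Hahn-Banach theorem. A minimal sublinear functional [Q] below [P] exists by
    Zorn's lemma. The infimum over [t >= 0] of [Q (x + t v) - t Q v] is sublinear
    and below [Q], hence equal to it; its value at [-v] is at most [- Q v], so [Q]
    is odd, and an odd sublinear functional is linear. *)
Theorem sublinear_dominates_linear P : sublinear P ->
  exists Phi : V -> R, [/\ forall x y, Phi (x + y) = Phi x + Phi y,
    forall a x, Phi (a *: x) = a * Phi x & forall x, Phi x <= P x].
Proof.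
move=> Ps; pose T := {Q : V -> R | sublinear Q /\ forall x, Q x <= P x}.
pose below (Q Q' : T) := `[< forall x, sval Q' x <= sval Q x >].
have lb (Q : T) x : - P (- x) <= sval Q x.
  by case: Q => Q /= [Qs QP]; apply: le_trans (sublinearN x Qs); rewrite lerN2 QP.
have [|||[Q [Qs QP]] Qmin] := @ZL_preorder T (exist _ P (conj Ps (fun=> lexx _))) below.
- by move=> Q; apply/asboolP => x.
- by move=> Q1 Q2 Q3 /asboolP h1 /asboolP h2; apply/asboolP => x; exact: le_trans (h2 x) _.
- move=> A Atot; have [[Q0 AQ0]|noA] := pselect (exists Q : T, A Q); last first.
    exists (exist _ P (conj Ps (fun=> lexx _))) => Q AQ.
    by exfalso; apply: noA; exists Q.
  pose I x := [set r | exists2 Q : T, A Q & r = sval Q x].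
  have Is : sublinear (fun x => inf (I x)).
    apply: (@inf_sublinear P) => //.
    + by move=> x; exists (sval Q0 x), Q0.
    + by move=> x _ [Q _ ->].
    + move=> x y _ _ [Q AQ ->] [Q' AQ' ->].
      have [/asboolP QQ'|/asboolP QQ'] := Atot _ _ AQ AQ'.
        exists (sval Q' (x + y)); first by exists Q'.
        by case: Q' {AQ'} QQ' => Q' /= [[h _] _] QQ'; rewrite (le_trans (h _ _))// lerD2r.
      exists (sval Q (x + y)); first by exists Q.
      by case: Q {AQ} QQ' => Q /= [[h _] _] QQ'; rewrite (le_trans (h _ _))// lerD2l.
    + move=> a x _ a0 [Q AQ ->]; exists (sval Q (a *: x)); first by exists Q.
      by case: Q {AQ} => Q /= [[_ h] _]; exact: h.
  have Ile (Q : T) x : A Q -> inf (I x) <= sval Q x.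
    by move=> AQ; apply: inf_lbound; [exists (- P (- x)) => _ [Q' _ ->]|exists Q].
  have IP x : inf (I x) <= P x.
    by apply: le_trans (Ile _ _ AQ0) _; case: (Q0) => Q /= [].
  by exists (exist _ (fun x => inf (I x)) (conj Is IP) : T) => Q AQ; apply/asboolP => x; exact: Ile.
have odd v : Q (- v) = - Q v.
  apply/eqP; rewrite eq_le; apply/andP; split; last by have := sublinearN v Qs; lra.
  pose I x := [set Q (x + t *: v) - t * Q v | t in [set t | 0 <= t]].
  have Ilb x r : I x r -> - Q (- x) <= r.
    case=> t /= t0 <-; rewrite lerBrDr.
    have [->|t1] := eqVneq t 0.
      by rewrite scale0r mul0r !addr0; exact: sublinearN.
    have tpos : 0 < t by rewrite lt_def t1.
    have [_ /(_ t^-1 (t *: v))] := Qs; rewrite invr_gt0 scalerA mulVf// scale1r => /(_ tpos).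
    rewrite mulrC ler_pdivlMr// mulrC => tv.
    by have := sublinearB (t *: v) (- x) Qs; rewrite opprK [_ + x]addrC; lra.
  have Is : sublinear (fun x => inf (I x)).
    apply: (@inf_sublinear Q) => //.
    + by move=> x; exists (Q (x + 0 *: v) - 0 * Q v); exists 0 => /=.
    + move=> x y _ _ [t /= t0 <-] [t' /= t'0 <-].
      exists (Q (x + y + (t + t') *: v) - (t + t') * Q v).
        by exists (t + t') => //=; rewrite addr_ge0.
      have [+ _] := Qs => /(_ (x + t *: v) (y + t' *: v)).
      by rewrite addrACA -scalerDl; lra.
    + move=> a x _ a0 [t /= t0 <-].
      exists (Q (a *: x + (a * t) *: v) - (a * t) * Q v).
        by exists (a * t) => //=; rewrite mulr_ge0// ltW.
      have [_ /(_ a (x + t *: v) a0)] := Qs; rewrite scalerDr scalerA; lra.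
  have Ile x t : 0 <= t -> inf (I x) <= Q (x + t *: v) - t * Q v.
    move=> t0; apply: inf_lbound; last by exists t.
    by exists (- Q (- x)) => r; exact: Ilb.
  have IQ x : inf (I x) <= Q x.
    by have := Ile x 0 (lexx _); rewrite scale0r mul0r addr0 subr0.
  have IP x : inf (I x) <= P x by apply: le_trans (IQ x) (QP x).
  have /asboolP/(_ (- v))/= QI := Qmin (exist _ (fun x => inf (I x)) (conj Is IP) : T) (asboolT IQ).
  apply: le_trans QI _; have := Ile (- v) 1 ler01.
  by rewrite scale1r mul1r addNr sublinear0// sub0r.
have add x y : Q (x + y) = Q x + Q y.
  apply/eqP; rewrite eq_le; have [-> _ /=] := Qs.
  by have := sublinearB x (- y) Qs; rewrite opprK odd opprK.
exists Q; split=> // a x.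
have pos b z : 0 < b -> Q (b *: z) = b * Q z.
  move=> b0; apply/eqP; rewrite eq_le; have [_ Qh] := Qs; rewrite Qh//=.
  have := Qh b^-1 (b *: z); rewrite invr_gt0 scalerA mulVf ?gt_eqF// scale1r => /(_ b0).
  by rewrite mulrC ler_pdivlMr// mulrC.
have [a0|a0|->] := ltgtP a 0; last by rewrite scale0r mul0r sublinear0.
  by rewrite -[a *: x]opprK -scaleNr odd pos ?oppr_gt0// mulNr opprK.
exact: pos.
Qed.

(** Apply the Hahn-Banach theorem to the infimum of [P (x + g) - r] over the cone [K];
    it is finite because [K] satisfies the inequality [r <= P g]. *)
Corollary sublinear_separation P (K : V -> R -> Prop) : sublinear P ->
  K 0 0 -> (forall g r g' r', K g r -> K g' r' -> K (g + g') (r + r')) ->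
  (forall (a : R) g r, 0 < a -> K g r -> K (a *: g) (a * r)) ->
  (forall g r, K g r -> r <= P g) ->
  exists Phi : V -> R, [/\ forall x y, Phi (x + y) = Phi x + Phi y,
    forall a x, Phi (a *: x) = a * Phi x, forall x, Phi x <= P x &
    forall g r, K g r -> r <= Phi g].
Proof.
move=> Ps K0 KD KZ KP.
pose I x := [set q | exists g r, K g r /\ q = P (x + g) - r].
have Ilb x q : I x q -> - P (- x) <= q.
  by move=> [g [r [/KP h ->]]]; have := sublinearB g (- x) Ps; rewrite opprK (addrC g x); lra.
have Is : sublinear (fun x => inf (I x)).
  apply: (@inf_sublinear P) => //.
  - by move=> x; exists (P (x + 0) - 0), 0, 0.
  - move=> x y _ _ [g [r [h ->]]] [g' [r' [h' ->]]].
    exists (P (x + y + (g + g')) - (r + r')).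
      by exists (g + g'), (r + r'); split=> //; exact: KD.
    by have [+ _] := Ps => /(_ (x + g) (y + g')); rewrite addrACA; lra.
  - move=> a x _ a0 [g [r [h ->]]]; exists (P (a *: x + a *: g) - a * r).
      by exists (a *: g), (a * r); split=> //; exact: KZ.
    by have [_ /(_ a (x + g) a0)] := Ps; rewrite scalerDr; lra.
have Ile x g r : K g r -> inf (I x) <= P (x + g) - r.
  move=> h; apply: inf_lbound; last by exists g, r.
  by exists (- P (- x)) => q; exact: Ilb.
have [Phi [PhiD PhiZ PhiI]] := sublinear_dominates_linear Is.
exists Phi; split=> // [x|g r h].
  by apply: le_trans (PhiI x) _; have := Ile x _ _ K0; rewrite addr0 subr0.
have := le_trans (PhiI (- g)) (Ile (- g) _ _ h).
by rewrite addNr sublinear0// -scaleN1r PhiZ; lra.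
Qed.

End sublinear.

Section bounded_functions.
Variables (R : realType) (S : Type) (s0 : S).

Definition bounded_fun_pred : {pred S -> R^o} :=
  [pred f : S -> R^o | `[< exists M : R, forall x, `|f x| <= M >]].

Lemma bounded_fun_submod : submod_closed bounded_fun_pred.
Proof.
split; first by apply/asboolP; exists 0 => x; rewrite normr0.
move=> a f g /asboolP[M fM] /asboolP[N gN]; apply/asboolP; exists (`|a| * M + N) => x.
rewrite -[(a *: f + g) x]/(a * f x + g x).
by rewrite (le_trans (ler_normD _ _))// normrM lerD// ler_wpM2l.
Qed.

HB.instance Definition _ := GRing.isSubmodClosed.Build R (S -> R^o)
  bounded_fun_pred bounded_fun_submod.

Record bfun := Bfun { bfun_fun :> S -> R^o ; bfunP : bfun_fun \in bounded_fun_pred }.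

HB.instance Definition _ := [isSub for bfun_fun].
HB.instance Definition _ := [Choice of bfun by <:].
HB.instance Definition _ := [SubChoice_isSubLmodule of bfun by <:].

Definition bfun_sup (f : bfun) : R := sup (range f).

Lemma bfun_has_sup (f : bfun) : has_sup (range f).
Proof.
split; first by exists (f s0), s0.
have /asboolP[M fM] := bfunP f; exists M => _ [x _ <-].
exact: le_trans (ler_norm _) (fM x).
Qed.

Lemma bfun_le_sup (f : bfun) x : f x <= bfun_sup f.
Proof. by apply: (sup_upper_bound (bfun_has_sup f)); exists x. Qed.

Lemma bfun_sup_le (f : bfun) M : (forall x, f x <= M) -> bfun_sup f <= M.
Proof.
move=> fM; apply: ge_sup; first by have [] := bfun_has_sup f.
by move=> _ [x _ <-].
Qed.

Lemma bfun_sup_sublinear : sublinear bfun_sup.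
Proof.
split=> [f g|a f a0]; apply: bfun_sup_le => x.
  by rewrite -[(f + g) x]/(f x + g x) lerD// bfun_le_sup.
by rewrite -[(a *: f) x]/(a * f x) ler_pM2l// bfun_le_sup.
Qed.

End bounded_functions.

(** * Row, column and operator norms of matrices of operators *)

Lemma sqrt_leP (R : realType) (S B : R) : 0 <= S -> 0 <= B ->
  (Num.sqrt S <= B) = (S <= B ^+ 2).
Proof.
move=> S0 B0; rewrite -{2}(sqr_sqrtr S0).
by rewrite ler_pXn2r ?nnegrE ?sqrtr_ge0.
Qed.

Lemma rnorm_sum (R : realType) (V : normedModType R[i]) (I : Type) (r : seq I)
  (P : pred I) (F : I -> V) :
  rnorm (\sum_(i <- r | P i) F i) <= \sum_(i <- r | P i) rnorm (F i).
Proof.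
elim/big_rec2: _ => [|i y x _ le]; first by rewrite rnorm0.
by apply: le_trans (rnormD _ _) _; rewrite lerD2l.
Qed.

Lemma rnorm_real (R : realType) (a : R) : rnorm (a%:C : R[i]^o) = `|a|.
Proof. by apply: complexI; rewrite rnormE /= normc_def /= expr0n addr0 sqrtr_sqr. Qed.

Lemma rnormZ_real (R : realType) (V : normedModType R[i]) (a : R) (x : V) :
  rnorm (a%:C *: x) = `|a| * rnorm x.
Proof. by rewrite rnormZ rnorm_real. Qed.

Section operator_matrices.
Variables (R : realType) (H : hilbertType R).
Local Notation C := R[i].

(** Being homogeneous, this form of the bound is easier to handle than the supremum
    over the unit ball. *)
Definition opmx_le n (a : 'M[bop H H]_n) (B : R) := forall xi : 'I_n -> H,
  \sum_i rnorm (\sum_j a i j (xi j)) ^+ 2 <= B ^+ 2 * \sum_j rnorm (xi j) ^+ 2.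

Lemma opmx_normP n (a : 'M[bop H H]_n) (B : R) : 0 <= B ->
  (opmx_norm a <= B%:E)%E <-> opmx_le a B.
Proof.
move=> B0; have S0 (v : 'I_n -> H) : 0 <= \sum_j rnorm (v j) ^+ 2.
  by apply: sumr_ge0 => j _; exact: sqr_ge0.
split=> [le xi|le]; last first.
  apply: ge_ereal_sup => _ [xi /= xi1 <-]; rewrite lee_fin sqrt_leP//.
  by apply: le_trans (le xi) _; rewrite ler_piMr ?sqr_ge0.
have [xi0|xi0] := eqVneq (\sum_j rnorm (xi j) ^+ 2) 0.
  have z j : xi j = 0.
    move/eqP: xi0; rewrite psumr_eq0; last by move=> i _; exact: sqr_ge0.
    move/allP => /(_ j); rewrite mem_index_enum sqrf_eq0 => /(_ isT)/eqP.
    exact: rnorm0_eq0.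
  rewrite xi0 mulr0 big1// => i _; rewrite big1 ?rnorm0 ?expr0n// => j _.
  by rewrite z linear0.
have pos : 0 < \sum_j rnorm (xi j) ^+ 2 by rewrite lt_def xi0 S0.
pose c := (Num.sqrt (\sum_j rnorm (xi j) ^+ 2))^-1.
have c2 : c ^+ 2 = (\sum_j rnorm (xi j) ^+ 2)^-1 by rewrite exprVn sqr_sqrtr ?S0.
have sc (v : 'I_n -> H) : \sum_j rnorm (c%:C *: v j) ^+ 2 = c ^+ 2 * \sum_j rnorm (v j) ^+ 2.
  rewrite mulr_sumr; apply: eq_bigr => j _.
  by rewrite rnormZ_real exprMn real_normK ?num_real.
have : ((Num.sqrt (\sum_(i < n)
    rnorm (\sum_(j < n) a i j (c%:C *: xi j)) ^+ 2))%:E <= B%:E)%E.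
  apply: le_trans le; apply: ereal_sup_ubound; exists (fun j => c%:C *: xi j) => //=.
  by rewrite sc c2 mulVf.
rewrite lee_fin sqrt_leP//.
rewrite (eq_bigr (fun i => rnorm (c%:C *: \sum_j a i j (xi j)) ^+ 2)); last first.
  move=> i _; congr (rnorm _ ^+ 2); rewrite scaler_sumr; apply: eq_bigr => j _.
  by rewrite linearZ.
by rewrite (sc (fun i => _)) c2 mulrC ler_pdivrMr.
Qed.

Definition ocol_le n (x : 'I_n -> bop H H) (B : R) := forall xi : H,
  \sum_j rnorm (x j xi) ^+ 2 <= B ^+ 2 * rnorm xi ^+ 2.

Definition orow_le n (x : 'I_n -> bop H H) (B : R) := forall xi : 'I_n -> H,
  rnorm (\sum_j x j (xi j)) ^+ 2 <= B ^+ 2 * \sum_j rnorm (xi j) ^+ 2.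

(** A column is a square matrix with one nonzero column, so that completely bounded
    maps act on column norms. *)
Lemma ocol_leP n (x : 'I_n.+1 -> bop H H) B :
  ocol_le x B <-> opmx_le (\matrix_(i, j) if j == ord0 then x i else 0) B.
Proof.
have E (xi : 'I_n.+1 -> H) i : \sum_j (\matrix_(i, j) if j == ord0 then x i else 0) i j (xi j) =
    x i (xi ord0).
  rewrite (bigD1 ord0)//= mxE eqxx big1 ?addr0// => j /negPf j0.
  by rewrite mxE j0.
split=> le xi.
  under eq_bigr do rewrite E.
  apply: le_trans (le _) _; rewrite ler_wpM2l ?sqr_ge0//.
  by rewrite (bigD1 ord0)//= lerDl sumr_ge0// => j _; exact: sqr_ge0.
have := le (fun j => if j == ord0 then xi else 0).
under eq_bigr do rewrite E eqxx.
rewrite [X in _ <= _ * X -> _](bigD1 ord0)//= [X in rnorm _ ^+ 2 + X]big1 ?addr0//.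
by move=> j /negPf ->; rewrite rnorm0 expr0n.
Qed.

Lemma orow_leP n (x : 'I_n.+1 -> bop H H) B :
  orow_le x B <-> opmx_le (\matrix_(i, j) if i == ord0 then x j else 0) B.
Proof.
have E (xi : 'I_n.+1 -> H) :
    \sum_i rnorm (\sum_j (\matrix_(i, j) if i == ord0 then x j else 0) i j (xi j)) ^+ 2 =
    rnorm (\sum_j x j (xi j)) ^+ 2.
  rewrite (bigD1 ord0)//= [X in _ + X]big1 ?addr0; last first.
    move=> i /negPf i0; rewrite big1 ?rnorm0 ?expr0n// => j _.
    by rewrite mxE i0.
  by congr (rnorm _ ^+ 2); apply: eq_bigr => j _; rewrite mxE.
by split=> le xi; have := le xi; rewrite E.
Qed.

Lemma opmx_leZ n (a : 'M[bop H H]_n) (B c : R) : 0 <= c ->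
  opmx_le a B -> opmx_le (map_mx ( *:%R c%:C) a) (c * B).
Proof.
move=> c0 le xi.
rewrite (eq_bigr (fun i => c ^+ 2 * rnorm (\sum_j a i j (xi j)) ^+ 2)).
  by rewrite -mulr_sumr exprMn -[leRHS]mulrA ler_wpM2l ?sqr_ge0//; exact: le.
move=> i _; rewrite -exprMn -{2}(ger0_norm c0) -rnormZ_real scaler_sumr.
by congr (rnorm _ ^+ 2); apply: eq_bigr => j _; rewrite mxE.
Qed.

End operator_matrices.

Section cb_maps.
Variable R : realType.

Lemma cbnorm_le (V W : mxNormedType R) (u : V -> W) K n (x : 'M[V]_n) :
  (cbnorm u <= K)%E -> (mxnorm x <= 1)%E -> (mxnorm (map_mx u x) <= K)%E.
Proof. by move=> uK x1; apply: le_trans uK; apply: ereal_sup_ubound; exists n, x. Qed.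

Variables (HE HG : hilbertType R) (E : opspace HE) (G : opspace HG).

Lemma unit_scale n (x : 'M[E]_n) B : 0 < B -> opmx_le (map_mx val x) B ->
  (mxnorm (map_mx ( *:%R (B^-1)%:C) x) <= 1)%E.
Proof.
move=> B0 le; apply/opmx_normP => //.
have B'0 : 0 <= B^-1 by rewrite invr_ge0 ltW.
have := opmx_leZ B'0 le; rewrite mulVf ?gt_eqF//.
suff -> : map_mx ( *:%R (B^-1)%:C) (map_mx val x) =
  map_mx (@opval _ _ E) (map_mx ( *:%R (B^-1)%:C) x) by [].
by apply/matrixP => i j; rewrite !mxE.
Qed.

Lemma cbnorm_opmx_le (u : {linear E -> G}) (K B : R) n (x : 'M[E]_n) :
  (cbnorm u <= K%:E)%E -> 0 <= K -> 0 < B ->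
  opmx_le (map_mx val x) B -> opmx_le (map_mx val (map_mx u x)) (K * B).
Proof.
move=> uK K0 B0 /(unit_scale B0)/(cbnorm_le uK)/(opmx_normP _ K0) le.
have := opmx_leZ (ltW B0) le; rewrite mulrC.
suff -> : map_mx ( *:%R B%:C) (map_mx (@opval _ _ G) (map_mx u (map_mx ( *:%R (B^-1)%:C) x))) =
  map_mx val (map_mx u x) by [].
apply/matrixP => i j; rewrite !mxE linearZ /=.
rewrite [X in _ *: X = _](_ : _ = (B^-1)%:C *: val (u (x i j)))// scalerA -rmorphM /= divff ?gt_eqF//.
by rewrite rmorph1 scale1r.
Qed.

Lemma cbnorm_ocol_le (u : {linear E -> G}) (K B : R) n (x : 'I_n -> E) :
  (cbnorm u <= K%:E)%E -> 0 <= K -> 0 < B ->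
  ocol_le (fun j => val (x j)) B -> ocol_le (fun j => val (u (x j))) (K * B).
Proof.
case: n x => [|n] x uK K0 B0.
  by move=> _ xi; rewrite big_ord0 mulr_ge0// sqr_ge0.
move=> /ocol_leP le; apply/ocol_leP.
pose X : 'M[E]_n.+1 := \matrix_(i, j) if j == ord0 then x i else 0.
have := @cbnorm_opmx_le u K B _ X uK K0 B0.
have -> : map_mx val X = \matrix_(i, j) if j == ord0 then val (x i) else 0.
  by apply/matrixP => i j; rewrite !mxE; case: ifP.
move=> /(_ le).
suff -> : map_mx val (map_mx u X) = \matrix_(i, j) if j == ord0 then val (u (x i)) else 0 by [].
by apply/matrixP => i j; rewrite !mxE; case: ifP => // _; rewrite linear0.
Qed.

Lemma cbnorm_orow_le (u : {linear E -> G}) (K B : R) n (x : 'I_n -> E) :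
  (cbnorm u <= K%:E)%E -> 0 <= K -> 0 < B ->
  orow_le (fun j => val (x j)) B -> orow_le (fun j => val (u (x j))) (K * B).
Proof.
case: n x => [|n] x uK K0 B0.
  by move=> _ xi; rewrite !big_ord0 rnorm0 expr0n mulr0.
move=> /orow_leP le; apply/orow_leP.
pose X : 'M[E]_n.+1 := \matrix_(i, j) if i == ord0 then x j else 0.
have := @cbnorm_opmx_le u K B _ X uK K0 B0.
have -> : map_mx val X = \matrix_(i, j) if i == ord0 then val (x j) else 0.
  by apply/matrixP => i j; rewrite !mxE; case: ifP.
move=> /(_ le).
suff -> : map_mx val (map_mx u X) = \matrix_(i, j) if i == ord0 then val (u (x j)) else 0 by [].
by apply/matrixP => i j; rewrite !mxE; case: ifP => // _; rewrite linear0.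
Qed.

End cb_maps.

(** Both the vector and the functional used to test the matrix of all
    [<u (X p q), Y i j>] are the unit vector [sum_p e_p (x) e_p / sqrt N]. *)
Lemma cbnorm_pairing_le (R : realType) (HE HF : hilbertType R) (E : opspace HE)
    (F : opspace HF) (u : {linear E -> odual F}) (K A B : R) N
    (X : 'M[E]_N) (Y : 'M[F]_N) :
  (cbnorm u <= K%:E)%E -> 0 <= K -> 0 < A -> 0 < B ->
  opmx_le (map_mx val X) A -> opmx_le (map_mx val Y) B ->
  rnorm (\sum_p \sum_r (u (X p r) : bop F R[i]^o) (Y p r)) <= K * A * B * N%:R.
Proof.
move=> uK K0 A0 B0 XA YB.
have [N0|Npos] := posnP N; first by move: X Y XA YB; rewrite N0 => X Y _ _; rewrite big_ord0 rnorm0 mulr0.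
have := cbnorm_le uK (unit_scale A0 XA).
move=> /cbnorm_le/(_ (unit_scale B0 YB)).
set M := map_mx _ _ => /= hM.
have N0 : 0 < N%:R :> R by rewrite ltr0n.
pose sN := Num.sqrt (N%:R : R); have sN0 : 0 < sN by rewrite sqrtr_gt0.
pose xi : 'M[R[i]]_(N, N) := (sN^-1)%:C%:M.
have ME i j p q : M i j p q = ((A * B)^-1)%:C * (u (X p q) : bop F R[i]^o) (Y i j).
  rewrite !mxE !linearZ /=.
  rewrite -[LHS]/((B^-1)%:C * ((A^-1)%:C * (u (X p q) : bop F R[i]^o) (Y i j))).
  by rewrite mulrA -rmorphM /= invfM mulrC [B^-1 * _]mulrC mulrC.
have : ((Num.sqrt (\sum_(i < N) \sum_(p < N)
      rnorm (\sum_(j < N) \sum_(q < N) M i j p q * xi j q : R[i]^o) ^+ 2))%:E <= K%:E)%E.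
  apply: le_trans hM; apply: ereal_sup_ubound; exists xi => //=.
  rewrite (eq_bigr (fun=> N%:R^-1)).
    by rewrite sumr_const card_ord -[_ *+ _]mulr_natr mulVf// gt_eqF.
  move=> j _; rewrite (bigD1 j)//= mxE eqxx mulr1n big1 ?addr0.
    rewrite rnorm_real ger0_norm ?invr_ge0 ?ltW// exprVn sqr_sqrtr//.
  by move=> q /negPf qj; rewrite mxE eq_sym qj mulr0n rnorm0 expr0n.
pose c i p : R[i]^o := ((A * B * sN)^-1)%:C * \sum_j (u (X p j) : bop F R[i]^o) (Y i j).
have cE i p : (\sum_(j < N) \sum_(q < N) M i j p q * xi j q : R[i]^o) = c i p.
  rewrite /c mulr_sumr; apply: eq_bigr => j _.
  rewrite (bigD1 j)//= [xi j j]mxE eqxx mulr1n big1 ?addr0.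
    by rewrite ME mulrAC -rmorphM /= -invfM.
  by move=> q /negPf qj; rewrite [xi j q]mxE eq_sym qj mulr0n mulr0.
rewrite (eq_bigr (fun i => \sum_p rnorm (c i p) ^+ 2)); last first.
  by move=> i _; apply: eq_bigr => p _; rewrite -cE.
rewrite lee_fin sqrt_leP//; last first.
  by apply: sumr_ge0 => i _; apply: sumr_ge0 => p _; exact: sqr_ge0.
move=> hc; have diag : \sum_i rnorm (c i i) ^+ 2 <= K ^+ 2.
  apply: le_trans hc; apply: ler_sum => i _.
  by rewrite [leRHS](bigD1 i)//= lerDl sumr_ge0// => p _; exact: sqr_ge0.
set T := \sum_p _.
have TE : ((A * B * sN)^-1)%:C *: (T : R[i]^o) = \sum_p c p p.
  by rewrite /T scaler_sumr.
have ABs : 0 < A * B * sN by rewrite !mulr_gt0.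
have le1 : rnorm (T : R[i]^o) / (A * B * sN) <= \sum_p rnorm (c p p).
  apply: le_trans (rnorm_sum _ _ _); rewrite -TE rnormZ_real mulrC.
  by rewrite ger0_norm// invr_ge0 ltW.
have le2 : (\sum_p rnorm (c p p)) ^+ 2 <= (sN * K) ^+ 2.
  have := sum_CauchySchwarz (fun p => rnorm (c p p)) (fun=> 1).
  under eq_bigr do rewrite mulr1; move/le_trans; apply.
  rewrite expr1n sumr_const card_ord mulrC exprMn sqr_sqrtr ?(ltW N0)//.
  by rewrite ler_wpM2l// ltW.
have sum0 : 0 <= \sum_p rnorm (c p p) by apply: sumr_ge0 => p _; exact: rnorm_ge0.
rewrite ler_pXn2r ?nnegrE ?mulr_ge0 ?(ltW sN0)// in le2.
have := le_trans le1 le2; rewrite ler_pdivrMr// => /le_trans; apply.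
rewrite -[N%:R](sqr_sqrtr (ltW N0)) -/sN expr2.
by rewrite le_eqVlt; apply/orP; left; apply/eqP; ring.
Qed.

(** * Truncation of operators on ell2 *)

Section truncation.
Variable R : realType.
Local Notation C := R[i].
Local Notation l2 := (ell2 R).
Implicit Types x y : l2.

Lemma trunc_subproof m x :
  (fun k => if (k < m)%N then x k else 0 : C^o) \in @square_summable R.
Proof.
apply: (@square_summableP _ _ (rnorm x ^+ 2)) => n.
apply: le_trans (ell2_rnorm_ge x n); apply: ler_sum => k _.
by case: ifP => // _; rewrite rnorm0 expr0n sqr_ge0.
Qed.

Definition trunc m x : l2 := Ell2 (trunc_subproof m x).

Lemma ell2E (a : C) x y k : (a *: x + y : l2) k = a * x k + y k.
Proof. by []. Qed.

Lemma ell2BE x y k : (x - y : l2) k = x k - y k.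
Proof. by []. Qed.

Lemma ell2_ext x y : (forall k, x k = y k) -> x = y.
Proof. by move=> xy; apply: val_inj; apply/funext. Qed.

Lemma tailE m x k : (x - trunc m x) k = if (k < m)%N then 0 else x k.
Proof. by rewrite ell2BE /=; case: ifP => _; rewrite ?subrr ?subr0. Qed.

Lemma rnorm_trunc_sqr m x : rnorm (trunc m x) ^+ 2 = \sum_(k < m) rnorm (x k) ^+ 2.
Proof.
apply/eqP; rewrite eq_le; apply/andP; split; last first.
  rewrite -(big_mkord xpredT (fun k => rnorm (x k) ^+ 2)).
  apply: le_trans (ell2_rnorm_ge (trunc m x) m).
  by rewrite !big_mkord le_eqVlt; apply/orP; left; apply/eqP; apply: eq_bigr => k _ /=; rewrite ltn_ord.
have S0 : 0 <= \sum_(k < m) rnorm (x k) ^+ 2 by apply: sumr_ge0 => k _; exact: sqr_ge0.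
rewrite -(sqr_sqrtr S0) ler_pXn2r ?nnegrE ?rnorm_ge0 ?sqrtr_ge0//.
apply: ell2_rnorm_le => [|n]; rewrite ?sqrtr_ge0// sqr_sqrtr//.
rewrite -(big_mkord xpredT (fun k => rnorm (x k) ^+ 2)).
have [mn|nm] := leqP m n.
  rewrite (big_cat_nat (leq0n _) mn)//= [X in _ + X]big1_seq ?addr0; last first.
    by move=> k; rewrite mem_index_iota => /andP[_ /andP[mk _]]; rewrite ltnNge mk rnorm0 expr0n.
  by apply: ler_sum_nat => k /andP[_ ->].
rewrite [leRHS](big_cat_nat (leq0n _) (ltnW nm))//= -[leLHS]addr0 lerD//.
  by apply: ler_sum_nat => k /andP[_ kn]; rewrite (ltn_trans kn).
by apply: sumr_ge0 => k _; exact: sqr_ge0.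
Qed.

Lemma rnorm_trunc_tail m x : rnorm (x - trunc m x) ^+ 2 =
  rnorm x ^+ 2 - \sum_(k < m) rnorm (x k) ^+ 2.
Proof.
apply/eqP; rewrite eq_le; apply/andP; split.
  have S0 : 0 <= rnorm x ^+ 2 - \sum_(k < m) rnorm (x k) ^+ 2.
    by rewrite subr_ge0 -(big_mkord xpredT (fun k => rnorm (x k) ^+ 2)) ell2_rnorm_ge.
  rewrite -(sqr_sqrtr S0) ler_pXn2r ?nnegrE ?rnorm_ge0 ?sqrtr_ge0//.
  apply: ell2_rnorm_le => [|n]; rewrite ?sqrtr_ge0// sqr_sqrtr//.
  rewrite lerBrDr; apply: le_trans (ell2_rnorm_ge x (maxn m n)).
  rewrite -(big_mkord xpredT (fun k => rnorm (x k) ^+ 2)).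
  rewrite [leRHS](big_cat_nat (leq0n _) (leq_maxl m n))// [leLHS]addrC lerD2l.
  have -> : \sum_(m <= k < maxn m n) rnorm (x k) ^+ 2 =
      \sum_(m <= k < maxn m n) rnorm ((x - trunc m x) k) ^+ 2.
    by apply: eq_big_nat => k /andP[mk _]; rewrite tailE ltnNge mk.
  have [mn|nm] := leqP m n.
    rewrite (big_cat_nat (leq0n _) mn) // [X in X + _ <= _]big1_seq ?add0r.
      exact: lexx.
    by move=> k; rewrite mem_index_iota => /andP[_ /andP[_ km]]; rewrite tailE km rnorm0 expr0n.
  rewrite big1_seq ?sumr_ge0//.
    by move=> k _; exact: sqr_ge0.
  move=> k; rewrite mem_index_iota => /andP[_ /andP[_ kn]].
  by rewrite tailE (ltn_trans kn nm) rnorm0 expr0n.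
rewrite lerBlDr [leLHS]ell2_rnorm_sqr; apply: limr_le; first exact: ell2_sqr_cvg.
near=> n; have mn : (m <= n)%N by near: n; exact: nbhs_infty_ge.
rewrite /series /= (big_cat_nat (leq0n _) mn)// [leLHS]addrC big_mkord lerD2r.
have -> : \sum_(m <= k < n) rnorm (x k) ^+ 2 =
    \sum_(m <= k < n) rnorm ((x - trunc m x) k) ^+ 2.
  by apply: eq_big_nat => k /andP[mk _]; rewrite tailE ltnNge mk.
apply: le_trans (ell2_rnorm_ge (x - trunc m x) n).
by rewrite [leRHS](big_cat_nat (leq0n _) mn)// lerDr sumr_ge0// => k _; exact: sqr_ge0.
Unshelve. all: by end_near. Qed.

Lemma rnorm_trunc_split m x :
  rnorm x ^+ 2 = rnorm (trunc m x) ^+ 2 + rnorm (x - trunc m x) ^+ 2.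
Proof. by rewrite rnorm_trunc_tail rnorm_trunc_sqr addrC subrK. Qed.

Lemma rnorm_trunc_le m x : rnorm (trunc m x) <= rnorm x.
Proof.
rewrite -(@ler_pXn2r _ 2) ?nnegrE ?rnorm_ge0// rnorm_trunc_sqr.
by rewrite -(big_mkord xpredT (fun k => rnorm (x k) ^+ 2)) ell2_rnorm_ge.
Qed.

Lemma rnorm_tail_le m x : rnorm (x - trunc m x) <= rnorm x.
Proof.
rewrite -(@ler_pXn2r _ 2) ?nnegrE ?rnorm_ge0// rnorm_trunc_tail.
by rewrite lerBlDr lerDl sumr_ge0// => k _; exact: sqr_ge0.
Qed.

Lemma truncZ m (a : C) x : trunc m (a *: x) = a *: trunc m x.
Proof.
apply: ell2_ext => k; rewrite -[RHS]/(a * trunc m x k) -[LHS]/(if (k < m)%N then a * x k else 0).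
by rewrite /=; case: ltnP => // _; rewrite mulr0.
Qed.

Lemma tail_cvg0 x (e : R) : 0 < e -> \forall m \near \oo, rnorm (x - trunc m x) <= e.
Proof.
move=> e0; have /cvgrPdist_le/(_ _ (exprn_gt0 2 e0)) := @ell2_sqr_cvg _ x.
rewrite -ell2_rnorm_sqr; apply: filterS => m; rewrite /series /= big_mkord => le.
rewrite -(@ler_pXn2r _ 2) ?nnegrE ?rnorm_ge0 ?(ltW e0)// rnorm_trunc_tail.
exact: le_trans (ler_norm _) le.
Qed.

Lemma delta_subproof k : (fun i => (i == k)%:R : C^o) \in @square_summable R.
Proof.
apply: (@square_summableP _ _ 1) => n.
have [kn|nk] := ltnP k n; last first.
  rewrite big1_seq// => i; rewrite mem_index_iota => /andP[_ /andP[_ ik]].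
  by rewrite ltn_eqF ?(leq_trans ik) ?rnorm0 ?expr0n.
rewrite big_mkord (bigD1 (Ordinal kn))//= eqxx big1 ?addr0.
  by rewrite -[1%:R]/(1%:C) rnorm_real normr1 expr1n.
by move=> i; rewrite -val_eqE /= => /negPf ->; rewrite rnorm0 expr0n.
Qed.

Definition ell2_delta k : l2 := Ell2 (delta_subproof k).

Lemma trunc_sum m x : trunc m x = \sum_(k < m) x k *: ell2_delta k.
Proof.
apply: ell2_ext => i.
have -> : (\sum_(k < m) x k *: ell2_delta k : l2) i = \sum_(k < m) x k * (i == k)%:R.
  have h (r : seq 'I_m) : (\sum_(k <- r) x k *: ell2_delta k : l2) i =
      \sum_(k <- r) x k * (i == k)%:R.
    elim: r => [|k r IH]; first by rewrite !big_nil.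
    by rewrite !big_cons ell2E IH.
  exact: h.
rewrite /=; case: ltnP => im; last first.
  by rewrite big1// => k _; rewrite gtn_eqF ?mulr0// (leq_trans _ im).
rewrite (bigD1 (Ordinal im))//= eqxx mulr1 big1 ?addr0// => k.
by rewrite -val_eqE /= eq_sym => /negPf ->; rewrite mulr0.
Qed.

(** The values of [f] on the basis are square summable, as one sees by evaluating [f]
    at their conjugates, and a square summable sequence has small tails. *)
Lemma functional_tail (f : l2 -> C^o) (M e : R) : linear f ->
  (forall x, rnorm (f x) <= M * rnorm x) -> 0 < e ->
  \forall m \near \oo, forall x, rnorm (f (x - trunc m x)) <= e * rnorm x.
Proof.
move=> flin fM e0.
pose F : {linear l2 -> C^o} := HB.pack f (GRing.isLinear.Build _ _ _ _ f flin).
have fE m x : f (trunc m x) = \sum_(k < m) x k * f (ell2_delta k).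
  rewrite -[f]/(F : _ -> _) trunc_sum linear_sum; apply: eq_bigr => k _.
  by rewrite linearZ.
pose a : nat -> C^o := fun k => Num.conj (f (ell2_delta k)).
have sum_le n : \sum_(0 <= k < n) rnorm (a k) ^+ 2 <= M ^+ 2.
  rewrite big_mkord; set s := \sum_(k < n) _.
  have s0 : 0 <= s by apply: sumr_ge0 => k _; exact: sqr_ge0.
  have asq : (fun k => if (k < n)%N then a k else 0 : C^o) \in @square_summable R.
    apply: (@square_summableP _ _ s) => p.
    have [np|pn] := leqP n p.
      rewrite (big_cat_nat (leq0n _) np)//= [X in _ + X]big1_seq ?addr0.
        rewrite big_mkord /s le_eqVlt; apply/orP; left; apply/eqP.
        by apply: eq_bigr => k _; rewrite ltn_ord.
      move=> k; rewrite mem_index_iota => /andP[_ /andP[nk _]].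
      by rewrite ltnNge nk rnorm0 expr0n.
    rewrite /s -(big_mkord xpredT (fun k => rnorm (a k) ^+ 2)) (big_cat_nat (leq0n _) (ltnW pn))//=.
    rewrite -[leLHS]addr0 lerD ?sumr_ge0//; last by move=> k _; exact: sqr_ge0.
    by apply: ler_sum_nat => k /andP[_ kp]; rewrite (ltn_trans kp).
  pose y := Ell2 asq; have ty : trunc n y = y.
    by apply: ell2_ext => k; rewrite /y /=; case: ltnP => _.
  have ny : rnorm y ^+ 2 = s.
    by rewrite -{1}ty rnorm_trunc_sqr; apply: eq_bigr => k _; rewrite /y /= ltn_ord.
  have fy : f y = s%:C.
    rewrite -{1}ty fE /s rmorph_sum; apply: eq_bigr => k _ /=.
    by rewrite ltn_ord rmorphXn /= rnormE normCK /a conjCK.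
  have := fM y; rewrite fy rnorm_real ger0_norm// => le.
  have [->|s1] := eqVneq s 0; first exact: sqr_ge0.
  have spos : 0 < s by rewrite lt_def s1.
  rewrite -(ler_pM2r spos) -{3}ny -exprMn -expr2.
  by rewrite ler_pXn2r ?nnegrE// (le_trans s0).
have asq : a \in @square_summable R by apply: square_summableP sum_le.
have := tail_cvg0 (Ell2 asq) e0; apply: filterS => m mle x.
set y := x - trunc m x.
have fyn n : rnorm (f (trunc n y)) <= e * rnorm x.
  rewrite fE -(@ler_pXn2r _ 2) ?nnegrE ?rnorm_ge0 ?mulr_ge0 ?(ltW e0) ?rnorm_ge0// exprMn.
  have h1 : rnorm (\sum_(k < n) y k * f (ell2_delta k) : C^o) <=
      \sum_(k < n) rnorm (y k) * rnorm ((Ell2 asq - trunc m (Ell2 asq)) k).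
    apply: le_trans (rnorm_sum _ _ _) _; apply: ler_sum => k _.
    rewrite rnormM; have [km|mk] := ltnP k m.
      by rewrite /y !tailE km rnorm0 mul0r mulr_ge0// rnorm_ge0.
    by rewrite !tailE ltnNge mk /= /a rnorm_conj.
  apply: le_trans (_ : (\sum_(k < n) rnorm (y k) *
      rnorm ((Ell2 asq - trunc m (Ell2 asq)) k)) ^+ 2 <= _).
    by rewrite ler_pXn2r ?nnegrE ?rnorm_ge0 ?sumr_ge0// => k _; rewrite mulr_ge0 ?rnorm_ge0.
  apply: le_trans (sum_CauchySchwarz _ _) _; rewrite mulrC.
  rewrite -(big_mkord xpredT (fun k => rnorm (y k) ^+ 2)).
  rewrite -(big_mkord xpredT (fun k => rnorm ((Ell2 asq - trunc m (Ell2 asq)) k) ^+ 2)).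
  apply: ler_pM; rewrite ?sumr_ge0//; try by move=> *; exact: sqr_ge0.
    apply: le_trans (ell2_rnorm_ge _ _) _.
    by rewrite ler_pXn2r ?nnegrE ?rnorm_ge0 ?(ltW e0).
  apply: le_trans (ell2_rnorm_ge _ _) _.
  by rewrite ler_pXn2r ?nnegrE ?rnorm_ge0// rnorm_tail_le.
have M0 : 0 <= `|M| by [].
apply/ler_addgt0Pr => d d0.
have pos : 0 < d / (`|M| + 1) by rewrite divr_gt0// ltr_wpDl.
have [n nle] := filter_ex (tail_cvg0 y pos).
rewrite -[y](subrK (trunc n y)) addrC -[f]/(F : _ -> _) linearD /=.
apply: le_trans (rnormD _ _) _; apply: lerD => //.
apply: le_trans (fM _) _; apply: (@le_trans _ _ (`|M| * (d / (`|M| + 1)))).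
  by apply: (@le_trans _ _ (`|M| * rnorm (y - trunc n y)));
    [rewrite ler_wpM2r ?rnorm_ge0// ler_norm|rewrite ler_wpM2l].
by rewrite mulrA ler_pdivrMr ?ltr_wpDl// mulrC ler_wpM2l ?(ltW d0)// lerDl.
Qed.

(** The tails of a fixed vector tend to 0 and are 1-Lipschitz functions of it, so that
    the convergence is uniform on compact sets. *)
Lemma compact_tail (T : bop l2 l2) (e : R) : compact_op T -> 0 < e ->
  \forall m \near \oo, forall x, rnorm (T x - trunc m (T x)) <= e * rnorm x.
Proof.
rewrite /compact_op /= precompactE => /compact_near_coveringP cT e0.
have e2 : 0 < e / 2 by rewrite divr_gt0.
have : \forall m \near \oo, forall y, closure (T @` [set x | rnorm x <= 1]) y ->
    rnorm (y - trunc m y) <= e.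
  apply: (cT nat \oo (fun m y => rnorm (y - trunc m y) <= e)) => y _.
  have [M _ MP] := tail_cvg0 y e2.
  exists ([set z | rnorm (y - z) < e / 2], [set m | (M <= m)%N]) => /=.
    split; last by exists M.
    have ec : 0 < (e / 2)%:C :> C by rewrite ltcR.
    apply: filterS (nbhsx_ballx y _ ec) => z; rewrite -ball_normE /=.
    by rewrite -rnormE ltcR.
  move=> [z m] /= [yz Mm].
  have -> : z - trunc m z = ((z - y) - trunc m (z - y)) + (y - trunc m y).
    have h : trunc m (z - y) = trunc m z - trunc m y.
      by apply: ell2_ext => k; rewrite ell2BE /=; case: ifP => //; rewrite subrr.
    by rewrite h opprB addrACA subrK [trunc m y - _ - _]addrAC subrr sub0r.
  apply: le_trans (rnormD _ _) _; rewrite [e]splitr lerD//; last exact: MP.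
  by apply: le_trans (rnorm_tail_le _ _) _; rewrite rnormB ltW.
apply: filterS => m mP x.
have [x0|x0] := eqVneq (rnorm x) 0.
  by rewrite (rnorm0_eq0 x0) linear0 (_ : trunc m 0 = 0) ?subrr ?rnorm0 ?mulr0//;
    apply: ell2_ext => k /=; case: ltnP.
have xpos : 0 < rnorm x by rewrite lt_def x0 rnorm_ge0.
have /mP : closure (T @` [set x | rnorm x <= 1]) (T ((rnorm x)^-1%:C *: x)).
  apply: subset_closure; eexists; last reflexivity.
  by rewrite /= rnormZ_real ger0_norm ?invr_ge0 ?rnorm_ge0// mulVf.
rewrite linearZ truncZ -scalerBr rnormZ_real ger0_norm ?invr_ge0 ?rnorm_ge0//.
by rewrite mulrC ler_pdivrMr.
Qed.

(** Compactness truncates the range; then only finitely many coordinate functionals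
    of the [T j] remain, and their tails truncate the domain. *)
Lemma compact_ops_truncation n (T : 'I_n -> bop l2 l2) (e : R) :
  (forall j, compact_op (T j)) -> 0 < e -> exists m1 m2, forall j x,
  rnorm (T j x - trunc m1 (T j (trunc m2 x))) <= e * rnorm x.
Proof.
move=> cT e0; have e2 : 0 < e / 2 by rewrite divr_gt0.
have [m1 m1P] := filter_ex (@filter_forall nat 'I_n
  (fun j m => forall x, rnorm (T j x - trunc m (T j x)) <= e / 2 * rnorm x) \oo _
  (fun j => compact_tail (cT j) e2)).
have [d d0 dE] : exists2 d : R, 0 < d & d = e / 2 / (m1%:R + 1).
  by eexists; last reflexivity; rewrite divr_gt0// ltr_wpDl.
have dP j (p : 'I_m1) : \forall m \near \oo, forall x,
    rnorm (T j (x - trunc m x) p : C^o) <= d * rnorm x.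
  apply: (@functional_tail (fun x => T j x p) (opnorm (T j))) => //.
    by move=> a x y; rewrite linearP.
  by move=> x; apply: le_trans (ell2_coord_le _ _) _; exact: opnormP.
have [m2 m2P] := filter_ex (@filter_forall nat 'I_n
  (fun j m => forall (p : 'I_m1) x, rnorm (T j (x - trunc m x) p : C^o) <= d * rnorm x)
  \oo _ (fun j => @filter_forall nat 'I_m1 _ \oo _ (dP j))).
exists m1, m2 => j x.
have -> : T j x - trunc m1 (T j (trunc m2 x)) =
    (T j x - trunc m1 (T j x)) + trunc m1 (T j (x - trunc m2 x)).
  rewrite linearB; set u := T j (trunc m2 x); set v := T j x; apply: ell2_ext => k.
  rewrite -[LHS]/(v k - (if (k < m1)%N then u k else 0)).
  rewrite -[RHS]/(v k - (if (k < m1)%N then v k else 0) +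
    (if (k < m1)%N then v k - u k else 0)).
  by case: ltnP => _; rewrite ?addr0// subrr add0r.
apply: le_trans (rnormD _ _) _; rewrite [X in X * rnorm x]splitr mulrDl lerD//.
rewrite -(@ler_pXn2r _ 2) ?nnegrE ?rnorm_ge0 ?mulr_ge0 ?(ltW e0) ?rnorm_ge0//.
rewrite rnorm_trunc_sqr.
apply: (@le_trans _ _ (\sum_(p < m1) (d * rnorm x) ^+ 2)).
  apply: ler_sum => p _.
  rewrite ler_pXn2r ?nnegrE ?rnorm_ge0 ?mulr_ge0 ?(ltW d0) ?rnorm_ge0//.
rewrite dE sumr_const card_ord -[_ *+ m1]mulr_natr.
have m0 : 0 < m1%:R + 1 :> R by rewrite ltr_wpDl.
have -> : (e / 2 / (m1%:R + 1) * rnorm x) ^+ 2 * m1%:R =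
    (e / 2 * rnorm x) ^+ 2 * (m1%:R / (m1%:R + 1) ^+ 2).
  by field; rewrite gt_eqF.
rewrite ler_piMr ?sqr_ge0// ler_pdivrMr ?exprn_gt0// mul1r.
by have := sqr_ge0 (m1%:R : R); have : 0 <= m1%:R :> R by []; lra.
Qed.

End truncation.

(** * Tensor products with compact operators *)

Lemma sum_Minkowski (R : realType) (I : finType) (a b : I -> R) (A B : R) :
  0 <= A -> 0 <= B -> \sum_i a i ^+ 2 <= A ^+ 2 -> \sum_i b i ^+ 2 <= B ^+ 2 ->
  \sum_i (a i + b i) ^+ 2 <= (A + B) ^+ 2.
Proof.
move=> A0 B0 hA hB.
have -> : \sum_i (a i + b i) ^+ 2 =
    \sum_i a i ^+ 2 + 2 * (\sum_i a i * b i) + \sum_i b i ^+ 2.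
  rewrite (eq_bigr (fun i => a i ^+ 2 + 2 * (a i * b i) + b i ^+ 2)).
    by rewrite !big_split mulr_sumr.
  by move=> i _; ring.
have cs : \sum_i a i * b i <= A * B.
  apply: le_trans (ler_norm _) _.
  rewrite -(@ler_pXn2r _ 2) ?nnegrE ?mulr_ge0// real_normK ?num_real//.
  apply: le_trans (sum_CauchySchwarz _ _) _; rewrite exprMn.
  by apply: ler_pM => //; apply: sumr_ge0 => i _; exact: sqr_ge0.
lra.
Qed.

Section realification.
Variable R : realType.
Local Notation C := R[i].
Local Notation l2 := (ell2 R).

(** The matrices [a_j] being real, complex coefficients can be replaced by real ones
    of twice the size: [reim] is the matrix of the real and imaginary parts of the
    first [m] coordinates, and [reop] the corresponding matrix of an operator. *)
Definition reim m N (x : 'I_N -> l2) : 'M[R]_(m + m, N) :=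
  col_mx (\matrix_(k, p) complex.Re (x p k)) (\matrix_(k, p) complex.Im (x p k)).

Definition reop m1 m2 (T : bop l2 l2) : 'M[R]_(m1 + m1, m2 + m2) :=
  let A := \matrix_(k < m1, l < m2) complex.Re (T (ell2_delta R l) k) in
  let B := \matrix_(k < m1, l < m2) complex.Im (T (ell2_delta R l) k) in
  block_mx A (- B) B A.

Lemma nsq_reim m N (x : 'I_N -> l2) :
  nsq (reim m x) = \sum_p rnorm (trunc m (x p)) ^+ 2.
Proof.
rewrite nsqE2; apply: eq_bigr => p _.
rewrite rnorm_trunc_sqr big_split_ord /= -big_split /=; apply: eq_bigr => k _.
by rewrite col_mxEu col_mxEd !mxE rnorm_sqr.
Qed.

Lemma nsq_reim_le m N (x : 'I_N -> l2) : nsq (reim m x) <= \sum_p rnorm (x p) ^+ 2.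
Proof.
rewrite nsq_reim; apply: ler_sum => p _.
by rewrite ler_pXn2r ?nnegrE ?rnorm_ge0// rnorm_trunc_le.
Qed.

Lemma ell2_sumE (I : Type) (r : seq I) (x : I -> l2) k :
  (\sum_(j <- r) x j : l2) k = \sum_(j <- r) x j k.
Proof.
elim: r => [|j r IH]; first by rewrite !big_nil.
by rewrite !big_cons -IH.
Qed.

Lemma Re_sum (I : Type) (r : seq I) (z : I -> C) :
  complex.Re (\sum_(j <- r) z j) = \sum_(j <- r) complex.Re (z j).
Proof. by elim: r => [|j r IH]; rewrite ?big_nil// !big_cons -IH; case: (z j) (\sum_(_ <- _) _) => ? ? []. Qed.

Lemma Im_sum (I : Type) (r : seq I) (z : I -> C) :
  complex.Im (\sum_(j <- r) z j) = \sum_(j <- r) complex.Im (z j).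
Proof. by elim: r => [|j r IH]; rewrite ?big_nil// !big_cons -IH; case: (z j) (\sum_(_ <- _) _) => ? ? []. Qed.

Lemma reim_sum m N (I : Type) (r : seq I) (x : I -> 'I_N -> l2) :
  reim m (fun p => \sum_(j <- r) x j p) = \sum_(j <- r) reim m (x j).
Proof.
apply/matrixP => i p; rewrite summxE; case: (split_ordP i) => k ->.
  rewrite col_mxEu mxE ell2_sumE Re_sum; apply: eq_bigr => j _.
  by rewrite col_mxEu mxE.
rewrite col_mxEd mxE ell2_sumE Im_sum; apply: eq_bigr => j _.
by rewrite col_mxEd mxE.
Qed.

Lemma reim_mul m N P (x : 'I_N -> l2) (q : 'M[R]_(N, P)) :
  reim m x *m q = reim m (fun p => \sum_r (q r p)%:C *: x r).
Proof.
rewrite /reim mul_col_mx; congr col_mx; apply/matrixP => k p; rewrite !mxE ell2_sumE.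
  rewrite Re_sum; apply: eq_bigr => r _; rewrite mxE -[(_ *: x r) k]/(_ * x r k).
  by case: (x r k) => u v /=; ring.
rewrite Im_sum; apply: eq_bigr => r _; rewrite mxE -[(_ *: x r) k]/(_ * x r k).
by case: (x r k) => u v /=; ring.
Qed.

Lemma reop_mul m1 m2 N (T : bop l2 l2) (x : 'I_N -> l2) :
  reop m1 m2 T *m reim m2 x = reim m1 (fun p => T (trunc m2 (x p))).
Proof.
have E p k : T (trunc m2 (x p)) k = \sum_(l < m2) x p l * T (ell2_delta R l) k.
  by rewrite trunc_sum linear_sum ell2_sumE; apply: eq_bigr => l _; rewrite linearZ.
rewrite /reop /reim mul_block_col; congr col_mx; apply/matrixP => k p; rewrite !mxE E.
  rewrite Re_sum -big_split /=; apply: eq_bigr => l _; rewrite !mxE.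
  by case: (x p l) (T _ _) => u v [u' v'] /=; ring.
rewrite Im_sum -big_split /=; apply: eq_bigr => l _; rewrite !mxE.
by case: (x p l) (T _ _) => u v [u' v'] /=; ring.
Qed.

Lemma reim_surj m (v : 'cV[R]_(m + m)) : exists2 x : l2,
  trunc m x = x & reim m (fun _ : 'I_1 => x) = v.
Proof.
pose a (k : nat) : C^o := if insub k is Some l
  then v (lshift m l) 0 +i* v (rshift m l) 0 else 0.
have aE (l : 'I_m) : a l = v (lshift m l) 0 +i* v (rshift m l) 0 by rewrite /a valK.
have a0 k : (m <= k)%N -> a k = 0 by move=> mk; rewrite /a insubF// ltnNge mk.
have asq : a \in @square_summable R.
  apply: (@square_summableP _ _ (\sum_(0 <= k < m) rnorm (a k) ^+ 2)) => n.
  have S k l : 0 <= \sum_(k <= i < l) rnorm (a i) ^+ 2.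
    by apply: sumr_ge0 => i _; exact: sqr_ge0.
  have [nm|mn] := leqP n m.
    by rewrite [leRHS](big_cat_nat (leq0n _) nm) //= lerDl.
  rewrite (big_cat_nat (leq0n _) (ltnW mn)) //= [X in _ + X]big1_seq ?addr0// => k.
  by rewrite mem_index_iota => /andP[_ /andP[mk _]]; rewrite a0// rnorm0 expr0n.
exists (Ell2 asq).
  by apply: ell2_ext => k /=; case: ltnP => // mk; rewrite a0.
apply/colP => i; case: (split_ordP i) => k ->.
  by rewrite col_mxEu mxE /= aE.
by rewrite col_mxEd mxE /= aE.
Qed.

Lemma reop_col_bound n m1 m2 (T : 'I_n -> bop l2 l2) (c : R) :
  ocol_le T c -> col_bound (fun j => reop m1 m2 (T j)) c.
Proof.
move=> Tc v; have [x tx <-] := reim_surj v.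
rewrite nsq_reim big_ord1 tx; apply: le_trans (Tc x).
apply: ler_sum => j _; rewrite reop_mul tx; apply: le_trans (nsq_reim_le _ _) _.
by rewrite big_ord1.
Qed.

Lemma reop_row_bound n m1 m2 (T : 'I_n -> bop l2 l2) (c : R) :
  orow_le T c -> row_bound (fun j => reop m1 m2 (T j)) c.
Proof.
move=> Tc v; have /choice[x xP] j : exists x : l2,
    trunc m2 x = x /\ reim m2 (fun _ : 'I_1 => x) = v j.
  by have [x tx xv] := reim_surj (v j); exists x.
rewrite (eq_bigr (fun j => reim m1 (fun _ : 'I_1 => T j (x j)))); last first.
  by move=> j _; have [tx <-] := xP j; rewrite reop_mul tx.
rewrite -reim_sum; apply: le_trans (nsq_reim_le _ _) _; rewrite big_ord1.
apply: le_trans (Tc x) _; rewrite ler_wpM2l ?sqr_ge0//; apply: ler_sum => j _.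
by have [tx <-] := xP j; rewrite nsq_reim big_ord1 tx.
Qed.

Lemma contraction_ell2 N (q : 'M[R]_N) (x : 'I_N -> l2) :
  (forall w : 'rV_N, nsq (w *m q) <= nsq w) ->
  \sum_p rnorm (\sum_r (q r p)%:C *: x r) ^+ 2 <= \sum_r rnorm (x r) ^+ 2.
Proof.
move=> qc; set y := fun p => \sum_r (q r p)%:C *: x r.
apply/ler_addgt0Pr => e e0; pose d := Num.sqrt (e / (N%:R + 1)).
have N0 : 0 < N%:R + 1 :> R by rewrite ltr_wpDl.
have d0 : 0 < d by rewrite sqrtr_gt0 divr_gt0.
have [m mP] := filter_ex (@filter_forall nat 'I_N
  (fun p m => rnorm (y p - trunc m (y p)) <= d) \oo _ (fun p => tail_cvg0 (y p) d0)).
rewrite (eq_bigr (fun p => rnorm (trunc m (y p)) ^+ 2 + rnorm (y p - trunc m (y p)) ^+ 2)).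
  rewrite big_split /=; apply: lerD.
    rewrite -nsq_reim -reim_mul; apply: le_trans (nsq_reim_le m x).
    by rewrite nsq_row [leRHS]nsq_row; apply: ler_sum => i _; rewrite row_mul.
  apply: (@le_trans _ _ (\sum_(p < N) d ^+ 2)).
    by apply: ler_sum => p _; rewrite ler_pXn2r ?nnegrE ?rnorm_ge0 ?(ltW d0).
  rewrite sumr_const card_ord -[_ *+ N]mulr_natr sqr_sqrtr ?divr_ge0 ?(ltW e0) ?(ltW N0)//.
  by rewrite mulrAC ler_pdivrMr// ler_wpM2l ?(ltW e0)// lerDl.
by move=> p _; exact: rnorm_trunc_split.
Qed.

(** The truncation error is multiplied by [q], whose norm is at most 1 whatever the
    size of the truncation: it stays small although [q] depends on the
    truncation. *)
Theorem compact_free_like n (T : 'I_n -> bop l2 l2) (c e : R) :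
  (forall j, compact_op (T j)) -> 0 < c -> 0 < e -> ocol_le T c -> orow_le T c ->
  exists L0, forall L, (L0 <= L)%N -> exists q : 'M[R]_(nperm n L),
    nsq (1%:M - q) <= e * (nperm n L)%:R /\
    opmx_le (\matrix_(p, r) \sum_j (q r (act j p))%:C *: T j) (2 * c * (1 + e)).
Proof.
move=> cT c0 e0 Tcol Trow.
have n0 : 0 < n%:R + 1 :> R by rewrite ltr_wpDl.
have [d d0 dn] : exists2 d : R, 0 < d & d * n%:R <= c * e.
  exists (c * e / (n%:R + 1)); first by rewrite divr_gt0// mulr_gt0.
  rewrite mulrAC ler_pdivrMr// ler_wpM2l ?mulr_ge0 ?(ltW c0) ?(ltW e0)//.
  by rewrite lerDl.
have [m1 [m2 TP]] := compact_ops_truncation cT d0.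
have e2 : 0 < e / 2 by rewrite divr_gt0.
have [L0 L0P] := free_like_norm_le c0 e2 (@reop_col_bound _ m1 m2 _ _ Tcol)
  (@reop_row_bound _ m1 m2 _ _ Trow).
exists L0 => L /L0P[q [qc q1 qX]]; set N := nperm n L in q qc q1 qX *.
exists q; split.
  by apply: le_trans q1 _; apply: ler_wpM2r => //; lra.
move=> xi; set S := \sum_j rnorm (xi j) ^+ 2.
have S0 : 0 <= S by apply: sumr_ge0 => j _; exact: sqr_ge0.
pose y (p : 'I_N) : l2 := \sum_r (q r p)%:C *: xi r.
have yS : \sum_p rnorm (y p) ^+ 2 <= S by exact: contraction_ell2.
pose main (p : 'I_N) : l2 := \sum_j trunc m1 (T j (trunc m2 (y (act j p)))).
pose err (p : 'I_N) : R := \sum_j d * rnorm (y (act j p)).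
have outE p : \sum_r (\matrix_(p, r) \sum_j (q r (act j p))%:C *: T j) p r (xi r) =
    \sum_j T j (y (act j p)).
  transitivity (\sum_r \sum_j (q r (act j p))%:C *: T j (xi r)).
    apply: eq_bigr => r _; rewrite mxE.
    have h (s : seq 'I_n) : (\sum_(j <- s) (q r (act j p))%:C *: T j : bop l2 l2) (xi r) =
        \sum_(j <- s) (q r (act j p))%:C *: T j (xi r).
      by elim: s => [|j s IH]; rewrite ?big_nil// !big_cons -IH.
    exact: h.
  rewrite exchange_big /=; apply: eq_bigr => j _.
  by rewrite /y linear_sum; apply: eq_bigr => r _; rewrite linearZ.
have out_le p : rnorm (\sum_j T j (y (act j p))) <= rnorm (main p) + err p.
  have -> : \sum_j T j (y (act j p)) = main p +
      \sum_j (T j (y (act j p)) - trunc m1 (T j (trunc m2 (y (act j p))))).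
    by rewrite /main -big_split /=; apply: eq_bigr => j _; rewrite addrC subrK.
  apply: le_trans (rnormD _ _) _; rewrite lerD2l; apply: le_trans (rnorm_sum _ _ _) _.
  by apply: ler_sum => j _; exact: TP.
have mainS : \sum_p rnorm (main p) ^+ 2 <= (2 * c * (1 + e / 2) * Num.sqrt S) ^+ 2.
  rewrite exprMn sqr_sqrtr//.
  apply: le_trans (_ : _ <= (2 * c * (1 + e / 2)) ^+ 2 * nsq (reim m2 xi)) _; last first.
    by rewrite ler_wpM2l ?sqr_ge0// nsq_reim_le.
  apply: le_trans (qX _); rewrite reim_mul -/y.
  rewrite (_ : psum _ _ _ = reim m1 main).
    rewrite nsq_reim; apply: ler_sum => p _.
    suff -> : trunc m1 (main p) = main p by [].
    by apply: ell2_ext => k; rewrite /= /main ell2_sumE; case: ltnP => // mk;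
      rewrite big1// => j _ /=; rewrite ltnNge mk.
  rewrite /main reim_sum /psum; apply: eq_bigr => j _; rewrite reop_mul.
  apply/matrixP => a p; rewrite mulmx_sg; case: (split_ordP a) => k ->.
    by rewrite !col_mxEu !mxE /= ltn_ord.
  by rewrite !col_mxEd !mxE /= ltn_ord.
have errS : \sum_p err p ^+ 2 <= (c * e * Num.sqrt S) ^+ 2.
  rewrite exprMn sqr_sqrtr//.
  have h p : err p ^+ 2 <= d ^+ 2 * n%:R * \sum_j rnorm (y (act j p)) ^+ 2.
    have := sum_CauchySchwarz (fun=> d) (fun j => rnorm (y (act j p))).
    by rewrite sumr_const card_ord mulr_natr.
  apply: le_trans (ler_sum _ (fun p _ => h p)) _; rewrite -mulr_sumr exchange_big /=.
  rewrite (eq_bigr (fun=> \sum_p rnorm (y p) ^+ 2)); last first.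
    by move=> j _; rewrite [RHS](reindex_inj (inv_inj (@actK n L j))).
  rewrite sumr_const card_ord; set A := \sum_p _ in yS *.
  rewrite -[A *+ n]mulr_natr.
  have -> : d ^+ 2 * n%:R * (A * n%:R) = (d * n%:R) ^+ 2 * A by ring.
  apply: ler_pM => //; first exact: sqr_ge0.
    by apply: sumr_ge0 => p _; exact: sqr_ge0.
  by rewrite ler_pXn2r ?nnegrE ?mulr_ge0 ?(ltW c0) ?(ltW e0) ?(ltW d0).
rewrite (eq_bigr (fun p => rnorm (\sum_j T j (y (act j p))) ^+ 2)); last first.
  by move=> p _; rewrite outE.
apply: (@le_trans _ _ (\sum_p (rnorm (main p) + err p) ^+ 2)).
  apply: ler_sum => p _; rewrite ler_pXn2r ?nnegrE ?rnorm_ge0 ?out_le//.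
  by apply: le_trans (out_le p); exact: rnorm_ge0.
apply: le_trans (sum_Minkowski _ _ mainS errS) _.
- by rewrite !mulr_ge0 ?sqrtr_ge0 ?(ltW c0)// addr_ge0// ltW.
- by rewrite !mulr_ge0 ?sqrtr_ge0 ?(ltW c0) ?(ltW e0).
rewrite -{3}(sqr_sqrtr S0) -exprMn le_eqVlt; apply/orP; left; apply/eqP.
by congr (_ ^+ 2); field.
Qed.

End realification.

(** * Finite families in exact operator spaces *)

Section finite_span.
Variables (R : realType) (V : normedModType R[i]).
Local Notation C := R[i].
Implicit Types (A : set V) (x y v : V).

Lemma closed_rnormP A : closed A <->
  forall y, (forall e : R, 0 < e -> exists2 b, A b & rnorm (y - b) <= e) -> A y.
Proof.
split=> [cA y yA|cA y yA].
  apply: cA => B /nbhs_ballP[_ /gt0_complexP[e e0 ->]] eB.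
  have e2 : 0 < e / 2 by rewrite divr_gt0.
  have [b Ab yb] := yA _ e2; exists b; split=> //; apply: eB.
  by rewrite -ball_normE /= -rnormE ltcR; lra.
apply: cA => e e0; have ec : 0 < e%:C :> C by rewrite ltcR.
have [b [Ab]] := yA _ (nbhsx_ballx y _ ec).
by rewrite -ball_normE /= -rnormE ltcR => /ltW yb; exists b.
Qed.

Lemma cauchy_seq_cvg (a : nat -> C^o) (M : R) :
  (forall n m, rnorm (a n - a m) <= M * (n.+1%:R^-1 + m.+1%:R^-1)) -> cvgn a.
Proof.
move=> aM; apply: complex_complete; apply: cauchy_exP => _ /gt0_complexP[e e0 ->].
have M0 : 0 < `|M| + 1 by rewrite ltr_wpDl.
have [D D0 DE] : exists2 D : R, 0 < D & (`|M| + 1) * D = e.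
  by exists (e / (`|M| + 1)); [rewrite divr_gt0|field; rewrite gt_eqF].
have d0 : 0 < D / 4 by rewrite divr_gt0.
have /cvgrPdist_le/(_ _ d0)[n _ nP] := @cvg_harmonic R.
have small k : (n <= k)%N -> (k.+1%:R)^-1 <= D / 4.
  by move=> /nP /=; rewrite sub0r normrN ger0_norm// invr_ge0.
exists (a n); exists n => //= k /= nk; rewrite -ball_normE /= -rnormE ltcR.
apply: le_lt_trans (aM n k) _.
have h : n.+1%:R^-1 + k.+1%:R^-1 <= D / 2.
  by apply: le_trans (lerD (small _ (leqnn n)) (small _ nk)) _; lra.
have s0 : 0 <= n.+1%:R^-1 + k.+1%:R^-1 :> R by rewrite addr_ge0 ?invr_ge0.
apply: (@le_lt_trans _ _ ((`|M| + 1) * (D / 2))).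
  apply: le_trans (_ : (`|M| + 1) * (n.+1%:R^-1 + k.+1%:R^-1) <= _).
    by rewrite ler_wpM2r//; have := ler_norm M; lra.
  by rewrite ler_wpM2l// ltW.
by rewrite mulrA DE; lra.
Qed.

(** If [x] is not in [A], its distance [d] to [A] is positive and
    [d |a| <= |a x + v|] for [v] in [A]: the coefficients of a convergent sequence of
    vectors [a_n x + v_n] form a Cauchy sequence. *)
Lemma closed_add_line A x : closed A -> A 0 ->
  (forall (a : C) u v, A u -> A v -> A (a *: u + v)) ->
  closed [set y | exists a : C, A (y - a *: x)].
Proof.
move=> cA A0 Alin; have AZ (a : C) u : A u -> A (a *: u).
  by move=> Au; rewrite -[a *: u]addr0; exact: Alin.
have [Ax|nAx] := pselect (A x).
  rewrite (_ : [set y | _] = A)//; apply/seteqP; split=> y /=.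
    by case=> a /(Alin a x _ Ax); rewrite addrC subrK.
  by move=> Ay; exists 0; rewrite scale0r subr0.
have [d d0 dP] : exists2 d : R, 0 < d & forall v, A v -> d <= rnorm (x - v).
  apply: contrapT => nd; apply: nAx; move/closed_rnormP: cA; apply => e e0.
  apply: contrapT => nb; apply: nd; exists e => // v Av.
  by rewrite leNgt; apply/negP => /ltW ve; apply: nb; exists v.
have da (a : C) v : A v -> d * rnorm (a : C^o) <= rnorm (a *: x + v).
  move=> Av; have [->|a0] := eqVneq a 0; first by rewrite rnorm0 mulr0 rnorm_ge0.
  have -> : a *: x + v = a *: (x - (- a^-1) *: v).
    by rewrite scaleNr opprK scalerDr scalerA mulfV// scale1r.
  by rewrite rnormZ mulrC ler_wpM2l ?rnorm_ge0//; apply: dP; exact: AZ.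
apply/closed_rnormP => y yP.
have /choice[b bP] n : exists b : C * V, A b.2 /\
    rnorm (y - (b.1 *: x + b.2)) <= n.+1%:R^-1.
  have n0 : 0 < n.+1%:R^-1 :> R by rewrite invr_gt0.
  have [z [a Az] yz] := yP _ n0; exists (a, z - a *: x); split=> //=.
  by rewrite [X in y - X]addrC subrK.
pose a n : C^o := (b n).1.
have /cvg_ex[l al] : cvgn a.
  apply: (@cauchy_seq_cvg a d^-1) => n m; rewrite ler_pdivlMl//.
  have [An yn] := bP n; have [Am ym] := bP m.
  apply: le_trans (da _ ((-1) *: (b m).2 + (b n).2) (Alin _ _ _ Am An)) _.
  have -> : (a n - a m) *: x + (-1 *: (b m).2 + (b n).2) =
      (y - ((b m).1 *: x + (b m).2)) - (y - ((b n).1 *: x + (b n).2)).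
    rewrite scaleN1r scalerBl opprB [RHS]addrC [RHS]addrA subrK.
    by rewrite opprD [RHS]addrACA; congr (_ + _); rewrite addrC.
  by apply: le_trans (rnormD _ _) _; rewrite addrC /rnorm normrN lerD.
exists l; move/closed_rnormP: cA; apply => e e0.
have e2 : 0 < e / 2 by rewrite divr_gt0.
have M0 : 0 < rnorm x + 1 by rewrite ltr_wpDl ?rnorm_ge0.
have el : 0 < e / 2 / (rnorm x + 1) by rewrite divr_gt0.
have /cvg_rnormP/(_ _ el) h1 := al.
have /cvgrPdist_le/(_ _ e2) h2 := @cvg_harmonic R.
have [n [an hn]] := filter_ex (filterI h1 h2).
have [An yn] := bP n; exists (b n).2 => //.
have -> : y - l *: x - (b n).2 = (y - ((b n).1 *: x + (b n).2)) + (- (l - a n)) *: x.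
  rewrite scaleNr scalerBl opprB opprD [X in _ = X + _]addrA [RHS]addrACA subrK.
  by rewrite -addrA; congr (_ + _); rewrite addrC.
apply: le_trans (rnormD _ _) _; rewrite [e]splitr lerD//.
  by apply: le_trans yn _; move: hn; rewrite /= sub0r normrN ger0_norm// invr_ge0.
rewrite rnormZ {1}/rnorm normrN -/(rnorm _).
rewrite ler_pdivlMr// in an; apply: le_trans an.
by rewrite ler_wpM2l ?rnorm_ge0// lerDl.
Qed.

Definition span_set n (x : 'I_n -> V) : set V :=
  [set y | exists c : 'I_n -> C, y = \sum_i c i *: x i].

Lemma span_set_lin n (x : 'I_n -> V) (a : C) u v :
  span_set x u -> span_set x v -> span_set x (a *: u + v).
Proof.
move=> [c ->] [c' ->]; exists (fun i => a * c i + c' i).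
rewrite scaler_sumr -big_split /=; apply: eq_bigr => i _.
by rewrite scalerDl scalerA.
Qed.

Lemma span_set0 n (x : 'I_n -> V) : span_set x 0.
Proof. by exists (fun=> 0); rewrite big1// => i _; rewrite scale0r. Qed.

Lemma span_set_mem n (x : 'I_n -> V) i : span_set x (x i).
Proof.
exists (fun j => (j == i)%:R); rewrite (bigD1 i)//= eqxx scale1r big1 ?addr0//.
by move=> j /negPf ->; rewrite scale0r.
Qed.

Lemma closed_span_set n (x : 'I_n -> V) : closed (span_set x).
Proof.
elim: n x => [|n IH] x.
  apply/closed_rnormP => y yP; exists (fun=> 0); rewrite big_ord0.
  apply: rnorm0_eq0; apply/eqP; rewrite eq_le rnorm_ge0 andbT.
  apply/ler_addgt0Pr => e e0; rewrite add0r; have [b [c ->]] := yP e e0.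
  by rewrite big_ord0 subr0.
pose x' i := x (lift ord0 i).
rewrite (_ : span_set x = [set y | exists a : C, span_set x' (y - a *: x ord0)]).
  by apply: closed_add_line; [exact: IH|exact: span_set0|exact: span_set_lin].
apply/seteqP; split=> y /=.
  case=> c ->; exists (c ord0), (fun i => c (lift ord0 i)).
  by rewrite big_ord_recl addrC addKr.
case=> a [c yE]; exists (fun i => if unlift ord0 i is Some j then c j else a).
rewrite big_ord_recl unlift_none -[LHS](subrK (a *: x ord0)) yE addrC; congr (_ + _).
by apply: eq_bigr => i _; rewrite liftK.
Qed.

End finite_span.

Section exact_model.
Variable R : realType.
Local Notation C := R[i].
Local Notation l2 := (ell2 R).
Local Open Scope ereal_scope.

Lemma opmx_norm_ge0 (H : hilbertType R) n (a : 'M[bop H H]_n) : 0 <= opmx_norm a.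
Proof.
apply: (@le_trans _ _ (Num.sqrt (\sum_(i < n)
  rnorm (\sum_(j < n) a i j ((fun=> 0%R) j)) ^+ 2))%:E); first by rewrite lee_fin sqrtr_ge0.
apply: ereal_sup_ubound; exists (fun=> 0%R) => //=.
by rewrite big1 ?ler01// => j _; rewrite rnorm0 expr0n.
Qed.

Lemma opmx_norm0 (H : hilbertType R) n : opmx_norm (0%R : 'M[bop H H]_n) <= 1.
Proof.
apply/opmx_normP => // xi; rewrite big1 => [|i _].
  by rewrite mulr_ge0 ?sqr_ge0// sumr_ge0// => j _; exact: sqr_ge0.
by rewrite big1 ?rnorm0 ?expr0n// => j _; rewrite mxE.
Qed.

Lemma cbnorm_ge0 (H H' : hilbertType R) (E : opspace H) (G : opspace H')
  (u : {linear E -> G}) : 0 <= cbnorm u.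
Proof.
apply: le_trans (_ : mxnorm (map_mx u (0%R : 'M[E]_0)) <= _); first exact: opmx_norm_ge0.
apply: ereal_sup_ubound; exists 0%N, 0%R; split=> //.
rewrite (_ : mxnorm _ = opmx_norm (0%R : 'M[bop H H]_0)); first exact: opmx_norm0.
by congr opmx_norm; apply/matrixP => -[].
Qed.

Lemma dSK_fin_ge0 (H : hilbertType R) (E : opspace H) : 0 <= dSK_fin E.
Proof.
apply: le_ereal_inf_tmp => _ [G _ <-]; apply: le_ereal_inf_tmp => _ [v [w [_ _ ->]]].
by apply: mule_ge0; exact: cbnorm_ge0.
Qed.

Definition span_opspace (H : hilbertType R) n (x : 'I_n -> bop H H) : opspace H.
Proof.
refine (@OpSpace R H (span_set x) _ (@closed_span_set _ _ _ x)).
split; first by rewrite inE; exact: span_set0.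
by move=> a u v; rewrite !inE; exact: span_set_lin.
Defined.

Lemma span_opspace_finite (H : hilbertType R) n (x : 'I_n -> bop H H) :
  finite_dim (span_opspace x).
Proof.
have xP i : x i \in opset_pred (span_opspace x).
  by rewrite inE; exact: span_set_mem.
exists n, (fun i => OpElt (xP i)) => -[y yP]; have := yP; rewrite inE => -[c yE].
exists c; apply: val_inj; rewrite raddf_sum /= yE; apply: eq_bigr => i _.
by [].
Qed.

Lemma dSK_span_le (H : hilbertType R) (E : opspace H) n (x : 'I_n -> E) :
  exists (E0 : opspace H) (x0 : 'I_n -> E0),
    (forall j, val (x0 j) = val (x j)) /\ dSK_fin E0 <= dSK E.
Proof.
rewrite /dSK; case: asboolP => [fE|nfE].
  by exists E, x; split.
pose y j : bop H H := val (x j).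
have yP i : y i \in opset_pred (span_opspace y).
  by rewrite inE; exact: span_set_mem.
exists (span_opspace y), (fun i => OpElt (yP i)); split=> //.
apply: ereal_sup_ubound; exists (span_opspace y) => //; split; last exact: span_opspace_finite.
move=> _ [c ->].
have : (\sum_(i < n) c i *: y i)%R \in opset_pred E.
  by apply: rpred_sum => i _; apply: rpredZ; exact: opvalP.
by rewrite inE.
Qed.

Lemma dSK_ge0 (H : hilbertType R) (E : opspace H) : 0 <= dSK E.
Proof.
have [E0 [_ [_ le]]] := dSK_span_le (fun _ : 'I_0 => 0%R : E).
exact: le_trans (dSK_fin_ge0 E0) le.
Qed.

Lemma cbnorm_gt0 (H H' : hilbertType R) (E : opspace H) (G : opspace H')
  (u : {linear E -> G}) x : u x != 0%R -> 0 < cbnorm u.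
Proof.
move=> ux; rewrite lt_def cbnorm_ge0 andbT; apply: contra_neq ux => u0.
have uK : cbnorm u <= 0%:E by rewrite u0.
have B0 : (0 < opnorm (val x) + 1)%R by rewrite ltr_wpDl ?opnorm_ge0.
have := @cbnorm_ocol_le _ _ _ _ _ u 0 _ 1 (fun=> x) uK (lexx _) B0 _.
move=> h; apply: val_inj; apply: val_inj; apply/funext => xi.
have /h/(_ xi) : ocol_le (fun _ : 'I_1 => val x) (opnorm (val x) + 1).
  move=> z; rewrite big_ord1 -exprMn ler_pXn2r ?nnegrE ?mulr_ge0 ?rnorm_ge0 ?(ltW B0)//.
  by apply: le_trans (opnormP _ _) _; rewrite ler_wpM2r ?rnorm_ge0// lerDl.
rewrite big_ord1 mul0r expr0n mul0r => le.
apply: rnorm0_eq0; apply/eqP; rewrite -sqrf_eq0 eq_le le sqr_ge0.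
by [].
Qed.

Lemma lte_mul_fin (a b : \bar R) (r : R) : 0 < a -> 0 < b -> a * b < r%:E ->
  exists a' b' : R, [/\ a = a'%:E, b = b'%:E, (0 < a')%R, (0 < b')%R & (a' * b' < r)%R].
Proof.
case: a => [a| |]//; case: b => [b| |]//; rewrite ?lte_fin.
- by move=> a0 b0 ab; exists a, b.
- by move=> a0 _; rewrite gt0_muley// ltNge leey.
- by move=> _ b0; rewrite gt0_mulye// ltNge leey.
Qed.

(** The family [t] is the image of [x] under an isomorphism [v] between a finite
    dimensional subspace of [E] and a space of compact operators. Row and column
    norms go from [x] to [t] by [v], norms of tensors go back by its inverse [w].
    A nonzero [x j] excludes the products 0 * oo in the distance. *)
Lemma exact_model (H : hilbertType R) (E : opspace H) n (x : 'I_n -> E) (r : R) :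
  dSK E < r%:E -> (exists j, x j != 0%R) ->
  exists (t : 'I_n -> bop l2 l2) (kv kw : R),
    [/\ forall j, compact_op (t j), (0 < kv)%R, (0 < kw)%R & (kv * kw < r)%R] /\
    [/\ forall B, (0 < B)%R -> ocol_le (fun j => val (x j)) B -> ocol_le t (kv * B),
        forall B, (0 < B)%R -> orow_le (fun j => val (x j)) B -> orow_le t (kv * B) &
        forall N (a : 'I_n -> 'M[C]_N) B, (0 < B)%R ->
          opmx_le (\matrix_(p, q) (\sum_j a j p q *: t j)%R) B ->
          opmx_le (\matrix_(p, q) (\sum_j a j p q *: val (x j))%R) (kw * B)].
Proof.
move=> Er [j0 xj0].
have [E0 [x0 [x0E le]]] := dSK_span_le x.
have /ereal_inf_lt[_ [G cG <-]] := le_lt_trans le Er.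
move=> /ereal_inf_lt[_ [v [w [vw wv ->]]] vwr].
have x00 : x0 j0 != 0%R.
  apply: contra_neq xj0 => h; apply: val_inj; rewrite -x0E h //.
have v0 : 0 < cbnorm v.
  apply: (@cbnorm_gt0 _ _ _ _ v (x0 j0)); apply: contra_neq x00 => h.
  by rewrite -(vw (x0 j0)) h linear0.
have w0 : 0 < cbnorm w by apply: (@cbnorm_gt0 _ _ _ _ w (v (x0 j0))); rewrite vw.
have [kv [kw [vE wE kv0 kw0 kr]]] := lte_mul_fin v0 w0 vwr.
have vK : cbnorm v <= kv%:E by rewrite vE.
have wK : cbnorm w <= kw%:E by rewrite wE.
exists (fun j => val (v (x0 j))), kv, kw; split; split=> //.
- by move=> j; apply: cG; have := opvalP (v (x0 j)); rewrite inE.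
- move=> B B0 xB; apply: (cbnorm_ocol_le vK (ltW kv0) B0).
  by move=> xi; apply: le_trans (xB xi); under eq_bigr do rewrite x0E.
- move=> B B0 xB; apply: (cbnorm_orow_le vK (ltW kv0) B0).
  move=> xi; apply: le_trans (xB xi); rewrite le_eqVlt; apply/orP; left; apply/eqP.
  by congr (rnorm _ ^+ 2)%R; apply: eq_bigr => j _; rewrite x0E.
- move=> N a B B0 tB.
  pose X : 'M[G]_N := (\matrix_(p, q) \sum_j a j p q *: v (x0 j))%R.
  have := @cbnorm_opmx_le _ _ _ _ _ w kw B N X wK (ltW kw0) B0.
  have -> : map_mx val X = (\matrix_(p, q) \sum_j a j p q *: val (v (x0 j)))%R.
    by apply/matrixP => p q; rewrite !mxE raddf_sum.
  move=> /(_ tB).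
  suff -> : map_mx val (map_mx w X) = (\matrix_(p, q) \sum_j a j p q *: val (x j))%R by [].
  apply/matrixP => p q; rewrite !mxE linear_sum raddf_sum /=; apply: eq_bigr => j _.
  by rewrite linearZ vw -x0E.
Qed.

End exact_model.

(** * The Grothendieck inequality for exact operator spaces *)

(** The permutations of distinct letters agree nowhere, so the matrices of the letters
    are exactly orthogonal; multiplying by [q1] and [q2] changes their inner
    products by little. *)
Lemma sgmx_almost_orthonormal (R : realType) n L (q1 q2 : 'M[R]_(nperm n L)) (d : R) j k :
  (0 < L)%N -> 0 <= d <= 1 ->
  nsq (1%:M - q1) <= d ^+ 2 * (nperm n L)%:R ->
  nsq (1%:M - q2) <= d ^+ 2 * (nperm n L)%:R ->
  `|\sum_p \sum_s q1 s (act j p) * q2 s (act k p) - (j == k)%:R * (nperm n L)%:R|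
    <= 3 * d * (nperm n L)%:R.
Proof.
move=> L0 /andP[d0 d1]; set N := nperm n L => hf1 hf2.
have N0 : 0 <= N%:R :> R by [].
pose U i : 'M[R]_N := sgmx R (@act n L) i.
have dotU (f g : 'M[R]_N) : dotmx (f *m U j) (g *m U k) =
    \sum_p \sum_s f s (act j p) * g s (act k p).
  rewrite dotmxE exchange_big /=; apply: eq_bigr => p _; apply: eq_bigr => s _.
  by rewrite !mulmx_sg.
have nsqU (f : 'M[R]_N) i : nsq (f *m U i) = nsq f.
  rewrite !nsqE2 [RHS](reindex_inj (inv_inj (@actK n L i))); apply: eq_bigr => p _.
  by apply: eq_bigr => s _; rewrite mulmx_sg.
have nsq1 : nsq (1%:M : 'M[R]_N) = N%:R.
  rewrite nsqE (eq_bigr (fun=> 1)); first by rewrite sumr_const card_ord.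
  move=> i _; rewrite (bigD1 i)//= mxE eqxx expr1n big1 ?addr0// => s /negPf si.
  by rewrite mxE eq_sym si expr0n.
have dot1 : dotmx (1%:M *m U j) (1%:M *m U k) = (j == k)%:R * N%:R.
  have [<-|jk] := eqVneq j k; first by rewrite -/(nsq _) nsqU nsq1 mul1r.
  rewrite dotU mul0r big1// => p _; rewrite big1// => s _; rewrite !mxE.
  have [->|] := eqVneq s (act j p); last by rewrite mul0r.
  by rewrite (negPf (act_neq p L0 jk)) mulr0.
have cs (f g : 'M[R]_N) (a b : R) : 0 <= a -> 0 <= b ->
    nsq f <= a ^+ 2 * N%:R -> nsq g <= b ^+ 2 * N%:R ->
    `|dotmx (f *m U j) (g *m U k)| <= a * b * N%:R.
  move=> a0 b0 fa gb; rewrite -(@ler_pXn2r _ 2) ?nnegrE ?mulr_ge0//.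
  rewrite real_normK ?num_real//; apply: le_trans (dotmx_CauchySchwarz _ _) _.
  rewrite !nsqU; have -> : (a * b * N%:R) ^+ 2 = a ^+ 2 * N%:R * (b ^+ 2 * N%:R) by ring.
  by apply: ler_pM => //; exact: nsq_ge0.
set f1 := 1%:M - q1 in hf1; set f2 := 1%:M - q2 in hf2.
have hN : nsq (1%:M : 'M[R]_N) <= 1 ^+ 2 * N%:R by rewrite nsq1; lra.
have b1 := cs f1 1%:M d 1 d0 ler01 hf1 hN.
have b2 := cs 1%:M f2 1 d ler01 d0 hN hf2.
have b3 := cs f1 f2 d d d0 d0 hf1 hf2.
rewrite -dotU -dot1.
have -> : dotmx (q1 *m U j) (q2 *m U k) - dotmx (1%:M *m U j) (1%:M *m U k) =
    dotmx (f1 *m U j) (f2 *m U k) - dotmx (f1 *m U j) (1%:M *m U k) -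
    dotmx (1%:M *m U j) (f2 *m U k).
  rewrite /f1 /f2 !mulmxBl !dotmxDl !dotmxDr !dotmxNl.
  have dotNr (A B : 'M[R]_N) : dotmx A (- B) = - dotmx A B by rewrite dotmxC dotmxNl dotmxC.
  by rewrite !dotNr; ring.
apply: le_trans (ler_normB _ _) _; apply: le_trans (lerD (ler_normB _ _) (lexx _)) _.
have : d * d * N%:R <= d * N%:R by rewrite ler_wpM2r// ler_piMl.
lra.
Qed.

Lemma le_of_small_perturbation (R : realFieldType) (T A W : R) : 0 <= A -> 0 <= W ->
  (forall d, 0 < d -> d <= 1 -> T <= A + 3 * d * (A + W)) -> T <= A.
Proof.
move=> A0 W0 H; apply/ler_addgt0Pr => e e0; pose D := 3 * (A + W) + e + 1.
have D0 : 0 < D by rewrite /D; lra.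
have De : 0 < e / D by rewrite divr_gt0.
apply: le_trans (H (e / D) De _) _.
  by rewrite ler_pdivrMr// mul1r /D; lra.
rewrite lerD2l mulrAC mulrA ler_pdivrMr// mulrC ler_wpM2l ?(ltW e0)//.
by rewrite /D; lra.
Qed.

Lemma perturbed_product_le (R : realFieldType) (A W d : R) : 0 <= A -> 0 < d -> d <= 1 ->
  A * (1 + d ^+ 2) ^+ 2 + 3 * d * W <= A + 3 * d * (A + W).
Proof.
move=> A0 d0 d1; have dd0 : 0 < d ^+ 2 by rewrite exprn_gt0.
have dd : d ^+ 2 <= d by rewrite expr2 ler_piMl// ltW.
have ddd : (1 + d ^+ 2) ^+ 2 <= 1 + 3 * d.
  have : d ^+ 2 * d ^+ 2 <= d * 1 by apply: ler_pM; rewrite ?(ltW dd0)//; lra.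
  lra.
have : A * (1 + d ^+ 2) ^+ 2 <= A * (1 + 3 * d) by rewrite ler_wpM2l.
lra.
Qed.

Section grothendieck.
Variable R : realType.
Local Notation C := R[i].

Lemma opmx_le_mono (H : hilbertType R) n (a : 'M[bop H H]_n) (A B : R) :
  0 <= A -> A <= B -> opmx_le a A -> opmx_le a B.
Proof.
move=> A0 AB aA xi; apply: le_trans (aA xi) _; rewrite ler_wpM2r//.
  by apply: sumr_ge0 => j _; exact: sqr_ge0.
by rewrite ler_pXn2r ?nnegrE// (le_trans A0).
Qed.

Lemma exact_free_like (H : hilbertType R) (E : opspace H) n (x : 'I_n -> E) (r rho e : R) :
  (dSK E < r%:E)%E -> (exists j, x j != 0) -> 0 < rho -> 0 < e ->
  ocol_le (fun j => val (x j)) rho -> orow_le (fun j => val (x j)) rho ->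
  exists L0, forall L, (L0 <= L)%N -> exists q : 'M[R]_(nperm n L),
    nsq (1%:M - q) <= e * (nperm n L)%:R /\
    opmx_le (\matrix_(p, s) \sum_j (q s (act j p))%:C *: val (x j)) (2 * rho * r * (1 + e)).
Proof.
move=> Er xn0 rho0 e0 xcol xrow.
have [t [kv [kw [[tc kv0 kw0 kr] [tcol trow tx]]]]] := exact_model Er xn0.
have c0 : 0 < kv * rho by rewrite mulr_gt0.
have [L0 L0P] := compact_free_like tc c0 e0 (tcol _ rho0 xcol) (trow _ rho0 xrow).
have e1 : 0 < 1 + e by rewrite ltr_wpDl.
have B0 : 0 < 2 * (kv * rho) * (1 + e) by rewrite !mulr_gt0.
have B1 : kw * (2 * (kv * rho) * (1 + e)) <= 2 * rho * r * (1 + e).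
  have -> : kw * (2 * (kv * rho) * (1 + e)) = 2 * rho * (kv * kw) * (1 + e) by ring.
  by rewrite ler_wpM2r ?(ltW e1)// ler_wpM2l ?mulr_ge0 ?(ltW rho0)// ltW.
have B2 : 0 <= kw * (2 * (kv * rho) * (1 + e)) by rewrite mulr_ge0 ?ltW.
exists L0 => L /L0P[q [q1 qt]]; exists q; split; first exact: q1.
have := tx _ (fun j => \matrix_(p, s) (q s (act j p))%:C) _ B0.
have mE (V : lmodType C) (z : 'I_n -> V) :
    \matrix_(p, s) (\sum_j (\matrix_(p', s') (q s' (act j p'))%:C) p s *: z j) =
    \matrix_(p, s) (\sum_j (q s (act j p))%:C *: z j).
  by apply/matrixP => p s; rewrite !mxE; apply: eq_bigr => j _; rewrite mxE.
by rewrite !mE => /(_ qt); exact: opmx_le_mono.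
Qed.

Lemma odual_pairing_sum (HE HF : hilbertType R) (E : opspace HE) (F : opspace HF)
    (u : {linear E -> odual F}) n (x : 'I_n -> E) (y : 'I_n -> F) N (a b : 'I_n -> 'M[R]_N) :
  \sum_p \sum_s (u ((\matrix_(p, s) \sum_j (a j p s)%:C *: x j) p s) : bop F C^o)
    ((\matrix_(p, s) \sum_j (b j p s)%:C *: y j) p s) =
  \sum_j \sum_k (\sum_p \sum_s a j p s * b k p s)%:C *: ((u (x j) : bop F C^o) (y k) : C^o).
Proof.
have E1 p s : (u ((\matrix_(p, s) \sum_j (a j p s)%:C *: x j) p s) : bop F C^o)
    ((\matrix_(p, s) \sum_j (b j p s)%:C *: y j) p s) =
    \sum_j \sum_k (a j p s * b k p s)%:C *: ((u (x j) : bop F C^o) (y k) : C^o).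
  rewrite !mxE [u (\sum_j _)]linear_sum.
  have h (r : seq 'I_n) v : ((\sum_(j <- r) u ((a j p s)%:C *: x j) : odual F) : bop F C^o) v =
      \sum_(j <- r) (u ((a j p s)%:C *: x j) : bop F C^o) v.
    by elim: r => [|j r IH]; rewrite ?big_nil// !big_cons -IH.
  apply: etrans (h _ _) _; apply: eq_bigr => j _; rewrite linear_sum; apply: eq_bigr => k _.
  rewrite !linearZ rmorphM -[LHS]/(_ * (_ * (u (x j) : bop F C^o) (y k))).
  by rewrite mulrA [X in X * _]mulrC.
rewrite (eq_bigr (fun p => \sum_j \sum_s \sum_k (a j p s * b k p s)%:C *:
  ((u (x j) : bop F C^o) (y k) : C^o))); last first.
  by move=> p _; rewrite exchange_big; apply: eq_bigr => s _; exact: E1.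
rewrite exchange_big; apply: eq_bigr => j _.
rewrite (eq_bigr (fun p => \sum_k \sum_s (a j p s * b k p s)%:C *:
  ((u (x j) : bop F C^o) (y k) : C^o))); last by move=> p _; rewrite exchange_big.
rewrite exchange_big; apply: eq_bigr => k _.
rewrite rmorph_sum scaler_suml; apply: eq_bigr => p _.
by rewrite rmorph_sum scaler_suml.
Qed.

Lemma diagonal_sum_le n (g : 'I_n -> 'I_n -> C^o) (w : 'I_n -> 'I_n -> R) (N eta : R) :
  0 <= N -> (forall j k, `|w j k - (j == k)%:R * N| <= eta * N) ->
  N * rnorm (\sum_j g j j) <= rnorm (\sum_j \sum_k (w j k)%:C *: g j k) +
    eta * N * \sum_j \sum_k rnorm (g j k).
Proof.
move=> N0 wE.
have -> : N * rnorm (\sum_j g j j) = rnorm (N%:C *: \sum_j g j j).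
  by rewrite rnormZ_real ger0_norm.
have -> : N%:C *: (\sum_j g j j) = \sum_j \sum_k (w j k)%:C *: g j k -
    \sum_j \sum_k (w j k - (j == k)%:R * N)%:C *: g j k.
  rewrite -sumrB scaler_sumr; apply: eq_bigr => j _; rewrite -sumrB.
  rewrite (bigD1 j)// eqxx mul1r big1 ?addr0.
    by rewrite /= addr0 rmorphB scalerBl opprB addrC subrK.
  by move=> k; rewrite eq_sym => /= /negPf ->; rewrite mul0r subr0 subrr.
have rnormN (z : C^o) : rnorm (- z) = rnorm z by rewrite /rnorm normrN.
apply: le_trans (rnormD _ _) _; rewrite rnormN lerD2l.
apply: le_trans (rnorm_sum _ _ _) _; rewrite mulr_sumr; apply: ler_sum => j _.
apply: le_trans (rnorm_sum _ _ _) _; rewrite mulr_sumr; apply: ler_sum => k _.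
by rewrite rnormZ_real ler_wpM2r ?rnorm_ge0.
Qed.

(** The two contractions, for [E] and for [F], must come from the same group, whence
    the need for a common [L]. *)
Theorem grothendieck_exact (HE HF : hilbertType R) (E : opspace HE) (F : opspace HF)
    (u : {linear E -> odual F}) (r s K rho tau : R) n (x : 'I_n -> E) (y : 'I_n -> F) :
  (dSK E < r%:E)%E -> (dSK F < s%:E)%E -> (cbnorm u <= K%:E)%E -> 0 <= K ->
  0 < rho -> 0 < tau ->
  ocol_le (fun j => val (x j)) rho -> orow_le (fun j => val (x j)) rho ->
  ocol_le (fun j => val (y j)) tau -> orow_le (fun j => val (y j)) tau ->
  rnorm (\sum_j (u (x j) : bop F C^o) (y j)) <= 4 * (r * s) * K * (rho * tau).
Proof.
move=> Er Fs uK K0 rho0 tau0 xcol xrow ycol yrow.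
have r0 : 0 < r by rewrite -lte_fin; apply: le_lt_trans Er; exact: dSK_ge0.
have s0 : 0 < s by rewrite -lte_fin; apply: le_lt_trans Fs; exact: dSK_ge0.
set A := 4 * (r * s) * K * (rho * tau).
have A0 : 0 <= A by rewrite /A !mulr_ge0 ?(ltW r0) ?(ltW s0) ?(ltW rho0) ?(ltW tau0).
have [xn0|x0] := pselect (exists j, x j != 0); last first.
  rewrite big1 ?rnorm0// => j _; have -> : x j = 0.
    by apply: contrapT => /eqP h; apply: x0; exists j.
  by rewrite linear0.
have [yn0|y0] := pselect (exists j, y j != 0); last first.
  rewrite big1 ?rnorm0// => j _; have -> : y j = 0.
    by apply: contrapT => /eqP h; apply: y0; exists j.
  by rewrite linear0.
pose g j k : C^o := (u (x j) : bop F C^o) (y k).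
pose W := \sum_j \sum_k rnorm (g j k).
have W0 : 0 <= W by do 2!apply: sumr_ge0 => ? _; exact: rnorm_ge0.
(* The defect of the contractions is [d ^+ 2] in squared normalized norm. *)
apply: (le_of_small_perturbation A0 W0) => d d0 d1.
apply: le_trans (perturbed_product_le W A0 d0 d1).
have e1 : 0 < 1 + d ^+ 2 by rewrite ltr_pwDl// sqr_ge0.
have A1 : 0 < 2 * rho * r * (1 + d ^+ 2) by rewrite !mulr_gt0.
have B1 : 0 < 2 * tau * s * (1 + d ^+ 2) by rewrite !mulr_gt0.
have d01 : 0 <= d <= 1 by rewrite ltW.
have dd0 : 0 < d ^+ 2 by rewrite exprn_gt0.
have alg N' W' : K * (2 * rho * r * (1 + d ^+ 2)) * (2 * tau * s * (1 + d ^+ 2)) * N' +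
    3 * d * N' * W' = N' * (A * (1 + d ^+ 2) ^+ 2 + 3 * d * W') by rewrite /A; ring.
have [Lx LxP] := exact_free_like Er xn0 rho0 dd0 xcol xrow.
have [Ly LyP] := exact_free_like Fs yn0 tau0 dd0 ycol yrow.
have [L [LxL LyL L0]] : exists L, [/\ (Lx <= L)%N, (Ly <= L)%N & (0 < L)%N].
  by exists (maxn (maxn Lx Ly) 1); rewrite !leq_max !leqnn !orbT.
have [q1 [hq1 Xle]] := LxP _ LxL; have [q2 [hq2 Yle]] := LyP _ LyL.
have NN0 : 0 < (nperm n L)%:R :> R by rewrite ltr0n nperm_gt0.
pose a j : 'M[R]_(nperm n L) := \matrix_(p, s) q1 s (act j p).
pose b j : 'M[R]_(nperm n L) := \matrix_(p, s) q2 s (act j p).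
pose X : 'M[E]_(nperm n L) := \matrix_(p, s) \sum_j (a j p s)%:C *: x j.
pose Y : 'M[F]_(nperm n L) := \matrix_(p, s) \sum_j (b j p s)%:C *: y j.
have XA : opmx_le (map_mx val X) (2 * rho * r * (1 + d ^+ 2)).
  suff -> : map_mx val X = \matrix_(p, s) \sum_j (q1 s (act j p))%:C *: val (x j) by exact: Xle.
  by apply/matrixP => p q; rewrite !mxE raddf_sum; apply: eq_bigr => j _; rewrite mxE.
have YB : opmx_le (map_mx val Y) (2 * tau * s * (1 + d ^+ 2)).
  suff -> : map_mx val Y = \matrix_(p, s) \sum_j (q2 s (act j p))%:C *: val (y j) by exact: Yle.
  by apply/matrixP => p q; rewrite !mxE raddf_sum; apply: eq_bigr => j _; rewrite mxE.
have := cbnorm_pairing_le uK K0 A1 B1 XA YB; rewrite odual_pairing_sum => hS.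
have wE j k : `|\sum_p \sum_s a j p s * b k p s - (j == k)%:R * (nperm n L)%:R|
    <= 3 * d * (nperm n L)%:R.
  rewrite (eq_bigr (fun p => \sum_s q1 s (act j p) * q2 s (act k p))); last first.
    by move=> p _; apply: eq_bigr => s' _; rewrite !mxE.
  by apply: sgmx_almost_orthonormal; [exact: L0|exact: d01|exact: hq1|exact: hq2].
have le := le_trans (@diagonal_sum_le n g _ _ _ (ltW NN0) wE) (lerD hS (lexx _)).
rewrite -(ler_pM2l NN0); apply: le_trans le _.
by rewrite le_eqVlt -alg eqxx.
Qed.

End grothendieck.

(** * A positive form dominating a bilinear pairing *)

Section hilbert_form.
Variables (R : realType) (H : hilbertType R).
Local Notation C := R[i].

Lemma dotp_formDl a (x y z : H) : dotp (a *: x + y) z = a * dotp x z + dotp y z.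
Proof. by rewrite linearPl. Qed.

Lemma dotp_formC (x y : H) : dotp y x = Num.conj (dotp x y).
Proof. by rewrite hermC expr0 mul1r. Qed.

Lemma dotp_form_ge0 (x : H) : 0 <= dotp x x.
Proof. by rewrite -dotp_norm exprn_ge0. Qed.

Definition dotp_form : psd_form H := PsdForm dotp_formDl dotp_formC dotp_form_ge0.

Lemma dotp_formDr a (x y z : H) : dotp z (a *: x + y) = Num.conj a * dotp z x + dotp z y.
Proof. exact: (pformDr dotp_form). Qed.

Lemma pnorm_dotp (x : H) : pnorm dotp_form x = rnorm x.
Proof.
apply/eqP; rewrite -(@eqrXn2 _ 2) ?pnorm_ge0 ?rnorm_ge0//; apply/eqP/complexI.
by rewrite pnorm_sqr rmorphXn /= rnormE dotp_norm.
Qed.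

Lemma dotp_CS (x y : H) : rnorm (dotp x y : C^o) <= rnorm x * rnorm y.
Proof. by rewrite -!pnorm_dotp; exact: (pform_CauchySchwarz dotp_form). Qed.

Variable E : opspace H.
Implicit Types (x y : E) (xi eta zeta : H).

Lemma opelt_le x xi : rnorm (val x xi) <= rnorm x * rnorm xi.
Proof. exact: opnormP. Qed.

Lemma val_lin a x y xi : val (a *: x + y) xi = a *: val x xi + val y xi.
Proof. by []. Qed.

(** The form [x, y |-> <x xi, y xi>]. *)
Definition col_form xi : psd_form E.
Proof.
refine (@PsdForm R E (fun x y => dotp (val x xi) (val y xi)) _ _ _) => [a x y z|x y|x].
- by rewrite val_lin dotp_formDl.
- exact: dotp_formC.
- exact: dotp_form_ge0.
Defined.

Lemma adj_subproof x eta : (fun zeta => dotp eta (val x zeta) : C^o) \in antibounded dotp_form.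
Proof.
apply/asboolP; split=> [a z z'|].
  by rewrite linearP dotp_formDr.
exists (rnorm eta * rnorm x) => z; apply: le_trans (dotp_CS _ _) _.
by rewrite pnorm_dotp -mulrA ler_wpM2l ?rnorm_ge0// opelt_le.
Qed.

(** The vector [x^* eta], represented by the functional that it defines. *)
Definition adj x eta : antidual dotp_form := Antidual (adj_subproof x eta).

Lemma adj_lin a x y eta : adj (a *: x + y) eta = Num.conj a *: adj x eta + adj y eta.
Proof.
apply: val_inj; apply/funext => z.
exact: (dotp_formDr a (val x z) (val y z) eta).
Qed.

Lemma rnorm_adj_le x eta : rnorm (adj x eta) <= rnorm x * rnorm eta.
Proof.
apply: adnorm_le; first by rewrite mulr_ge0 ?rnorm_ge0.
move=> z; apply: le_trans (dotp_CS _ _) _.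
by rewrite pnorm_dotp (mulrC (rnorm x)) -mulrA ler_wpM2l ?rnorm_ge0// opelt_le.
Qed.

Lemma addot_linr (V : lmodType C) (s : psd_form V) a (f g h : antidual s) :
  addot h (a *: f + g) = Num.conj a * addot h f + addot h g.
Proof. by rewrite !(addotC h) addot_linear rmorphD rmorphM. Qed.

(** The form [x, y |-> <y^* eta, x^* eta>]. *)
Definition row_form eta : psd_form E.
Proof.
refine (@PsdForm R E (fun x y => addot (adj y eta) (adj x eta)) _ _ _) => [a x y z|x y|x].
- by rewrite adj_lin addot_linr conjCK.
- exact: addotC.
- by rewrite addotE ler0c sqr_ge0.
Defined.

Lemma pnorm_col xi x : pnorm (col_form xi) x = rnorm (val x xi).
Proof. exact: pnorm_dotp. Qed.

Lemma pnorm_row eta x : pnorm (row_form eta) x = rnorm (adj x eta).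
Proof.
apply/eqP; rewrite -(@eqrXn2 _ 2) ?pnorm_ge0 ?rnorm_ge0//; apply/eqP/complexI.
by rewrite pnorm_sqr /= addotE.
Qed.

(** Use [col_form] at the normalized vector [xi]. *)
Lemma ocol_le_forms n (z : 'I_n -> E) (rho : R) :
  (forall s : psd_form E, (forall x, pnorm s x <= rnorm x) ->
    \sum_j pnorm s (z j) ^+ 2 <= rho ^+ 2) ->
  ocol_le (fun j => val (z j)) rho.
Proof.
move=> zs xi; have [xi0|xi0] := eqVneq (rnorm xi) 0.
  rewrite (rnorm0_eq0 xi0) big1 => [|j _]; last by rewrite linear0 rnorm0 expr0n.
  by rewrite mulr_ge0 ?sqr_ge0.
have pos : 0 < rnorm xi by rewrite lt_def xi0 rnorm_ge0.
have n1 : rnorm ((rnorm xi)^-1%:C *: xi) = 1.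
  by rewrite rnormZ_real ger0_norm ?invr_ge0 ?rnorm_ge0// mulVf.
have := zs (col_form ((rnorm xi)^-1%:C *: xi)).
have le x : pnorm (col_form ((rnorm xi)^-1%:C *: xi)) x <= rnorm x.
  by rewrite pnorm_col; apply: le_trans (opelt_le _ _) _; rewrite n1 mulr1.
move=> /(_ le).
rewrite (eq_bigr (fun j => (rnorm xi)^-1 ^+ 2 * rnorm (val (z j) xi) ^+ 2)); last first.
  move=> j _; rewrite pnorm_col linearZ rnormZ_real exprMn.
  by rewrite ger0_norm// invr_ge0 rnorm_ge0.
by rewrite -mulr_sumr exprVn mulrC ler_pdivrMr// exprn_gt0.
Qed.

(** Use [row_form] at the unit vector in the direction of the row applied to
    [zeta]. *)
Lemma orow_le_forms n (z : 'I_n -> E) (rho : R) : 0 <= rho ->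
  (forall s : psd_form E, (forall x, pnorm s x <= rnorm x) ->
    \sum_j pnorm s (z j) ^+ 2 <= rho ^+ 2) ->
  orow_le (fun j => val (z j)) rho.
Proof.
move=> rho0 zs zeta; set v := \sum_j _; set S := \sum_j _.
have S0 : 0 <= S by apply: sumr_ge0 => j _; exact: sqr_ge0.
have [v0|v0] := eqVneq (rnorm v) 0; first by rewrite v0 expr0n mulr_ge0 ?sqr_ge0.
have pos : 0 < rnorm v by rewrite lt_def v0 rnorm_ge0.
pose eta := (rnorm v)^-1%:C *: v.
have n1 : rnorm eta = 1 by rewrite rnormZ_real ger0_norm ?invr_ge0 ?rnorm_ge0// mulVf.
have le x : pnorm (row_form eta) x <= rnorm x.
  by rewrite pnorm_row; apply: le_trans (rnorm_adj_le _ _) _; rewrite n1 mulr1.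
have := zs _ le; under eq_bigr do rewrite pnorm_row; move=> rowS.
have vE : rnorm v = rnorm (\sum_j adj (z j) eta (zeta j) : C^o).
  have -> : \sum_j adj (z j) eta (zeta j) = dotp eta v.
    by rewrite /v linear_sumr.
  have -> : dotp eta v = (rnorm v)%:C.
    rewrite /eta linearZl_LR /= -dotp_norm -rnormE expr2 mulrA -rmorphM /=.
    by rewrite mulVf// rmorph1 mul1r.
  by rewrite rnorm_real ger0_norm// rnorm_ge0.
rewrite vE; apply: (@le_trans _ _ ((\sum_j rnorm (adj (z j) eta) * rnorm (zeta j)) ^+ 2)).
  rewrite ler_pXn2r ?nnegrE ?rnorm_ge0 ?sumr_ge0//; last first.
    by move=> j _; rewrite mulr_ge0 ?rnorm_ge0.
  apply: le_trans (rnorm_sum _ _ _) _; apply: ler_sum => j _.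
  by apply: le_trans (antidual_le _ _) _; rewrite pnorm_dotp.
by apply: le_trans (sum_CauchySchwarz _ _) _; rewrite ler_wpM2r.
Qed.

End hilbert_form.

Section domination.
Variables (R : realType) (HE HF : hilbertType R) (E : opspace HE) (F : opspace HF).
Variables (u : {linear E -> odual F}) (M : R).
Local Notation C := R[i].
Hypothesis M0 : 0 < M.
Hypothesis gt : forall n (x : 'I_n -> E) (y : 'I_n -> F) rho tau, 0 < rho -> 0 < tau ->
  ocol_le (fun j => val (x j)) rho -> orow_le (fun j => val (x j)) rho ->
  ocol_le (fun j => val (y j)) tau -> orow_le (fun j => val (y j)) tau ->
  rnorm (\sum_j (u (x j) : bop F C^o) (y j)) <= M * (rho * tau).

Let pair x y : C^o := (u x : bop F C^o) y.

(** Apply the inequality to [z] and to the multiples of the [y j] by the conjugates of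
    [<u z_j, y_j>], whose row and column norms are at most the square root of the
    left-hand side. *)
Lemma square_sum_le n (z : 'I_n -> E) (y : 'I_n -> F) (rho : R) : 0 < rho ->
  (forall j, rnorm (y j) <= 1) ->
  (forall s : psd_form E, (forall x, pnorm s x <= rnorm x) ->
    \sum_j pnorm s (z j) ^+ 2 <= rho ^+ 2) ->
  \sum_j rnorm (pair (z j) (y j)) ^+ 2 <= M ^+ 2 * rho ^+ 2.
Proof.
move=> rho0 y1 zs; set G := \sum_j _.
have [->|G1] := eqVneq G 0; first by rewrite mulr_ge0 ?sqr_ge0.
have G0 : 0 < G by rewrite lt_def G1 sumr_ge0// => j _; exact: sqr_ge0.
pose tau := Num.sqrt G; have tau0 : 0 < tau by rewrite sqrtr_gt0.
have tau2 : tau ^+ 2 = G by rewrite sqr_sqrtr// ltW.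
pose c j : C := Num.conj (pair (z j) (y j)).
have cE j : rnorm (c j : C^o) = rnorm (pair (z j) (y j)) by exact: rnorm_conj.
have yle j xi : rnorm (val (c j *: y j) xi) <= rnorm (pair (z j) (y j)) * rnorm xi.
  rewrite -[val _ xi]/(c j *: val (y j) xi) rnormZ cE ler_wpM2l ?rnorm_ge0//.
  by apply: le_trans (opelt_le _ _) _; rewrite ler_piMl ?rnorm_ge0.
have ycol : ocol_le (fun j => val (c j *: y j)) tau.
  move=> xi; rewrite tau2 mulr_suml; apply: ler_sum => j _.
  by rewrite -exprMn ler_pXn2r ?nnegrE ?mulr_ge0 ?rnorm_ge0.
have yrow : orow_le (fun j => val (c j *: y j)) tau.
  move=> xi; rewrite tau2; apply: le_trans (sum_CauchySchwarz _ _).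
  rewrite ler_pXn2r ?nnegrE ?rnorm_ge0 ?sumr_ge0//; last first.
    by move=> j _; rewrite mulr_ge0 ?rnorm_ge0.
  by apply: le_trans (rnorm_sum _ _ _) _; apply: ler_sum => j _; exact: yle.
have := gt rho0 tau0 (ocol_le_forms zs) (orow_le_forms (ltW rho0) zs) ycol yrow.
rewrite (eq_bigr (fun j => (rnorm (pair (z j) (y j)) ^+ 2)%:C : C^o)); last first.
  move=> j _; rewrite linearZ rmorphXn /= rnormE normCK mulrC.
  by [].
have -> : \sum_j ((rnorm (pair (z j) (y j)) ^+ 2)%:C : C^o) = G%:C by rewrite rmorph_sum.
rewrite rnorm_real ger0_norm ?(ltW G0)// -{1}tau2 expr2 mulrA ler_pM2r// => h.
by rewrite -tau2 -exprMn ler_pXn2r ?nnegrE ?mulr_ge0 ?(ltW M0) ?(ltW rho0) ?(ltW tau0).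
Qed.

(** The set of these forms is the index set of the bounded functions to which the
    separation theorem is applied. *)
Record subform := Subform { subform_form :> psd_form E ;
  subform_le : forall x, pnorm subform_form x <= rnorm x }.

Definition zero_form : psd_form E.
Proof.
refine (@PsdForm R E (fun _ _ => 0) _ _ _) => *; rewrite ?mulr0 ?addr0 ?conjC0//.
Defined.

Lemma zero_form_le x : pnorm zero_form x <= rnorm x.
Proof. by rewrite /pnorm /= sqrtr0 rnorm_ge0. Qed.

Definition zero_subform := Subform zero_form_le.

Lemma subform_CS (s : subform) x y : rnorm (s x y : C^o) <= rnorm x * rnorm y.
Proof.
apply: le_trans (pform_CauchySchwarz s x y) _.
by apply: ler_pM; rewrite ?pnorm_ge0 ?subform_le.
Qed.

Lemma re_form_subproof x y :
  (fun s : subform => complex.Re (s x y) : R^o) \in @bounded_fun_pred R subform.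
Proof.
apply/asboolP; exists (rnorm x * rnorm y) => s.
exact: le_trans (rnorm_Re _) (subform_CS s x y).
Qed.

Lemma im_form_subproof x y :
  (fun s : subform => complex.Im (s x y) : R^o) \in @bounded_fun_pred R subform.
Proof.
apply/asboolP; exists (rnorm x * rnorm y) => s.
exact: le_trans (rnorm_Im _) (subform_CS s x y).
Qed.

Definition re_form x y : bfun R subform := Bfun (re_form_subproof x y).
Definition im_form x y : bfun R subform := Bfun (im_form_subproof x y).

Lemma bfun_ext (f g : bfun R subform) : (forall s, f s = g s) -> f = g.
Proof. by move=> fg; apply: val_inj; apply/funext. Qed.

Lemma re_formDl a x y z : re_form (a *: x + y) z =
  complex.Re a *: re_form x z + (- complex.Im a) *: im_form x z + re_form y z.
Proof.
apply: bfun_ext => s.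
rewrite -[RHS]/(complex.Re a * complex.Re (s x z) + - complex.Im a * complex.Im (s x z) +
  complex.Re (s y z)) /= pformDl.
by case: a (s x z) (s y z) => a a' [b b'] [c c'] /=; ring.
Qed.

Lemma im_formDl a x y z : im_form (a *: x + y) z =
  complex.Re a *: im_form x z + complex.Im a *: re_form x z + im_form y z.
Proof.
apply: bfun_ext => s.
rewrite -[RHS]/(complex.Re a * complex.Im (s x z) + complex.Im a * complex.Re (s x z) +
  complex.Im (s y z)) /= pformDl.
by case: a (s x z) (s y z) => a a' [b b'] [c c'] /=; ring.
Qed.

Lemma re_formC x y : re_form y x = re_form x y.
Proof. by apply: bfun_ext => s /=; rewrite pformC; case: (s x y). Qed.

Lemma im_formC x y : im_form y x = (-1) *: im_form x y.
Proof.
apply: bfun_ext => s; rewrite -[RHS]/(-1 * complex.Im (s x y)) /= pformC.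
by case: (s x y) => a b /=; rewrite mulN1r.
Qed.

Lemma re_formE x (s : subform) : re_form x x s = pnorm s x ^+ 2.
Proof. by rewrite -[LHS]/(complex.Re (s x x)) -pnorm_sqr. Qed.

Lemma im_form_diag x : im_form x x = 0.
Proof. by apply: bfun_ext => s /=; rewrite -pnorm_sqr. Qed.

(** The convex cone of the lower bounds to be satisfied by the value at the function
    [s |-> s(x, x)] of the positive functional [Phi]. *)
Definition lower_bound (g : bfun R subform) (r : R) :=
  exists l : seq (E * F), [/\ forall p, p \in l -> rnorm p.2 <= 1,
    g = \sum_(p <- l) re_form p.1 p.1 &
    r = M ^- 2 * \sum_(p <- l) rnorm (pair p.1 p.2) ^+ 2].

Lemma bfun_sumE (I : Type) (l : seq I) (f : I -> bfun R subform) s :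
  (\sum_(p <- l) f p : bfun R subform) s = \sum_(p <- l) f p s.
Proof. by elim: l => [|p l IH]; rewrite ?big_nil// !big_cons -IH. Qed.

Lemma lower_bound_le g r : lower_bound g r -> r <= bfun_sup g.
Proof.
case=> l [l1 gE ->].
have gs s : g s = \sum_(p <- l) pnorm s p.1 ^+ 2.
  by rewrite gE bfun_sumE; apply: eq_bigr => p _; exact: re_formE.
have sup0 : 0 <= bfun_sup g.
  apply: le_trans (bfun_le_sup zero_subform g zero_subform); rewrite gs.
  by apply: sumr_ge0 => p _; exact: sqr_ge0.
rewrite -[M ^- 2]/((M ^+ 2)^-1) mulrC ler_pdivrMr ?exprn_gt0//.
apply/ler_addgt0Pr => e e0.
have d0 : 0 < e / M ^+ 2 by rewrite divr_gt0// exprn_gt0.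
(* The added term makes [rho] positive. *)
pose rho := Num.sqrt (bfun_sup g + e / M ^+ 2).
have rho0 : 0 < rho by rewrite sqrtr_gt0 ltr_wpDl.
have rho2 : rho ^+ 2 = bfun_sup g + e / M ^+ 2 by rewrite sqr_sqrtr// addr_ge0// ltW.
have := @square_sum_le (size l) (fun j => (tnth (in_tuple l) j).1)
  (fun j => (tnth (in_tuple l) j).2) rho rho0.
rewrite (big_tnth _ _ l) rho2 mulrDr [M ^+ 2 * (_ / _)]mulrCA divff ?mulr1; last first.
  by rewrite gt_eqF// exprn_gt0.
rewrite [M ^+ 2 * _]mulrC; apply.
  by move=> j; apply: l1; exact: mem_tnth.
move=> s sle; have := bfun_le_sup zero_subform g (Subform sle).
rewrite gs (big_tnth _ _ l) /= => /le_trans; apply.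
by rewrite lerDl ltW.
Qed.

(** A functional [Phi] below the supremum is positive, so the values of [Phi] at the
    real and imaginary parts of [s |-> s(x, y)] are those of a positive form. *)
Theorem dominating_form : exists s : psd_form E, (forall x, pnorm s x <= rnorm x) /\
  (forall x y, rnorm (pair x y) <= M * pnorm s x * rnorm y).
Proof.
have [||||Phi [PhiD PhiZ Phile Philb]] := @sublinear_separation R (bfun R subform) (@bfun_sup R subform) lower_bound
  (bfun_sup_sublinear R zero_subform).
- by exists [::]; split; rewrite ?big_nil ?mulr0.
- move=> g r g' r' [l [l1 -> ->]] [l' [l'1 -> ->]]; exists (l ++ l'); split.
  + by move=> p; rewrite mem_cat => /orP[/l1|/l'1].
  + by rewrite big_cat.
  + by rewrite big_cat mulrDr.
- move=> a g r a0 [l [l1 -> ->]].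
  pose b := Num.sqrt a; have b2 : b ^+ 2 = a by rewrite sqr_sqrtr// ltW.
  exists [seq (b%:C *: p.1, p.2) | p <- l]; split.
  + by move=> p /mapP[q /l1 h ->].
  + rewrite big_map scaler_sumr; apply: eq_bigr => p _; apply: bfun_ext => s.
    rewrite -[LHS]/(a * re_form p.1 p.1 s) !re_formE /= pnormZ rnorm_real exprMn.
    by rewrite real_normK ?num_real// b2.
  + rewrite big_map mulrCA; congr (_ * _); rewrite mulr_sumr; apply: eq_bigr => p _.
    have -> : pair (b%:C *: p.1) p.2 = b%:C *: pair p.1 p.2 by rewrite /pair linearZ.
    rewrite rnormZ_real.
    by rewrite exprMn real_normK ?num_real// b2.
- exact: lower_bound_le.
have Phi0 : Phi 0 = 0 by rewrite -(scale0r 0) PhiZ mul0r.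
pose s x y : C := Phi (re_form x y) +i* Phi (im_form x y).
have sDl a x y z : s (a *: x + y) z = a * s x z + s y z.
  rewrite /s re_formDl im_formDl !PhiD !PhiZ; case: a => a a' /=.
  by apply/eqP; rewrite eq_complex /=; apply/andP; split; apply/eqP; ring.
have sC x y : s y x = Num.conj (s x y).
  by rewrite /s re_formC im_formC PhiZ mulN1r.
have sE x : s x x = (Phi (re_form x x))%:C by rewrite /s im_form_diag Phi0.
have pos x : 0 <= Phi (re_form x x).
  have := Phile ((-1) *: re_form x x); rewrite PhiZ mulN1r => h.
  rewrite -oppr_le0; apply: le_trans h _; apply: bfun_sup_le; first exact: zero_subform.
  move=> t; rewrite -[leLHS]/(-1 * re_form x x t) re_formE mulN1r oppr_le0.
  exact: sqr_ge0.
have s_ge0 x : 0 <= s x x by rewrite sE ler0c.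
pose sf := PsdForm sDl sC s_ge0.
have sf2 x : pnorm sf x ^+ 2 = Phi (re_form x x).
  by apply: complexI; rewrite pnorm_sqr -sE.
exists sf; split=> [x|x y].
  rewrite -(@ler_pXn2r _ 2) ?nnegrE ?pnorm_ge0 ?rnorm_ge0// sf2.
  apply: le_trans (Phile _) _; apply: bfun_sup_le; first exact: zero_subform.
  move=> t; rewrite re_formE ler_pXn2r ?nnegrE ?pnorm_ge0 ?rnorm_ge0//.
  exact: subform_le.
suff H y' : rnorm y' <= 1 -> rnorm (pair x y') <= M * pnorm sf x.
  have [y0|y0] := eqVneq (rnorm y) 0.
    by rewrite (rnorm0_eq0 y0) /pair linear0 !rnorm0 mulr0.
  have ypos : 0 < rnorm y by rewrite lt_def y0 rnorm_ge0.
  have := H ((rnorm y)^-1%:C *: y); rewrite rnormZ_real ger0_norm ?invr_ge0 ?rnorm_ge0//.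
  rewrite mulVf// => /(_ (lexx _)); rewrite /pair linearZ rnormZ_real.
  by rewrite ger0_norm ?invr_ge0 ?rnorm_ge0// mulrC ler_pdivrMr.
move=> y1; rewrite -(@ler_pXn2r _ 2) ?nnegrE ?rnorm_ge0 ?mulr_ge0 ?pnorm_ge0 ?(ltW M0)//.
have := Philb (re_form x x) (M ^- 2 * rnorm (pair x y') ^+ 2); rewrite exprMn sf2.
rewrite -[M ^- 2]/((M ^+ 2)^-1) ler_pdivrMl ?exprn_gt0//; apply.
exists [:: (x, y')]; split; rewrite ?big_seq1//.
by move=> p; rewrite inE => /eqP ->.
Qed.

End domination.

(** * Factorization through the Hilbert space of a form *)

Section factorization.
Variables (R : realType) (HE HF : hilbertType R) (E : opspace HE) (F : opspace HF).
Local Notation C := R[i].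
Variables (u : {linear E -> odual F}) (s : psd_form E) (M : R).
Hypothesis M0 : 0 <= M.
Hypothesis s_le : forall x, pnorm s x <= rnorm x.
Hypothesis us : forall x y, rnorm ((u x : bop F C^o) y) <= M * pnorm s x * rnorm y.

Lemma kernel_bounded : (kernel s : E -> antidual s) \in @bounded_linear R E (antidual s).
Proof.
apply/asboolP; split; first exact: kernel_linear.
by exists 1 => x; rewrite rnorm_kernel mul1r.
Qed.

Definition kernel_bop : bop E (antidual s) := Bop kernel_bounded.

Lemma dual_vector_subproof y :
  (fun x => Num.conj ((u x : bop F C^o) y) : C^o) \in antibounded s.
Proof.
apply/asboolP; split=> [a x x'|].
  have -> : (u (a *: x + x') : bop F C^o) y = a * (u x : bop F C^o) y + (u x' : bop F C^o) y.
    by rewrite linearP.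
  by rewrite rmorphD rmorphM.
by exists (M * rnorm y) => x; rewrite rnorm_conj mulrAC.
Qed.

(** The functional [x |-> <u x, y>] on [E], as a vector: its inner product with
    [kernel s x] recovers the pairing. *)
Definition dual_vector y : antidual s := Antidual (dual_vector_subproof y).

Lemma dual_vector_lin a y y' :
  dual_vector (a *: y + y') = Num.conj a *: dual_vector y + dual_vector y'.
Proof.
apply: val_inj; apply/funext => x.
rewrite -[LHS]/(Num.conj ((u x : bop F C^o) (a *: y + y'))) linearP.
by rewrite rmorphD rmorphM.
Qed.

Lemma rnorm_dual_vector y : rnorm (dual_vector y) <= M * rnorm y.
Proof.
apply: adnorm_le; first by rewrite mulr_ge0 ?rnorm_ge0.
by move=> x; rewrite [rnorm _]rnorm_conj mulrAC.
Qed.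

Lemma addot_dual_le f y : rnorm (addot f (dual_vector y) : C^o) <= (M * rnorm f) * rnorm y.
Proof.
apply: le_trans (addot_CauchySchwarz _ _) _.
by rewrite (mulrC M) -mulrA ler_wpM2l ?rnorm_ge0// rnorm_dual_vector.
Qed.

Lemma dual_functional_bounded f :
  (fun y => addot f (dual_vector y) : C^o) \in @bounded_linear R F C^o.
Proof.
apply/asboolP; split=> [a y y'|].
  by rewrite dual_vector_lin addot_linr conjCK.
by exists (M * rnorm f) => y; exact: addot_dual_le.
Qed.

Definition dual_functional f : odual F := Bop (dual_functional_bounded f).

Lemma dual_functional_opnorm f : opnorm (dual_functional f) <= M * rnorm f.
Proof.
by apply: opnorm_le; [rewrite mulr_ge0 ?rnorm_ge0|move=> y; exact: addot_dual_le].
Qed.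

Lemma dual_operator_bounded :
  (dual_functional : antidual s -> odual F) \in @bounded_linear R (antidual s) (odual F).
Proof.
apply/asboolP; split=> [a f g|].
  by apply: val_inj; apply/funext => y; exact: addot_linear.
by exists M => f; exact: dual_functional_opnorm.
Qed.

Definition dual_operator : bop (antidual s) (odual F) := Bop dual_operator_bounded.

Lemma factors_through_antidual : factors_through u kernel_bop dual_operator.
Proof.
move=> x; apply: val_inj; apply/funext => y.
rewrite -[RHS]/(addot (kernel s x) (dual_vector y)) addotC addot_kernel.
by rewrite -[X in Num.conj X]/(Num.conj ((u x : bop F C^o) y)) conjCK.
Qed.

Lemma hilbert_factorable_of_form : hilbert_factorable u.
Proof. by exists (antidual s), kernel_bop, dual_operator; exact: factors_through_antidual. Qed.

Lemma gamma2_le_of_form : (gamma2 u <= M%:E)%E.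
Proof.
apply: le_trans (_ : (rnorm dual_operator * rnorm kernel_bop)%:E <= _)%E.
  apply: ereal_inf_lbound; exists (antidual s), kernel_bop, dual_operator.
  by split=> //; exact: factors_through_antidual.
rewrite lee_fin -[leRHS]mulr1; apply: ler_pM; rewrite ?rnorm_ge0//.
  by apply: opnorm_le => // f; exact: dual_functional_opnorm.
by apply: opnorm_le => // x; rewrite mul1r [rnorm _]rnorm_kernel.
Qed.

End factorization.

Lemma cbnorm_odual_ge0 (R : realType) (HE HF : hilbertType R) (E : opspace HE)
  (F : opspace HF) (u : {linear E -> odual F}) : (0 <= cbnorm u)%E.
Proof.
have mx0 (H : hilbertType R) (G : opspace H) : (mxnorm (0%R : 'M[G]_0) <= 1)%E.
  rewrite (_ : mxnorm _ = opmx_norm (0%R : 'M[bop H H]_0)); first exact: opmx_norm0.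
  by congr opmx_norm; apply/matrixP => -[].
suff le0 : (0 <= odual_mxnorm (map_mx u (0%R : 'M[E]_0)))%E.
  by apply: le_trans le0 _; apply: ereal_sup_ubound; exists 0%N, 0%R.
set v := fun x : F => \matrix_(i, j) ((map_mx u (0%R : 'M[E]_0)) i j : bop F R[i]^o) x : Mn R 0.
suff le0 : (0 <= Mn_mxnorm (map_mx v (0%R : 'M[F]_0)))%E.
  by apply: le_trans le0 _; apply: ereal_sup_ubound; exists 0%N, 0%R.
apply: (@le_trans _ _ (Num.sqrt 0)%:E); first by rewrite lee_fin sqrtr_ge0.
by apply: ereal_sup_ubound; exists 0%R; rewrite /= ?big_ord0.
Qed.

Lemma product_perturbation (R : realFieldType) (a b k e : R) :
  0 <= a -> 0 <= b -> 0 <= k -> 0 < e ->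
  exists2 d, 0 < d & 4 * ((a + d) * (b + d)) * k + d <= 4 * (a * b) * k + e.
Proof.
move=> a0 b0 k0 e0; pose D := 4 * k * (a + b + 1) + 1.
have D1 : 1 <= D by rewrite /D lerDr !mulr_ge0// !addr_ge0.
have D0 : 0 < D by exact: lt_le_trans D1.
pose d := e / (D * (1 + e)).
have e1 : 0 < 1 + e by rewrite ltr_wpDl ?ltW.
have d0 : 0 < d by rewrite divr_gt0// mulr_gt0.
have d1 : d <= 1.
  rewrite ler_pdivrMr ?mulr_gt0// mul1r; apply: le_trans (_ : 1 * (1 + e) <= _).
    by rewrite mul1r lerDr.
  by rewrite ler_wpM2r// ltW.
have de : d * D <= e.
  rewrite /d mulrAC ler_pdivrMr ?mulr_gt0//.
  by rewrite ler_wpM2l ?(ltW e0)// ler_peMr ?(ltW D0)// lerDl ltW.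
exists d => //.
have : 4 * k * (d * d) <= 4 * k * d.
  by rewrite ler_wpM2l ?mulr_ge0// ler_piMl// ltW.
rewrite /D in de; lra.
Qed.

Theorem corollary1p6 (R : realType) (HE HF : hilbertType R)
    (E : opspace HE) (F : opspace HF)
    (exE : exact_opspace E) (exF : exact_opspace F)
    (u : {linear E -> odual F}) (cbu : completely_bounded u) :
  hilbert_factorable u /\
  (gamma2 u <= 4%:E * (dSK E * dSK F) * cbnorm u)%E.
Proof.
have fin (t : \bar R) : (0 <= t)%E -> (t < +oo)%E -> exists2 r : R, 0 <= r & t = r%:E.
  by case: t => [r| |]//; rewrite lee_fin => r0 _; exists r.
have [a a0 aE] := fin _ (dSK_ge0 E) exE; have [b b0 bE] := fin _ (dSK_ge0 F) exF.
have [k k0 kE] := fin _ (cbnorm_odual_ge0 u) cbu.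
have form e : 0 < e -> exists2 s : psd_form E, (forall x, pnorm s x <= rnorm x) &
    forall x y, rnorm ((u x : bop F R[i]^o) y) <=
      (4 * (a * b) * k + e) * pnorm s x * rnorm y.
  move=> e0; have [d d0 dle] := product_perturbation a0 b0 k0 e0.
  have A0 : 0 < 4 * ((a + d) * (b + d)) * k + d.
    have ad : 0 <= a + d by rewrite addr_ge0// ltW.
    have bd : 0 <= b + d by rewrite addr_ge0// ltW.
    by apply: ltr_wpDl => //; rewrite !mulr_ge0.
  have Er : (dSK E < (a + d)%:E)%E by rewrite aE lte_fin ltrDl.
  have Fs : (dSK F < (b + d)%:E)%E by rewrite bE lte_fin ltrDl.
  have uk : (cbnorm u <= k%:E)%E by rewrite kE.
  have [|s [s1 s2]] := @dominating_form R HE HF E F u _ A0.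
    move=> n x y rho tau rho0 tau0 xc xr yc yr.
    apply: le_trans (grothendieck_exact Er Fs uk k0 rho0 tau0 xc xr yc yr) _.
    by rewrite ler_wpM2r ?mulr_ge0 ?(ltW rho0) ?(ltW tau0)// lerDl ltW.
  exists s => // x y; apply: le_trans (s2 x y) _.
  by rewrite ler_wpM2r ?rnorm_ge0// ler_wpM2r ?pnorm_ge0.
split.
  have [s s1 s2] := form 1 ltr01.
  apply: (@hilbert_factorable_of_form _ _ _ _ _ u s _ _ s1 s2).
  by rewrite addr_ge0// !mulr_ge0.
rewrite aE bE kE -!EFinM; apply/lee_addgt0Pr => e e0; rewrite -EFinD.
have [s s1 s2] := form e e0.
apply: (@gamma2_le_of_form _ _ _ _ _ u s _ _ s1 s2).
by rewrite addr_ge0 ?(ltW e0)// !mulr_ge0.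
Qed.
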